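(* In the radio network model with unknown topology and with collision detection, there is a randomized distributed algorithm that broadcasts $k$ messages from the source to all nodes in $O(D + k\log n + \log^6 n)$ rounds, with high probability.
   Context: Radio network model with collision detection: the network is a connected undirected graph $G=(V,E)$ with $n$ nodes, operating in synchronous rounds. In each round each node either transmits a packet of $B=\Omega(\log n)$ bits or listens. A listening node $v$ receives a packet only if exactly one of its neighbors transmits in that round; if two or more neighbors transmit, $v$ receives a special collision symbol $\top$; if no neighbor transmits it receives nothing. $k$-message broadcast: a designated source node $s$ holds $k$ messages, each of at most $\Theta(B)$ bits, which must all be delivered to every node. $D$ denotes the diameter of $G$. Unknown topology: nodes do not know the graph, but know a polynomial upper bound on $n$ and a constant-factor upper bound on $D$. ''With high probability'' means with probability at least $1-1/n^{c}$ for a constant $c\ge 1$. *)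

(* Defs.v *)
From mathcomp Require Import all_boot all_order all_algebra.
Set Implicit Arguments.
Unset Strict Implicit.
Unset Printing Implicit Defensive.

Definition connected_graph (V : finType) (adj : rel V) : Prop :=
  [/\ symmetric adj, irreflexive adj & forall x y, connect adj x y].

Definition walk (V : finType) (adj : rel V) (d : nat) (x y : V) : bool :=
  [exists p : d.-tuple V, path adj x p && (last x p == y)].

(* The first d < #|V| admitting a walk of length d from x to y. The default
   value #|V| is returned only if y is not reachable from x. *)
Definition dist (V : finType) (adj : rel V) (x y : V) : nat :=
  find (fun d => walk adj d x y) (iota 0 #|V|).

Definition diameter (V : finType) (adj : rel V) : nat :=
  \max_(x : V) \max_(y : V) dist adj x y.

Inductive feedback (B : nat) : Type :=
  | Silence
  | Received of B.-tuple bool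
  | Collision.
Arguments Silence {B}.
Arguments Collision {B}.

(* The code run by every node of an anonymous network with B-bit packets.
   - [init (Some ms)] is the initial state of the source, holding the list of
     messages ms; [init None] is that of every other node.
   - In each round a node draws [ncoins] fresh private fair coins, then
     transmits the packet p if [action] is [Some p] and listens if it is [None].
   - [output] is the list of messages the node has decided on, if any. This
     decision is final. A node may keep taking part in the protocol after it. *)
Record protocol (B : nat) : Type := Protocol {
  state  : Type;
  ncoins : nat;
  init   : option (seq bitseq) -> state;
  action : state -> ncoins.-tuple bool -> option (B.-tuple bool);
  update : state -> ncoins.-tuple bool -> feedback B -> state;
  output : state -> option (seq bitseq);
  output_final : forall st w fb ms,
    output st = Some ms -> output (update st w fb) = Some ms
}.

Definition coins (V : finType) (B : nat) (P : protocol B) : finType :=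
  {ffun V -> (ncoins P).-tuple bool}.

(* What v perceives when [tx u] is the packet transmitted by u, if any. A
   transmitting node perceives nothing. *)
Definition perceive (V : finType) (adj : rel V) (B : nat)
    (tx : V -> option (B.-tuple bool)) (v : V) : feedback B :=
  if tx v is Some _ then Silence else
  match pmap tx [seq u <- enum V | adj v u] with
  | [::] => Silence
  | [:: p] => Received p
  | _ => Collision
  end.

Definition round (V : finType) (adj : rel V) (B : nat) (P : protocol B)
    (conf : V -> state P) (w : coins V P) : V -> state P :=
  let tx u := action (conf u) (w u) in
  fun v => update (conf v) (w v) (perceive adj tx v).

Definition start (V : finType) (s : V) (B : nat) (P : protocol B)
    (ms : seq bitseq) : V -> state P :=
  fun v => init P (if v == s then Some ms else None).

Definition run (V : finType) (adj : rel V) (s : V) (B : nat) (P : protocol B)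
    (ms : seq bitseq) (ws : seq (coins V P)) : V -> state P :=
  foldl (@round V adj B P) (start s P ms) ws.

Definition delivered (V : finType) (adj : rel V) (s : V) (B : nat)
    (P : protocol B) (ms : seq bitseq) (ws : seq (coins V P)) : bool :=
  [forall v : V, output (run adj s ms ws v) == Some ms].

Definition uniform_prob (Omega : finType) (E : pred Omega) : rat :=
  (#|E|%:R / #|Omega|%:R)%R.

(* Since outputs are final, this is the probability that all nodes have decided
   on ms at some point during the first T rounds. *)
Definition success_prob (V : finType) (adj : rel V) (s : V) (B : nat)
    (P : protocol B) (ms : seq bitseq) (T : nat) : rat :=
  uniform_prob (fun ws : T.-tuple (coins V P) => delivered adj s ms ws).

(* All that a node knows besides its initial state: an upper bound N on the
   number of nodes, an upper bound Dhat on the diameter, and the packet size B.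
   Only the source knows the number of messages. *)
Definition algorithm : Type := forall N Dhat B : nat, protocol B.

(* [up_log 2 n] is the ceiling of the binary logarithm of n. *)
Definition broadcast_rounds (C D k n : nat) : nat :=
  C * (D + k * up_log 2 n + up_log 2 n ^ 6).

(* Main.v *)
Require Import Defs.
From mathcomp Require Import all_boot all_order all_algebra all_field.
From mathcomp Require Import zify ring lra.
From Stdlib Require Import Classical ClassicalEpsilon FunctionalExtensionality.
Set Implicit Arguments.
Unset Strict Implicit.
Unset Printing Implicit Defensive.
Import Order.TTheory GRing.Theory Num.Theory.

(* A beep wave assigns to every node its distance from the source. The levels are
   cut into rings of polylogarithmic width, and within each ring a gathering
   spanning tree is built bottom-up with Decay: a parent that collects two
   children of rank r gets rank r + 1, while a child whose potential parents are
   all private is matched with one of them by a collision-free "fast" edge of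
   rank r. Ranks are logarithmic because 2^rank is bounded by the size of the
   subtree, and a potential that shrinks by a constant factor per cycle in
   expectation shows that logarithmically many cycles suffice.

   The messages are cut into batches of packets. In fast rounds a batch travels
   one level per round along paths of fast edges, where time slots separate
   levels modulo 3 and ranks. In slow rounds each node sends Reed-Solomon symbols
   of a batch, repeating one random Decay pattern for every batch; a neighbour
   decodes once it has received enough of them. Each node thus gets batch j in
   stage j + delta, where delta is the distance from the source in a weighted
   graph determined by the tree. This distance changes by at most 1 along an
   edge, so slots indexed by delta modulo 3 separate the senders, and since it
   does not depend on the patterns a union bound over the nodes is enough for any
   number of messages. A path from the source changes rank at most log n times
   per ring, which bounds delta times the stage length by O(D + log^6 n). *)

(** The ring width, about log^3 n, balances two costs. Building the tree takes logarithmically many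
    cycles of logarithmic length for each rank and each pair of consecutive levels; rings work in
    parallel, so this costs log^3 n times the width, which is the log^6 term. In the data phase a
    stage lasts order log^2 n rounds and a ring can cost order log n stages, so the delay is linear
    in D only if rings are at least log^3 n wide.

    Collision detection enters at two points: colliding beeps still count as a beep in the wave, and
    during the tree construction a potential parent can tell one active or answering child from
    several.

    The code needs a field with as many elements as there are frames in a stage, a number of order
    log n. A packet of B bits provides 2^B elements, which may be too few; but then B is of order
    log log n at most, while B is also at least of order log n, so n is bounded by a constant and a
    plain repetition code is good enough. *)

Section Expectation.
Local Open Scope ring_scope.

Definition avg (W : finType) (f : W -> rat) : rat := (\sum_w f w) / #|W|%:R.

Lemma avg_le (W : finType) (f g : W -> rat) :
  (forall w, f w <= g w) -> avg f <= avg g.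
Proof.
by move=> fg; rewrite ler_wpM2r ?invr_ge0 ?ler0n//; apply: ler_sum.
Qed.

Lemma avg_sum (W I : finType) (P : pred I) (f : I -> W -> rat) :
  avg (fun w => \sum_(i | P i) f i w) = \sum_(i | P i) avg (f i).
Proof. by rewrite /avg exchange_big /= mulr_suml. Qed.

Lemma avg_scale (W : finType) (a : rat) (f : W -> rat) :
  avg (fun w => a * f w) = a * avg f.
Proof. by rewrite /avg -mulr_sumr mulrA. Qed.

Lemma avgD (W : finType) (f g : W -> rat) :
  avg (fun w => f w + g w) = avg f + avg g.
Proof. by rewrite /avg big_split /= mulrDl. Qed.

Lemma avg_cst (W : finType) (a : rat) : (0 < #|W|)%N -> avg (fun _ : W => a) = a.
Proof.
move=> W0; rewrite /avg sumr_const -[a *+ _]mulr_natr mulfK //.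
by rewrite pnatr_eq0 -lt0n.
Qed.

Lemma sum_tupleS (T : finType) (n : nat) (f : n.+1.-tuple T -> rat) :
  \sum_w f w = \sum_(a : T) \sum_(w : n.-tuple T) f [tuple of a :: w].
Proof.
rewrite pair_big /=.
rewrite (reindex (fun p : T * n.-tuple T => [tuple of p.1 :: p.2])) //=.
exists (fun w => (thead w, [tuple of behead w])).
  by move=> [a w] _ /=; congr (_, _); apply: val_inj.
by move=> w _; rewrite [RHS](tuple_eta w); apply: val_inj.
Qed.

Lemma avg_tupleS (T : finType) (n : nat) (f : n.+1.-tuple T -> rat) :
  avg f = avg (fun a : T => avg (fun w : n.-tuple T => f [tuple of a :: w])).
Proof.
rewrite /avg sum_tupleS -mulr_suml -mulrA; congr (_ * _).
by rewrite -invfM -natrM !card_tuple expnSr.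
Qed.

Lemma avg_tuple0 (T : finType) (f : 0.-tuple T -> rat) : avg f = f [tuple].
Proof.
rewrite /avg card_tuple expn0 divr1.
rewrite (eq_bigr (fun _ => f [tuple])) => [|w _]; last by rewrite tuple0.
by rewrite sumr_const card_tuple expn0.
Qed.

Lemma avg_prod (V W : finType) (f : V -> W -> rat) :
  avg (fun w : {ffun V -> W} => \prod_v f v (w v)) = \prod_v avg (f v).
Proof.
rewrite /avg -bigA_distr_bigA /= card_ffun big_split /= natrX; congr (_ * _).
by rewrite prodr_const exprVn.
Qed.

(** Invariants of configurations are arbitrary propositions, hence a classical indicator. *)
Definition ind (P : Prop) : rat := if excluded_middle_informative P then 1 else 0.

Lemma ind_true (P : Prop) : P -> ind P = 1.
Proof. by rewrite /ind; case: excluded_middle_informative. Qed.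

Lemma ind_false (P : Prop) : ~ P -> ind P = 0.
Proof. by rewrite /ind; case: excluded_middle_informative. Qed.

Lemma ind_ge0 (P : Prop) : 0 <= ind P.
Proof. by rewrite /ind; case: excluded_middle_informative. Qed.

Lemma ind_le1 (P : Prop) : ind P <= 1.
Proof. by rewrite /ind; case: excluded_middle_informative. Qed.

Lemma ind_mono (P Q : Prop) : (P -> Q) -> ind P <= ind Q.
Proof.
move=> PQ; rewrite {1}/ind; case: excluded_middle_informative => /= [p|_].
  by rewrite ind_true //; apply: PQ.
exact: ind_ge0.
Qed.

End Expectation.

(** * Randomized programs: expectations, sure properties and failure probabilities *)

Section Programs.
Local Open Scope ring_scope.
Variables (W : finType) (S I : Type) (step : I -> S -> W -> S).
Hypothesis W0 : (0 < #|W|)%N.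

(** A program is a list of instructions, each using one fresh uniform draw. Nested averages replace
    a product space, so that composing programs is composing functions. *)
Fixpoint EX (p : seq I) (phi : S -> rat) (c : S) : rat :=
  if p is i :: p' then avg (fun w => EX p' phi (step i c w)) else phi c.

Fixpoint sure (p : seq I) (Q : S -> Prop) (c : S) : Prop :=
  if p is i :: p' then forall w, sure p' Q (step i c w) else Q c.

Lemma EX_cons i p phi c :
  EX (i :: p) phi c = avg (fun w => EX p phi (step i c w)).
Proof. by []. Qed.

Lemma EX_cat p q phi c : EX (p ++ q) phi c = EX p (EX q phi) c.
Proof.
elim: p c => //= i p IH c; rewrite /avg; congr (_ / _).
by apply: eq_bigr => w _; rewrite IH.
Qed.

Lemma sure_cat p q Q c : sure (p ++ q) Q c <-> sure p (sure q Q) c.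
Proof. by elim: p c => //= i p IH c; split=> H w; apply/IH. Qed.

Lemma sure_mono p (Q R : S -> Prop) c :
  (forall d, Q d -> R d) -> sure p Q c -> sure p R c.
Proof.
by move=> QR; elim: p c => [c /QR //|i p IH c /= H w]; apply/IH/H.
Qed.

Lemma sure_flatten (ps : seq (seq I)) (Q : nat -> S -> Prop) c :
  Q 0%N c ->
  (forall j d, (j < size ps)%N -> Q j d -> sure (nth [::] ps j) (Q j.+1) d) ->
  sure (flatten ps) (Q (size ps)) c.
Proof.
elim: ps Q c => [//|p ps IH] Q c Q0 H /=; apply/sure_cat.
have /= := H 0%N c isT Q0; apply: sure_mono => d Q1.
by apply: (IH (fun j => Q j.+1)) => // j e Hj; apply: (H j.+1).
Qed.

Lemma sure_iter p (Q : S -> Prop) n c :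
  Q c -> (forall d, Q d -> sure p Q d) -> sure (flatten (nseq n p)) Q c.
Proof.
move=> Qc H; rewrite -[n in nseq n p](size_nseq n p).
elim: n c Qc => [//|n IH] c Qc /=; apply/sure_cat.
by move: (H c Qc); apply: sure_mono => d; apply: IH.
Qed.

Lemma EX_sure_le p (phi psi : S -> rat) c :
  sure p (fun d => phi d <= psi d) c -> EX p phi c <= EX p psi c.
Proof. by elim: p c => //= i p IH c H; apply: avg_le => w; apply: IH. Qed.

Lemma EX_le p (phi psi : S -> rat) c :
  (forall d, phi d <= psi d) -> EX p phi c <= EX p psi c.
Proof.
by move=> H; elim: p c => //= i p IH c; apply: avg_le => w; apply: IH.
Qed.

Lemma EX_cst p (a : rat) c : EX p (fun=> a) c = a.
Proof.
elim: p c => //= i p IH c; rewrite -[RHS](avg_cst a W0).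
by rewrite /avg; congr (_ / _); apply: eq_bigr => w _; rewrite IH.
Qed.

Lemma EX_bound p phi a c : sure p (fun d => phi d <= a) c -> EX p phi c <= a.
Proof. by move=> H; rewrite -[leRHS](EX_cst p a c); apply: EX_sure_le. Qed.

Lemma EX_scale p a phi c : EX p (fun d => a * phi d) c = a * EX p phi c.
Proof.
elim: p c => //= i p IH c; rewrite -avg_scale /avg; congr (_ / _).
by apply: eq_bigr => w _; rewrite IH.
Qed.

Lemma EXD p phi psi c :
  EX p (fun d => phi d + psi d) c = EX p phi c + EX p psi c.
Proof.
elim: p c => //= i p IH c; rewrite -avgD /avg; congr (_ / _).
by apply: eq_bigr => w _; rewrite IH.
Qed.

(** A triple in which [eps] bounds the probability that the postcondition fails; sequential
    composition is then the union bound. *)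
Definition hoare (P : S -> Prop) (p : seq I) (Q : S -> Prop) (eps : rat) : Prop :=
  forall c, P c -> EX p (fun d => ind (~ Q d)) c <= eps.

Lemma hoare_sure (P Q : S -> Prop) p :
  (forall c, P c -> sure p Q c) -> hoare P p Q 0.
Proof.
move=> H c /H HQ; apply: EX_bound; apply: sure_mono HQ => d Qd.
by rewrite ind_false.
Qed.

Lemma hoare_cat (P Q R : S -> Prop) p q e1 e2 : 0 <= e2 ->
  hoare P p Q e1 -> hoare Q q R e2 -> hoare P (p ++ q) R (e1 + e2).
Proof.
move=> e20 H1 H2 c Pc; rewrite EX_cat.
apply: (@le_trans _ _ (EX p (fun d => ind (~ Q d) + e2) c)).
  apply: EX_le => d; have [Qd|nQd] := excluded_middle_informative (Q d).
    by rewrite ind_false // add0r H2.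
  rewrite ind_true //; apply: (@le_trans _ _ 1); last by rewrite lerDl.
  by rewrite -[leRHS](EX_cst q 1 d); apply: EX_le => ?; apply: ind_le1.
by rewrite EXD EX_cst lerD2r; apply: H1.
Qed.

Lemma hoare_weak (P P' Q Q' : S -> Prop) p e e' :
  (forall c, P' c -> P c) -> (forall c, Q c -> Q' c) -> e <= e' ->
  hoare P p Q e -> hoare P' p Q' e'.
Proof.
move=> PP QQ ee H c /PP /H Hc; apply: le_trans ee; apply: le_trans Hc.
by apply: EX_le => d; apply: ind_mono => nQ' /QQ.
Qed.

Lemma hoare_flatten (ps : seq (seq I)) (Q : nat -> S -> Prop) e : 0 <= e ->
  (forall j, (j < size ps)%N -> hoare (Q j) (nth [::] ps j) (Q j.+1) e) ->
  hoare (Q 0%N) (flatten ps) (Q (size ps)) (e *+ size ps).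
Proof.
move=> e0; elim: ps Q => [|p ps IH] Q H /=.
  by rewrite mulr0n; apply: hoare_sure.
rewrite mulrS; apply: (@hoare_cat _ (Q 1%N)); first by rewrite mulrn_wge0.
  exact: (H 0%N).
by apply: (IH (fun j => Q j.+1)) => j Hj; apply: (H j.+1).
Qed.

Lemma EX_contract p (Inv : S -> Prop) (phi : S -> rat) (rho : rat) n c :
  0 <= rho -> (forall d, Inv d -> sure p Inv d) ->
  (forall d, Inv d -> EX p phi d <= rho * phi d) ->
  Inv c -> EX (flatten (nseq n p)) phi c <= rho ^+ n * phi c.
Proof.
move=> rho0 Hs He; elim: n c => [|n IH] c Ic /=; first by rewrite expr0 mul1r.
rewrite EX_cat exprSr -mulrA.
apply: (@le_trans _ _ (EX p (fun d => rho ^+ n * phi d) c)).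
  apply: EX_sure_le; move: (Hs c Ic); apply: sure_mono => d; exact: IH.
by rewrite EX_scale ler_wpM2l ?exprn_ge0 //; apply: He.
Qed.

(* Markov's inequality: outside [Q] the potential is at least 1. *)
Lemma hoare_contract p (Inv Q : S -> Prop) (phi : S -> rat) (rho a : rat) n :
  0 <= rho -> (forall d, Inv d -> sure p Inv d) ->
  (forall d, Inv d -> EX p phi d <= rho * phi d) ->
  (forall d, 0 <= phi d) ->
  (forall d, Inv d -> ~ Q d -> 1 <= phi d) ->
  hoare (fun d => Inv d /\ phi d <= a) (flatten (nseq n p))
    (fun d => Inv d /\ Q d) (rho ^+ n * a).
Proof.
move=> rho0 Hs He phi0 HQ c [Ic ca].
apply: (@le_trans _ _ (rho ^+ n * phi c)); last by rewrite ler_wpM2l ?exprn_ge0.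
apply: le_trans (EX_contract n rho0 Hs He Ic).
apply: EX_sure_le; apply: sure_mono (sure_iter n Ic Hs) => d Id.
have [Qd|nQd] := excluded_middle_informative (Q d).
  by rewrite ind_false //; apply; split.
by apply: le_trans (ind_le1 _) (HQ d Id nQd).
Qed.

End Programs.

(** A level [l] up to the number of coins is reached with probability 2^-l. One draw thus settles
    the behaviour of a node in a whole Decay cycle, and the sets of transmitters decrease with the
    level. *)
Definition lead (w : seq bool) : nat := find negb w.

(** * Decay: the probability that exactly one node of a set reaches a given level *)

Section Isolation.
Local Open Scope ring_scope.

Definition half_pow (l : nat) : rat := 2^-1 ^+ l.

Lemma half_pow01 l : 0 <= half_pow l <= 1.
Proof. by rewrite /half_pow; apply/andP; split; [apply: exprn_ge0 | apply: exprn_ile1]; lra. Qed.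

Lemma avg_bool (f : bool -> rat) : avg f = (f true + f false) / 2.
Proof. by rewrite /avg card_bool big_bool. Qed.

Lemma avg_lead n l : (l <= n)%N ->
  avg (fun w : n.-tuple bool => (l <= lead w)%N%:R) = half_pow l.
Proof.
elim: n l => [|n IH] [|l] // Hl; rewrite /half_pow ?expr0.
- by rewrite avg_cst // card_tuple expn0.
- by rewrite avg_cst // card_tuple expn_gt0 card_bool.
rewrite avg_tupleS avg_bool /= -/lead.
have -> : avg (fun w : n.-tuple bool => ((l.+1 <= lead (true :: w))%N)%:R : rat)
  = half_pow l by rewrite -(IH l Hl).
have -> : avg (fun w : n.-tuple bool => ((l.+1 <= lead (false :: w))%N)%:R : rat)
  = 0.
  by rewrite avg_cst // card_tuple expn_gt0 card_bool.
by rewrite addr0 exprSr.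
Qed.

(** From l = 1 on, (1 - 2^-l)^(2^l) increases, because (1 - x/2)^2 >= 1 - x, and it starts at 1/4.
    For l = 0 the exponent is 0. *)
Lemma half_pow_comp l : 4^-1 <= (1 - half_pow l) ^+ (2 ^ l - 1).
Proof.
case: l => [|l]; first by rewrite expn0 subnn expr0.
have H : 4^-1 <= (1 - half_pow l.+1) ^+ (2 ^ l.+1).
  elim: l => [|l IH].
    by rewrite /half_pow expn1 expr1 expr2; lra.
  rewrite expnS exprM; apply: le_trans IH _.
  rewrite lerXn2r ?nnegrE //.
  - by have /andP[] := half_pow01 l.+1; lra.
  - by rewrite exprn_ge0 //; have /andP[] := half_pow01 l.+2; lra.
  have -> : half_pow l.+2 = half_pow l.+1 / 2 by rewrite /half_pow [LHS]exprSr.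
  by rewrite expr2; nra.
apply: le_trans H _; apply: ler_wiXn2l; last exact: leq_subr.
  by have /andP[] := half_pow01 l.+1; lra.
by have /andP[] := half_pow01 l.+1; lra.
Qed.

(** Rounding [d] up to a power of two less than doubles it. *)
Lemma half_pow_up_log d : (0 < d)%N -> 2^-1 <= d%:R * half_pow (up_log 2 d).
Proof.
move=> d0.
have h2 : (2 ^ up_log 2 d < 2 * d)%N.
  have [d1|d1] := leqP d 1.
    have -> : d = 1%N by lia.
    by rewrite up_log1.
  have /andP[h _] := up_log_bounds (isT : 1 < 2)%N d1.
  have l0 : (0 < up_log 2 d)%N by rewrite up_log_gt0.
  by rewrite -(prednK l0) expnS; lia.
rewrite /half_pow exprVn.
rewrite ler_pdivlMr ?exprn_gt0 // -natrX mulrC ler_pdivrMr //.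
by rewrite mulrC -natrM ler_nat; lia.
Qed.

Variables (V : finType) (n : nat).
Implicit Types (A B S : {set V}) (w : {ffun V -> n.-tuple bool}).

Definition above (l : nat) (lv : V -> nat) : {set V} := [set u | (l <= lv u)%N].

Lemma avg_isolated S u l : u \in S -> (l <= n)%N ->
  avg (fun w => (S :&: above l (fun v => lead (w v)) == [set u])%:R : rat) =
    half_pow l * (1 - half_pow l) ^+ (#|S| - 1).
Proof.
move=> uS ln.
(* The indicator of the event is a product over the nodes: [u] must reach level [l], the rest of [S]
   must not, and the other nodes are free. Independence then factors the average. *)
pose F (v : V) (x : n.-tuple bool) : rat :=
  if v == u then (l <= lead x)%N%:R
  else if v \in S then 1 + -1 * (l <= lead x)%N%:R else 1.
have card0 : (0 < #|{: n.-tuple bool}|)%N.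
  by rewrite card_tuple expn_gt0 card_bool.
transitivity (avg (fun w => \prod_v F v (w v))).
  rewrite /avg; congr (_ / _); apply: eq_bigr => w _.
  case: eqP => [E|NE].
    rewrite big1 // => v _; rewrite /F; move/setP/(_ v): E.
    rewrite !inE; case: eqP => [-> |_]; first by rewrite uS => /= ->.
    by case: (v \in S) => //= ->; rewrite mulr0 addr0.
  have /existsP[v /eqP Hv] : [exists v, F v (w v) == 0].
    apply: contra_notT NE => /existsPn H.
    apply/setP => v; rewrite !inE; have := H v; rewrite /F.
    case: (v =P u) => [->|_]; first by rewrite uS; case: (l <= _)%N; rewrite ?eqxx.
    by case: (v \in S) => //=; case: (l <= _)%N; rewrite //= mulr1 subrr eqxx.
  by rewrite (bigD1 v) //= Hv mul0r.
rewrite avg_prod (bigD1 u) //=; congr (_ * _).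
  rewrite -(avg_lead ln) /avg; congr (_ / _).
  by apply: eq_bigr => x _; rewrite /F eqxx.
rewrite (eq_bigr (fun v => if v \in S then 1 - half_pow l else 1)); last first.
  move=> v /negbTE vu; rewrite /F vu; case: ifP => _; last by rewrite avg_cst.
  rewrite avgD avg_scale (avg_cst _ card0); congr (_ + _).
  by rewrite avg_lead // mulN1r.
rewrite -big_mkcondr /= prodr_const; congr (_ ^+ _).
rewrite (cardsD1 u S) uS add1n subn1 /=.
by apply: eq_card => v; rewrite !inE.
Qed.

(** The exponent [#|S| - 1] is at most twice [2 ^ l - 1], so [half_pow_comp] is used squared, which
    gives 1/16. *)
Lemma avg_isolated_ge S u l : u \in S -> (l <= n)%N ->
  (#|S| <= 2 * 2 ^ l - 1)%N ->
  half_pow l / 16 <=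
  avg (fun w => (S :&: above l (fun v => lead (w v)) == [set u])%:R : rat).
Proof.
move=> uS ln HS; rewrite avg_isolated //.
have /andP[h0 h1] := half_pow01 l.
apply: ler_wpM2l => //.
have -> : 16^-1 = 4^-1 ^+ 2 :> rat by rewrite expr2; lra.
apply: le_trans (_ : ((1 - half_pow l) ^+ (2 ^ l - 1)) ^+ 2 <= _).
  by rewrite lerXn2r ?nnegrE ?half_pow_comp ?exprn_ge0 // subr_ge0.
rewrite -exprM; apply: ler_wiXn2l; rewrite ?subr_ge0 //; last by lia.
by rewrite gerBl.
Qed.

(** In the main application [A] holds the contenders around one child and [B u] those around a
    second child of [u], so the event makes both children hear [u] in the same round. For different
    [u] in [G] the events exclude each other because [G] lies in [A], hence probabilities add up. As
    [A] and [B u] share [u], their union has at most [2 * 2 ^ l - 1] elements. *)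
Lemma isolation A (G : {set V}) (B : V -> {set V}) l : (l <= n)%N ->
  G \subset A -> (forall u, u \in G -> u \in B u) ->
  (#|A| <= 2 ^ l)%N -> (forall u, u \in G -> #|B u| <= 2 ^ l)%N ->
  #|G|%:R * (half_pow l / 16) <=
  avg (fun w => [exists u in G,
     (A :|: B u) :&: above l (fun v => lead (w v)) == [set u]]%:R : rat).
Proof.
move=> ln GA GB cA cB.
apply: le_trans (_ : avg (fun w => \sum_(u in G)
   ((A :|: B u) :&: above l (fun v => lead (w v)) == [set u])%:R : rat) <= _).
  rewrite avg_sum mulr_natl -sumr_const; apply: ler_sum => u uG.
  apply: avg_isolated_ge => //; first by rewrite inE (subsetP GA).
  rewrite cardsU; have := cA; have := cB u uG.
  have : (0 < #|A :&: B u|)%N.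
    by apply/card_gt0P; exists u; rewrite inE (subsetP GA) // GB.
  by lia.
apply: avg_le => w.
case: existsP => [[u /andP[uG /eqP Eu]]|N]; last first.
  rewrite big1 // => u uG; case: eqP => // E.
  by case: N; exists u; rewrite uG E eqxx.
rewrite (bigD1 u) //= Eu eqxx big1 ?addr0 // => v /andP[vG vu].
case: eqP => // Ev; case/eqP: vu.
have : v \in [set u]; last by rewrite inE => /eqP.
rewrite -Eu inE; apply/andP; split; first by rewrite inE (subsetP GA).
have : v \in [set v] by rewrite inE.
by rewrite -Ev inE => /andP[].
Qed.

(** The level matching the size of [A] suffices: there [#|A|] times 2^-l is at least 1/2, and
    [isolation] contributes the factor 1/16. *)
Lemma isolation1 A : A != set0 -> (up_log 2 #|A| <= n)%N ->
  32^-1 <=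
  avg (fun w => [exists l : 'I_n.+1,
     #|A :&: above l (fun v => lead (w v))| == 1]%:R : rat).
Proof.
rewrite -card_gt0 => A0 ln; set l := up_log 2 #|A|.
have cA : (#|A| <= 2 ^ l)%N by apply: up_logP.
have := @isolation A A (fun=> A) l ln (subxx _) (fun u H => H) cA (fun _ _ => cA).
have -> : 32^-1 = 2^-1 / 16 :> rat by lra.
move=> H; apply: le_trans (le_trans _ H) _.
  by rewrite mulrA ler_wpM2r // half_pow_up_log.
apply: avg_le => w; case: existsP => [[u /andP[uA /eqP E]]|_]; last first.
  by case: existsP.
case: existsP => // -[]; exists (Ordinal (ln : (l < n.+1)%N)).
by rewrite /= -(setUid A) E cards1.
Qed.

End Isolation.

(* The state of a node while two consecutive levels of a ring are processed, the
   upper one consisting of the potential parents of the lower one: its rank;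
   whether it still lacks a parent rank; whether it has, or is, a fast parent;
   whether it is active in the current phase (lower level); whether it contends
   (upper level); whether it has just received a packet; and the random level up
   to which it transmits in the current cycle. *)
Record gst := Gst {
  rk : nat; fre : bool; hf : bool; fr : bool;
  ac : bool; pt : bool; fd : bool; lg : nat }.

(* [GPurge] deactivates the nodes with a neighbour of rank above [r], [GDeg] lets
   contenders count their active neighbours, and in [GEcho] the nodes that have
   received a packet answer. Mode [false] promotes a node answered at least twice
   to rank [r.+1]; mode [true] makes the answered node a fast parent of rank [r]. *)
Inductive ginstr :=
  | GInit of nat & nat
  | GPurge of nat & nat
  | GDeg of nat & bool
  | GTx of nat
  | GEcho of bool & nat & nat.

Definition gtx (i : ginstr) (o : nat) (g : gst) : bool :=
  match i with
  | GInit _ _ => false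
  | GPurge j r => [&& o == j, ~~ fre g & r < rk g]
  | GDeg _ _ => ac g
  | GTx l => pt g && (l <= lg g)
  | GEcho _ _ _ => fd g
  end.

Definition set_ac (g : gst) (x : bool) : gst :=
  Gst (rk g) (fre g) (hf g) (fr g) x (pt g) (fd g) (lg g).

Definition set_fd (g : gst) (x : bool) : gst :=
  Gst (rk g) (fre g) (hf g) (fr g) (ac g) (pt g) x (lg g).

Definition set_pt (g : gst) (x : bool) (d : nat) : gst :=
  Gst (rk g) (fre g) (hf g) (fr g) (ac g) x (fd g) d.

Definition set_rank (g : gst) (r : nat) (f : bool) : gst :=
  Gst r false (hf g) f (ac g) (pt g) (fd g) (lg g).

Definition set_hf (g : gst) : gst :=
  Gst (rk g) (fre g) true (fr g) false (pt g) (fd g) (lg g).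

Definition gupd (i : ginstr) (o : nat) (g : gst) (d k : nat) : gst :=
  match i with
  | GInit j r => set_ac g ((o == j.+1) && (rk g == r))
  | GPurge _ _ => set_ac g (ac g && (k == 0))
  | GDeg j m => set_pt g [&& o == j, fre g & if m then 0 < k else 1 < k] d
  | GTx _ => set_fd g (ac g && (k == 1))
  | GEcho false r l =>
      if [&& pt g, l <= lg g & 1 < k] then set_rank g r.+1 (fr g) else g
  | GEcho true r l =>
      let g' := if [&& pt g, l <= lg g & 0 < k] then set_rank g r true else g in
      if fd g then set_hf g' else g'
  end.

(** * Gathering spanning trees: the construction and its invariants *)

Section Tree.
Variables (V : finType) (adj : rel V) (lam : nat) (off : V -> nat).
Hypothesis adjC : symmetric adj.
Hypothesis cardV : #|V| <= 2 ^ lam.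

Definition heard (tx : V -> bool) (v : V) : nat :=
  if tx v then 0 else minn 2 #|[set u | adj v u & tx u]|.

Definition gconf := V -> gst.
Definition draws := {ffun V -> lam.-tuple bool}.

Definition gstep (i : ginstr) (c : gconf) (w : draws) : gconf :=
  fun v => gupd i (off v) (c v) (lead (w v))
                (heard (fun u => gtx i (off u) (c u)) v).

Definition cycle_body (m : bool) (r : nat) : seq ginstr :=
  flatten [seq [:: GTx l; GEcho m r l] | l <- iota 0 lam.+1].

Definition cycle_a (i r : nat) : seq ginstr :=
  GDeg i false :: cycle_body false r ++ [:: GPurge i r].

Definition cycle_b (i r : nat) : seq ginstr :=
  GDeg i true :: cycle_body true r.

Definition rankp (P i r : nat) : seq ginstr :=
  [:: GInit i r; GPurge i r] ++
  (flatten (nseq P (cycle_a i r)) ++ flatten (nseq P (cycle_b i r))).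

(** Ranks go downwards, so that a parent already ranked outranks all its lower neighbours still to
    come and serves them by slow edges. *)
Definition levelp (P i : nat) : seq ginstr :=
  flatten [seq rankp P i (lam - j) | j <- iota 0 lam.+1].

(** Indices are levels modulo the ring width, so every ring is treated at once, from its bottom pair
    of levels upwards. *)
Definition treep (P w : nat) : seq ginstr :=
  flatten [seq levelp P (w.-2 - j) | j <- iota 0 w.-1].

Implicit Types (c d : gconf) (i r l : nat) (u v x y : V).

(* The gathering spanning tree property: the fast edges of one rank form an
   induced matching, and every other edge to a parent increases the rank. *)
Definition linked c x : bool :=
  if hf (c x) then
    #|[set u | [&& adj x u, (off u).+1 == off x, fr (c u) & rk (c u) == rk (c x)]]| == 1
  else [exists u, [&& adj x u, (off u).+1 == off x & rk (c x) < rk (c u)]].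

Definition nbr v : {set V} := [set u | adj v u].
Definition trans c l : {set V} := [set u | pt (c u) && (l <= lg (c u))].
Definition caught c l : {set V} :=
  [set x | ac (c x) && (#|nbr x :&: trans c l| == 1)].

(** The means of payment that keep ranks logarithmic. A child of rank q carries weight 2^q, released
    once it is no longer active, and a parent of rank q must be covered by 2^q of released weight
    ([inv_weight]). The weight of a level thus stays below the number of nodes at that level and
    deeper. *)
Definition inactive_weight c i r : nat :=
  \sum_(x | off x == i.+1)
     (if (r < rk (c x)) || (rk (c x) == r) && ~~ ac (c x) then 2 ^ rk (c x) else 0).

Definition ranked_weight c i : nat :=
  \sum_(u | (off u == i) && ~~ fre (c u)) 2 ^ rk (c u).

Record below_ok c i : Prop := {
  top_init : forall v, off v < i -> rk (c v) = 0 /\ fre (c v);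
  top_fr : forall v, off v < i -> ~~ fr (c v);
  top_hf : forall v, off v <= i -> ~~ hf (c v);
  red_free : forall u, off u == i -> fre (c u) -> rk (c u) = 0 /\ ~~ fr (c u);
  low_linked : forall x, i.+1 < off x -> linked c x;
  low_weight : \sum_(x | off x == i.+1) 2 ^ rk (c x) <= #|[set x | i < off x]|;
  low_rank : forall x, i < off x -> rk (c x) <= lam }.

(** In mode [true], [inv_mode] counts matched children along with active ones: a new fast parent of
    rank [r] next to a child that is already matched would give it a second candidate parent and
    spoil the induced matching. *)
Record rank_inv (m : bool) i r c : Prop := {
  inv_below : below_ok c i;
  inv_ranked : forall u, off u == i -> ~~ fre (c u) -> r <= rk (c u);
  inv_high : forall x, off x == i.+1 -> r < rk (c x) -> linked c x;
  inv_low : forall x, off x == i.+1 -> rk (c x) < r -> ~~ hf (c x);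
  inv_ac : forall x, ac (c x) -> [/\ off x == i.+1, rk (c x) == r & ~~ hf (c x)];
  inv_ac_free : forall x u, ac (c x) -> adj x u -> off u == i -> fre (c u);
  inv_done : forall x, off x == i.+1 -> rk (c x) == r -> ~~ ac (c x) -> linked c x;
  inv_weight : ranked_weight c i <= inactive_weight c i r;
  inv_mode : if m then
      forall u x y, off u == i -> fre (c u) -> adj u x -> adj u y ->
        off x == i.+1 -> off y == i.+1 -> rk (c x) == r -> rk (c y) == r ->
        ac (c x) || hf (c x) -> ac (c y) || hf (c y) -> x = y
    else forall x, off x == i.+1 -> rk (c x) == r -> ~~ hf (c x) }.

Record rank_done i r c : Prop := {
  done_below : below_ok c i;
  done_ranked : forall u, off u == i -> ~~ fre (c u) -> r <= rk (c u);
  done_high : forall x, off x == i.+1 -> r <= rk (c x) -> linked c x;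
  done_low : forall x, off x == i.+1 -> rk (c x) < r -> ~~ hf (c x);
  done_weight : ranked_weight c i <=
     \sum_(x | (off x == i.+1) && (r <= rk (c x))) 2 ^ rk (c x) }.

Lemma adjE u v : adj u v = adj v u. Proof. exact: adjC. Qed.

Lemma heard_listen (tx : V -> bool) v :
  ~~ tx v -> heard tx v = minn 2 #|[set u | adj v u & tx u]|.
Proof. by rewrite /heard => /negbTE ->. Qed.

Definition agree c d : Prop := forall v,
  [/\ rk (c v) = rk (d v), fre (c v) = fre (d v), hf (c v) = hf (d v) &
      fr (c v) = fr (d v)] /\ ac (c v) = ac (d v).

Lemma agree_linked c d x : agree c d -> linked c x = linked d x.
Proof.
move=> E; rewrite /linked; have [[-> _ -> _] _] := E x; case: ifP => _.
  congr (_ == _); apply: eq_card => u; rewrite !inE.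
  by have [[-> _ _ ->] _] := E u.
by apply: eq_existsb => u; have [[-> _ _ _] _] := E u.
Qed.

Lemma agree_below c d i : agree c d -> below_ok c i -> below_ok d i.
Proof.
move=> E H; split=> [v|v|v|u|x||x].
- by have [[<- <- _ _] _] := E v; apply: (top_init H).
- by have [[_ _ _ <-] _] := E v; apply: (top_fr H).
- by have [[_ _ <- _] _] := E v; apply: (top_hf H).
- by have [[<- <- _ <-] _] := E u; apply: (red_free H).
- by rewrite -(agree_linked x E); apply: (low_linked H).
- rewrite (eq_bigr (fun x => 2 ^ rk (c x))) ?(low_weight H) // => x _.
  by have [[-> _ _ _] _] := E x.
- by have [[<- _ _ _] _] := E x; apply: (low_rank H).
Qed.

Lemma agree_inv m c d i r : agree c d -> rank_inv m i r c -> rank_inv m i r d.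
Proof.
move=> E H; split.
- exact: agree_below E (inv_below H).
- by move=> u; have [[<- <- _ _] _] := E u; apply: (inv_ranked H).
- by move=> x; rewrite -(agree_linked x E); have [[<- _ _ _] _] := E x; apply: (inv_high H).
- by move=> x; have [[<- _ <- _] _] := E x; apply: (inv_low H).
- by move=> x; have [[<- _ <- _] <-] := E x; apply: (inv_ac H).
- by move=> x u; have [_ <-] := E x; have [[_ <- _ _] _] := E u; apply: (inv_ac_free H).
- move=> x; rewrite -(agree_linked x E); have [[<- _ _ _] <-] := E x.
  exact: (inv_done H).
- have -> : ranked_weight d i = ranked_weight c i.
    apply: eq_big => u; first by have [[_ -> _ _] _] := E u.
    by have [[-> _ _ _] _] := E u.
  have -> : inactive_weight d i r = inactive_weight c i r; last exact: inv_weight H.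
  by apply: eq_bigr => x _; have [[-> _ _ _] ->] := E x.
- have := inv_mode H; case: m H => [_ H u x y|_ H x].
    have [[<- _ <- _] <-] := E x; have [[<- _ <- _] <-] := E y.
    by have [[_ <- _ _] _] := E u; apply: H.
  by have [[<- _ <- _] _] := E x; apply: H.
Qed.

Lemma in_caught c l x :
  (x \in caught c l) = ac (c x) && (#|nbr x :&: trans c l| == 1).
Proof. by rewrite inE. Qed.

Lemma sure_body m r (Q : nat -> gconf -> Prop) c : Q 0 c ->
  (forall l d, l <= lam -> Q l d -> forall w w',
     Q l.+1 (gstep (GEcho m r l) (gstep (GTx l) d w) w')) ->
  sure gstep (cycle_body m r) (Q lam.+1) c.
Proof.
move=> Q0 HQ; rewrite /cycle_body.
set ps := map _ _; have sz : size ps = lam.+1 by rewrite size_map size_iota.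
rewrite -sz; apply: sure_flatten => // j d; rewrite sz => Hj Qj.
rewrite (nth_map 0) ?size_iota // nth_iota // add0n /= => w w'.
exact: HQ.
Qed.

(* Transmitters and active nodes lie on different levels, so both sides listen
   when the other one transmits. *)
Definition apart c i : Prop :=
  (forall x, ac (c x) -> off x == i.+1) /\ (forall u, pt (c u) -> off u == i).

Lemma apart_ac_pt c i v : apart c i -> ac (c v) -> pt (c v) = false.
Proof.
move=> [Ha Hp] /Ha /eqP E; apply/negP => /Hp /eqP E'.
by rewrite E' in E; lia.
Qed.

Lemma fd_GTx c i l w v : apart c i ->
  fd (gstep (GTx l) c w v) = (v \in caught c l).
Proof.
move=> Hc; rewrite in_caught /gstep /=; case Ev : (ac (c v)) => //=.
rewrite heard_listen /= ?(apart_ac_pt Hc Ev) //.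
have -> : [set u | adj v u & pt (c u) && (l <= lg (c u))] = nbr v :&: trans c l.
  by apply/setP => u; rewrite !inE.
by rewrite /minn; case: ltngtP => // ?; apply/esym/negbTE; lia.
Qed.

Lemma heard_echo c i l m r w v : apart c i -> pt (c v) ->
  heard (fun u => gtx (GEcho m r l) (off u) (gstep (GTx l) c w u)) v =
    minn 2 #|nbr v :&: caught c l|.
Proof.
move=> Hc pv; rewrite heard_listen; last first.
  rewrite [gtx _ _ _](fd_GTx l w v Hc) in_caught negb_and.
  by case E: (ac (c v)) => //; rewrite (apart_ac_pt Hc E) in pv.
congr minn; apply: eq_card => u; rewrite !inE [gtx _ _ _](fd_GTx l w u Hc).
by rewrite in_caught.
Qed.

Definition prom c l u : bool := (u \in trans c l) && (1 < #|nbr u :&: caught c l|).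
Definition promoted c n u : bool := has (fun l => prom c l u) (iota 0 n).

(** In mode [false] activity and contention do not change between levels, so the outcome is
    expressed by the configuration [c] at the start of the cycle. *)
Record after_a r c n d : Prop := {
  aa_hf : forall v, hf (d v) = hf (c v) /\ fr (d v) = fr (c v);
  aa_ac : forall v, [/\ ac (d v) = ac (c v), pt (d v) = pt (c v) & lg (d v) = lg (c v)];
  aa_rk : forall v, rk (d v) = (if promoted c n v then r.+1 else rk (c v));
  aa_fre : forall v, fre (d v) = ~~ promoted c n v && fre (c v) }.

Lemma body_a i r c : apart c i ->
  sure gstep (cycle_body false r) (after_a r c lam.+1) c.
Proof.
move=> Hc; apply: sure_body; first by split.
move=> l d _ [Hhf Hac Hrk Hfre] w w'.
have Hd : apart d i.
  case: Hc => Ha Hp; split=> v; have [ea ep _] := Hac v; rewrite ?ea ?ep;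
    [exact: Ha | exact: Hp].
have Et : trans d l = trans c l.
  by apply/setP => u; rewrite !inE; have [_ -> ->] := Hac u.
have Ec : caught d l = caught c l.
  by apply/setP => u; rewrite !in_caught Et; have [-> _ _] := Hac u.
have Ep v : promoted c l.+1 v = promoted c l v || prom c l v.
  by rewrite /promoted -addn1 iotaD has_cat /= orbF add0n.
have E v : [&& pt (d v), l <= lg (d v)
    & 1 < heard (fun u => gtx (GEcho false r l) (off u) (gstep (GTx l) d w u)) v]
    = prom c l v.
  rewrite /prom -Et -Ec inE andbA; case pv : (pt (d v)) => //=.
  by case: (_ <= _) => //=; rewrite (heard_echo l false r w Hd pv) leq_min ltnSn.
split=> v; rewrite [gstep (GEcho _ _ _) _ _ v]/gstep [gupd _ _ _ _ _]/=.
- by rewrite E; have [? ?] := Hhf v; case: (prom c l v); split.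
- by rewrite E; have [? ? ?] := Hac v; case: (prom c l v); split.
- rewrite E Ep; case: (prom c l v); first by rewrite orbT.
  by rewrite orbF Hrk.
- rewrite E Ep; case: (prom c l v); first by rewrite orbT.
  by rewrite orbF Hfre.
Qed.

Definition children c n u : {set V} :=
  [set x in nbr u | ac (c x) &&
     has (fun l => nbr x :&: trans c l == [set u]) (iota 0 n)].

(* The sets of transmitters are nested, so during a cycle a listener receives
   from at most one node. *)
Lemma children_unique c n x u u' :
  x \in children c n u -> x \in children c n u' -> u = u'.
Proof.
wlog H : u u' / forall l l', nbr x :&: trans c l = [set u] ->
    nbr x :&: trans c l' = [set u'] -> l <= l' -> u = u'.
  move=> W; apply: W => l l' E E' ll'.
  have : u' \in [set u'] by rewrite inE.
  rewrite -E' !inE => /and3P[a b d].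
  have : u' \in nbr x :&: trans c l by rewrite !inE a b (leq_trans ll').
  by rewrite E inE => /eqP.
rewrite !inE => /and3P[_ _ /hasP[l _ /eqP E]] /and3P[_ _ /hasP[l' _ /eqP E']].
have [ll'|ll'] := leqP l l'; first exact: H E E' ll'.
have : u \in [set u] by rewrite inE.
rewrite -E !inE => /and3P[a b d].
have : u \in nbr x :&: trans c l' by rewrite !inE a b (leq_trans (ltnW ll')).
by rewrite E' inE => /eqP.
Qed.

Lemma promoted_children c n u : promoted c n u -> 1 < #|children c n u|.
Proof.
case/hasP => l Hl /andP[ul H]; apply: leq_trans H _; apply: subset_leq_card.
apply/subsetP => x; rewrite inE in_caught => /and3P[ux ax /cards1P[u' E]].
rewrite inE ux ax /=; apply/hasP; exists l => //; rewrite E.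
have : u \in nbr x :&: trans c l.
  by rewrite inE ul andbT !inE adjE; rewrite inE in ux.
by rewrite E inE => /eqP ->.
Qed.

(** Double counting: a promoted node has two children that heard only it, and by [children_unique]
    no child is counted for two nodes. [Q] will be the children silenced by the closing purge. *)
Lemma promoted_count c n (Q : pred V) :
  (forall x u, ac (c x) -> adj x u -> promoted c n u -> Q x) ->
  2 * #|[set u | promoted c n u]| <= #|[set x | Q x]|.
Proof.
move=> HQ.
apply: (@leq_trans (\sum_(u | promoted c n u) \sum_(x | x \in children c n u) 1)).
  rewrite mulnC -sum_nat_const (eq_bigl (promoted c n)); last first.
    by move=> u; rewrite inE.
  by apply: leq_sum => u; rewrite sum1_card; apply: promoted_children.
rewrite (exchange_big_dep Q) /=; last first.
  move=> u x Pu; rewrite inE => /and3P[ux ax _]; apply: (HQ x u) => //.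
  by rewrite adjE; rewrite inE in ux.
rewrite -sum1_card [leqRHS](eq_bigl Q); last by move=> x; rewrite inE.
apply: leq_sum => x _; rewrite sum1_card.
apply/card_le1_eqP => u u' /andP[_ a] /andP[_ b]; exact: children_unique b a.
Qed.

(** Promoted nodes had rank 0 and were no fast parents, so no link existing before relied on them,
    and they do not become fast parents either. *)
Lemma linked_promote c d r x (Pm : pred V) :
  (forall v, hf (d v) = hf (c v) /\ fr (d v) = fr (c v)) ->
  (forall v, rk (d v) = if Pm v then r else rk (c v)) ->
  (forall v, Pm v -> rk (c v) = 0 /\ ~~ fr (c v)) -> ~~ Pm x ->
  linked c x -> linked d x.
Proof.
move=> Hhf Hrk HP nPx; rewrite /linked Hrk (negbTE nPx).
have [-> _] := Hhf x; case: ifP => _ => [/eqP <-|/existsP[u /and3P[a b h]]].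
  apply/eqP/eq_card => u; rewrite !inE Hrk; have [_ ->] := Hhf u.
  by case: ifP => // /HP[_ /negbTE ->]; rewrite !andbF.
apply/existsP; exists u; rewrite a b Hrk /=; case: ifP => // /HP[E _].
by rewrite E in h.
Qed.

(** * First phase of a rank: promotion of parents with several active children *)

Definition actv c : {set V} := [set x | ac (c x)].

Definition contender c i u : bool :=
  [&& off u == i, fre (c u) & 1 < #|nbr u :&: actv c|].

Lemma minn2_eq0 k : (minn 2 k == 0) = (k == 0).
Proof. by apply/eqP/eqP; lia. Qed.

Lemma deg_pt m i r c w u : rank_inv m i r c ->
  pt (gstep (GDeg i m) c w u) =
    [&& off u == i, fre (c u) &
        if m then 0 < #|nbr u :&: actv c| else 1 < #|nbr u :&: actv c|].
Proof.
move=> H; rewrite /gstep /=; case: eqP => //= Eu; congr (_ && _).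
rewrite heard_listen /=; last first.
  by apply/negP => /(inv_ac H)[/eqP E _ _]; lia.
have -> : [set x | adj u x & ac (c x)] = nbr u :&: actv c.
  by apply/setP => x; rewrite !inE.
by case: m {H}; rewrite leq_min.
Qed.

Lemma deg_inv m i r c w : rank_inv m i r c ->
  rank_inv m i r (gstep (GDeg i m) c w) /\ apart (gstep (GDeg i m) c w) i.
Proof.
move=> H; have H' : rank_inv m i r (gstep (GDeg i m) c w) by apply: agree_inv H.
split=> //; split=> [x /(inv_ac H')[] //|u].
by rewrite (deg_pt w u H) => /and3P[].
Qed.

(** Before the cycle an active child has only free neighbours on the level above, so exactly the
    nodes promoted in this cycle can silence it in the final purge. *)
Lemma cycle_a_rest i r c w (c0 := gstep (GDeg i false) c w) :
  rank_inv false i r c ->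
  sure gstep (cycle_body false r ++ [:: GPurge i r])
    (fun d => [/\ rank_inv false i r d,
       forall v, fre (d v) = ~~ promoted c0 lam.+1 v && fre (c v) &
       forall v, ac (d v) =
         ac (c v) && ~~ [exists u, adj v u && promoted c0 lam.+1 u]]) c0.
Proof.
move=> H; have [H0 Hap] := deg_inv w H; rewrite -/c0 in H0 Hap.
apply/sure_cat; apply: sure_mono (body_a r Hap) => d1 [Ahf Aac Ark Afre] /= w'.
set d := gstep _ d1 w'; set Pm := promoted c0 lam.+1.
have PmP v : Pm v -> [/\ off v == i, fre (c v), rk (c v) = 0 & ~~ fr (c v)].
  move=> /hasP[l _ /andP[]]; rewrite inE => /andP[+ _ _].
  rewrite (deg_pt w v H) => /and3P[ov fv _].
  by have [? ?] := red_free (inv_below H) ov fv; split.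
have Poff x : off x != i -> ~~ Pm x.
  by move=> ox; apply/negP => /PmP[E _ _ _]; rewrite E in ox.
have Dhf v : hf (d v) = hf (c v) /\ fr (d v) = fr (c v) by apply: (Ahf v).
have Drk v : rk (d v) = if Pm v then r.+1 else rk (c v) by apply: (Ark v).
have Dfre v : fre (d v) = ~~ Pm v && fre (c v) by apply: (Afre v).
have Dac v : ac (d v) = ac (c v) && ~~ [exists u, adj v u && Pm u].
  rewrite /d /gstep [ac _]/=; have [-> _ _] := Aac v.
  rewrite [ac (c0 v)]/=; case av : (ac (c v)) => //=.
  have [/eqP ov _ _] := inv_ac H av.
  rewrite heard_listen /=; last by rewrite ov; lia.
  rewrite minn2_eq0; set S := [set u | _].
  have -> : S = [set u | adj v u & Pm u].
    apply/setP => u; rewrite !inE; case avu : (adj v u) => //=.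
    rewrite (Afre u) (Ark u) -/(Pm u) negb_and negbK.
    case Pu : (Pm u) => /=; first by have [-> _ _ _] := PmP u Pu; rewrite ltnSn.
    by case: eqP => //= /eqP ou; rewrite [fre _](inv_ac_free H av avu ou).
  rewrite cards_eq0; apply/eqP/idP => [E|/existsPn E].
    by apply/existsPn => u; move/setP/(_ u): E; rewrite !inE => ->.
  by apply/setP => u; rewrite !inE; apply/negbTE/E.
have Hm : forall x, off x == i.+1 -> rk (c x) == r -> ~~ hf (c x) := inv_mode H.
have Dlink x : off x != i -> linked c x -> linked d x.
  move=> ox; apply: (linked_promote Dhf Drk) => [v /PmP[]//|]; exact: Poff.
split=> //; split.
- split=> [v ov|v ov|v ov|u ou|x ox||x ox].
  + have nP : ~~ Pm v by apply: Poff; lia.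
    by rewrite Drk Dfre (negbTE nP) /=; apply: (top_init (inv_below H)).
  + by have [_ ->] := Dhf v; apply: (top_fr (inv_below H)).
  + by have [-> _] := Dhf v; apply: (top_hf (inv_below H)).
  + rewrite Dfre => /andP[nP fu]; rewrite Drk (negbTE nP); have [_ ->] := Dhf u.
    exact: (red_free (inv_below H)).
  + by apply: Dlink; [lia | apply: (low_linked (inv_below H))].
  + rewrite (eq_bigr (fun x => 2 ^ rk (c x))) ?(low_weight (inv_below H)) // => x ox.
    by rewrite Drk (negbTE (Poff x _)) //; lia.
  + by rewrite Drk (negbTE (Poff x _)) ?(low_rank (inv_below H)) //; lia.
- move=> u ou; rewrite Dfre Drk negb_and negbK; case: (Pm u) => //=.
  exact: (inv_ranked H).
- move=> x ox; have nP : ~~ Pm x by apply: Poff; lia.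
  rewrite Drk (negbTE nP) => h; apply: Dlink; first lia.
  exact: (inv_high H).
- move=> x ox; have nP : ~~ Pm x by apply: Poff; lia.
  by rewrite Drk (negbTE nP); have [-> _] := Dhf x; apply: (inv_low H).
- move=> x; rewrite Dac => /andP[/(inv_ac H)[ox rx hx] _].
  by rewrite Drk (negbTE (Poff x _)) //; [have [-> _] := Dhf x; split | lia].
- move=> x u; rewrite Dac Dfre => /andP[ax /existsPn E] xu ou.
  by have := E u; rewrite xu /= => -> /=; apply: (inv_ac_free H ax).
- move=> x ox; have nP : ~~ Pm x by apply: Poff; lia.
  rewrite Drk Dac (negbTE nP) negb_and negbK => rx /orP[nax|/existsP[u /andP[xu Pu]]].
    by apply: Dlink; [lia | apply: (inv_done H)].
  have := Hm x ox rx; rewrite /linked; have [-> _] := Dhf x => /negbTE ->.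
  apply/existsP; exists u; rewrite xu !Drk Pu (negbTE nP).
  by have [/eqP -> _ _ _] := PmP u Pu; rewrite eq_sym ox /= (eqP rx).
- have W1 : ranked_weight d i = ranked_weight c i + #|[set u | Pm u]| * 2 ^ r.+1.
    rewrite /ranked_weight (bigID Pm) /= addnC; congr (_ + _).
      apply: eq_big => u.
        rewrite Dfre; case Pu: (Pm u); rewrite ?andbT // andbF.
        by have [_ -> _ _] := PmP u Pu; rewrite andbF.
      by rewrite Drk => /andP[_ /negbTE ->].
    rewrite -sum_nat_const; apply: eq_big => u.
      rewrite inE Dfre; case Pu: (Pm u); rewrite ?andbF //=.
      by have [-> _ _ _] := PmP u Pu.
    by rewrite Drk => /andP[_ ->].
  (* The silenced children pay for the promotions: each promotion costs [2 ^ r.+1], the weight of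
     two children of rank [r]. *)
  pose Q x := ac (c x) && ~~ ac (d x).
  have W2 : inactive_weight d i r = inactive_weight c i r + #|[set x | Q x]| * 2 ^ r.
    have -> : #|[set x | Q x]| * 2 ^ r = \sum_(x | off x == i.+1) if Q x then 2 ^ r else 0.
      rewrite -sum_nat_const -big_mkcondr; apply: eq_bigl => x; rewrite inE.
      rewrite /Q; case ax: (ac (c x)); rewrite ?andbF //=.
      by have [-> _ _] := inv_ac H ax.
    rewrite -big_split; apply: eq_bigr => x ox.
    have nP : ~~ Pm x by apply: Poff; lia.
    rewrite Drk (negbTE nP) /Q Dac; case ax: (ac (c x)) => /=; last by rewrite addn0.
    have [_ /eqP -> _] := inv_ac H ax.
    by rewrite ltnn eqxx /=; case: [exists u, _].
  have HQ : 2 * #|[set u | Pm u]| <= #|[set x | Q x]|.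
    apply: promoted_count => x u ax xu Pu; rewrite /Q Dac [ac (c x)]ax /= negbK.
    by apply/existsP; exists u; rewrite xu.
  rewrite W1 W2 leq_add ?(inv_weight H) // expnS mulnA leq_mul2r.
  by rewrite mulnC HQ orbT.
- move=> x ox; have nP : ~~ Pm x by apply: Poff; lia.
  by rewrite Drk (negbTE nP); have [-> _] := Dhf x; apply: Hm.
Qed.

Lemma sum1_set (P : pred V) : \sum_(x | P x) 1 = #|[set x | P x]|.
Proof. by rewrite -sum1_card; apply: eq_bigl => x; rewrite inE. Qed.

Definition contenders c i : {set V} := [set u | contender c i u].

(* Every edge counted here disappears with constant probability, except possibly
   the one from [u] to its active neighbour of strictly least degree; as [u] has at
   least two active neighbours, this concerns at most half of the edges. *)
Definition pot_a i c : nat := \sum_(u | contender c i u) #|nbr u :&: actv c|.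

Lemma up_log_card (A : {set V}) : up_log 2 #|A| <= lam.
Proof. by apply: up_log_min => //; apply: leq_trans (max_card _) cardV. Qed.

Section Contraction.
Variables (i r : nat) (c : gconf).
Hypothesis Hc : rank_inv false i r c.
Let PT := contenders c i.
Let dg x := #|nbr x :&: PT|.
Let c0 (w : draws) := gstep (GDeg i false) c w.
Let purged w x := [exists u, adj x u && promoted (c0 w) lam.+1 u].

(** A second child [y] whose surroundings are no more crowded than those of [x]: the level suited to
    [x] then isolates [u] around [y] too. *)
Let witness u x y := [&& y \in nbr u, y \in actv c, y != x & dg y <= dg x].
Let good u x := [exists y, witness u x y].

Let pot_aE : pot_a i c = \sum_(x | ac (c x)) dg x.
Proof.
rewrite /pot_a (eq_bigr (fun u => \sum_(x | (x \in nbr u) && (ac (c x))) 1)).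
  rewrite (exchange_big_dep (fun x => ac (c x))) /=; last by move=> u x _ /andP[].
  apply: eq_bigr => x ax; rewrite sum1_set; apply: eq_card => u.
  by rewrite !inE ax andbT adjE andbC.
by move=> u _; rewrite sum1_set; apply: eq_card => x; rewrite !inE.
Qed.

Let trans_c0 w l : trans (c0 w) l = PT :&: above l (fun v => lead (w v)).
Proof. by apply/setP => u; rewrite !inE (deg_pt w u Hc). Qed.

(** A child without witness has strictly fewer contenders around it than every other active
    neighbour of [u], so there is at most one such child, while a contender has at least two active
    neighbours. *)
Let good_count u : contender c i u ->
  #|nbr u :&: actv c| <= 2 * #|[set x in nbr u :&: actv c | good u x]|.
Proof.
move=> /and3P[_ _ H].
have : #|nbr u :&: actv c :\: [set x in nbr u :&: actv c | good u x]| <= 1.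
  apply/card_le1_eqP => x y; rewrite !inE.
  move=> /andP[gx /andP[ux ax]] /andP[gy /andP[uy ay]].
  apply/eqP; apply: contraT => xy.
  have [h|h] := leqP (dg x) (dg y).
    move: gy; rewrite uy ay /= => /existsPn/(_ x).
    by rewrite /witness !inE ux ax h ?andbT eq_sym xy.
  move: gx; rewrite ux ax /= => /existsPn/(_ y).
  by rewrite /witness !inE uy ay (ltnW h) ?andbT xy.
set S := [set x in _ | _]; rewrite cardsD.
have -> : nbr u :&: actv c :&: S = S by apply/setIidPr; rewrite /S setIdE subsetIl.
lia.
Qed.

Local Open Scope ring_scope.

(** If [u] is the only transmitter around both [x] and its witness, two answers reach [u], which is
    promoted and silences [x]. At the level where 2^l is about [dg x], [isolation] gives 1/16 per
    good [u], and [half_pow_up_log] the factor 1/2. *)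
Let purge_prob x : ac (c x) ->
  #|[set u in nbr x :&: PT | good u x]|%:R / 32 <=
  (dg x)%:R * avg (fun w => (purged w x)%:R : rat).
Proof.
move=> ax; set G := [set u in _ | _].
have [G0|G0] := posnP #|G|.
  rewrite G0 mul0r mulr_ge0 // /avg mulr_ge0 ?invr_ge0 // sumr_ge0 //.
have dx : (0 < dg x)%N.
  apply: leq_trans G0 _; apply: subset_leq_card; apply/subsetP => u.
  by rewrite inE => /andP[].
set l := up_log 2 (dg x); pose y u := odflt x [pick y | witness u x y].
have yP u : u \in G -> witness u x (y u).
  rewrite inE => /andP[_ /existsP[z Hz]]; rewrite /y.
  by case: pickP => [//|/(_ z)]; rewrite Hz.
have lx : (dg x <= 2 ^ l)%N by apply: up_logP.
have := @isolation V lam (nbr x :&: PT) G (fun u => nbr (y u) :&: PT) l.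
rewrite up_log_card => /(_ isT) H.
apply: le_trans (_ : (dg x)%:R * (#|G|%:R * (half_pow l / 16)) <= _).
  have := half_pow_up_log dx; rewrite -/l => Hl.
  have -> : (dg x)%:R * (#|G|%:R * (half_pow l / 16)) =
     (#|G|%:R * ((dg x)%:R * half_pow l)) / 16 :> rat by ring.
  have g0 : 0 <= #|G|%:R :> rat by [].
  have : #|G|%:R * 2^-1 <= #|G|%:R * ((dg x)%:R * half_pow l) by rewrite ler_wpM2l.
  by lra.
apply: ler_wpM2l => //; apply: le_trans (H _ _ lx _) _.
- by apply/subsetP => u; rewrite inE => /andP[].
- move=> u uG; have /and4P[uy _ _ _] := yP u uG.
  move: uG; rewrite !inE => /andP[/andP[_ ->] _]; rewrite andbT adjE.
  by rewrite inE in uy.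
- by move=> u /yP/and4P[_ _ _ h]; apply: leq_trans h lx.
apply: avg_le => w; rewrite ler_nat; set e := [exists u in G, _].
suff : e -> purged w x by case: e; case: (purged w x) => // /(_ isT).
case/existsP => u /andP[uG /eqP E].
have /and4P[uy ay yx _] := yP u uG.
have [ux uPT] : u \in nbr x /\ u \in PT.
  by move: uG; rewrite inE => /andP[]; rewrite inE => /andP[].
have uab : u \in above l (fun v => lead (w v)).
  by have : u \in [set u] := set11 u; rewrite -E inE => /andP[].
have Esub (A : {set V}) : u \in A -> A \subset (nbr x :&: PT) :|: (nbr (y u) :&: PT) ->
    A :&: above l (fun v => lead (w v)) = [set u].
  move=> uA sA; apply/setP => v; apply/idP/idP.
    by rewrite in_setI => /andP[/(subsetP sA) vA vab]; rewrite -E in_setI vA.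
  by rewrite in_set1 => /eqP ->; rewrite in_setI uA.
apply/existsP; exists u; rewrite inE in ux; rewrite ux /=.
apply/hasP; exists l; first by rewrite mem_iota /= add0n ltnS up_log_card.
rewrite /prom trans_c0 inE uPT uab /=.
have sub : [set x; y u] \subset nbr u :&: caught (c0 w) l.
  apply/subsetP => z; rewrite !inE trans_c0 => /orP[/eqP -> | /eqP ->].
    rewrite adjE ux [ac _]ax /= setIA Esub ?cards1 ?subsetUl // !inE ux.
    by rewrite -[_ && _]/(contender _ _ _); rewrite inE in uPT.
  rewrite inE in uy; rewrite inE in ay.
  rewrite uy [ac _]ay /= setIA Esub ?cards1 ?subsetUr // !inE adjE uy.
  by rewrite inE in uPT.
by apply: leq_trans (subset_leq_card sub); rewrite cards2 eq_sym yx.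
Qed.

(** Seen from the children, the potential sums [dg x] over the active ones, so its expected loss is
    [dg x] times the purge probability. That is 1/32 per good edge, and at least half of the edges
    are good: hence 1/64. *)
Lemma cycle_a_contract :
  EX gstep (cycle_a i r) (fun d => (pot_a i d)%:R) c <= 63 / 64 * (pot_a i c)%:R.
Proof.
have W0 : (0 < #|{: draws}|)%N.
  by rewrite card_ffun card_tuple card_bool expn_gt0 expn_gt0.
rewrite /cycle_a EX_cons.
apply: le_trans (_ : avg (fun w : draws => \sum_(x | ac (c x))
   ((dg x)%:R + (- (dg x)%:R) * (purged w x)%:R)) <= _).
  apply: avg_le => w; apply: (EX_bound W0).
  apply: sure_mono (cycle_a_rest w Hc) => d [_ Hf Ha].
  have Asub : actv d \subset actv c.
    by apply/subsetP => x; rewrite !inE Ha => /andP[].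
  apply: le_trans (_ : (\sum_(x | ac (c x)) (dg x * ~~ purged w x))%N%:R <= _); last first.
    rewrite natr_sum; apply: ler_sum => x _; rewrite natrM.
    by case: (purged w x) => /=; rewrite ?mulr1 ?mulr0 ?addr0 ?addrN.
  rewrite ler_nat /pot_a.
  apply: leq_trans (_ : \sum_(u | contender c i u)
     \sum_(x | (x \in nbr u) && ac (c x)) ~~ purged w x <= _)%N.
    rewrite (big_mkcond (contender d i)) [leqRHS](big_mkcond (contender c i)) /=.
    apply: leq_sum => u _; case: ifP => [/and3P[ou]|//].
    rewrite Hf => /andP[_ fu] h; rewrite /contender ou fu /=.
    rewrite (leq_trans h) ?subset_leq_card ?setIS //.
    rewrite -sum1_card [leqRHS]big_mkcond [leqLHS]big_mkcond /=.
    apply: leq_sum => x _; rewrite !inE Ha; case: (adj u x) => //=.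
    by case: (ac (c x)) => //=; rewrite /purged; case: [exists u, _].
  rewrite (exchange_big_dep (fun x => ac (c x))) /=; last by move=> u x _ /andP[].
  apply: leq_sum => x ax; rewrite sum_nat_const leq_mul2r; apply/orP; right.
  apply: subset_leq_card; apply/subsetP => u.
  rewrite unfold_in => /and3P[cu xu _]; rewrite !inE adjE cu.
  by rewrite inE in xu; rewrite xu.
rewrite avg_sum.
apply: le_trans (_ : \sum_(x | ac (c x))
   ((dg x)%:R - #|[set u in nbr x :&: PT | good u x]|%:R / 32) <= _).
  apply: ler_sum => x ax; rewrite avgD avg_scale avg_cst // mulNr lerD2l lerN2.
  exact: purge_prob.
rewrite sumrB -natr_sum -pot_aE -mulr_suml -natr_sum.
suff : (pot_a i c <= 2 * \sum_(x | ac (c x)) #|[set u in nbr x :&: PT | good u x]|)%N.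
  rewrite -(ler_nat rat) natrM; lra.
have -> : (\sum_(x | ac (c x)) #|[set u in nbr x :&: PT | good u x]| =
   \sum_(u | contender c i u) #|[set x in nbr u :&: actv c | good u x]|)%N.
  transitivity (\sum_(x | ac (c x)) \sum_(u | [&& contender c i u, adj u x & good u x]) 1)%N.
    apply: eq_bigr => x ax; rewrite sum1_set; apply: eq_card => u.
    by rewrite !inE adjE andbCA -andbA andbCA.
  rewrite (exchange_big_dep (contender c i)) /=; last by move=> x u _ /and3P[].
  apply: eq_bigr => u cu; rewrite sum1_set; apply: eq_card => x.
  by rewrite !inE cu /= andbCA andbA.
rewrite big_distrr /=; apply: leq_sum => u; exact: good_count.
Qed.

End Contraction.

(** * Second phase of a rank: matching the remaining children by fast edges *)

Definition paired c l u : bool :=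
  (u \in trans c l) && (0 < #|nbr u :&: caught c l|).

Lemma pairedP c l u :
  reflect (u \in trans c l /\ exists2 x, adj u x & x \in caught c l) (paired c l u).
Proof.
apply: (iffP andP) => -[ul].
  case/card_gt0P => x; rewrite in_setI inE => /andP[ux xl].
  by split=> //; exists x.
case=> x ux xl; split=> //; apply/card_gt0P; exists x.
by rewrite in_setI inE ux.
Qed.

Lemma caught_paired c l x : x \in caught c l ->
  exists2 u, adj x u & nbr x :&: trans c l = [set u] /\ paired c l u.
Proof.
move=> xl; have := xl; rewrite in_caught => /andP[ax /cards1P[u E]].
have : u \in [set u] := set11 u.
rewrite -E in_setI inE => /andP[xu ul]; exists u => //; split=> //.
by apply/pairedP; split=> //; exists x; rewrite // adjE.
Qed.

Lemma echo_b i r c l w w' (d := gstep (GEcho true r l) (gstep (GTx l) c w) w') :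
  apart c i -> forall v,
  [/\ rk (d v) = (if paired c l v then r else rk (c v)),
      fre (d v) = ~~ paired c l v && fre (c v),
      fr (d v) = paired c l v || fr (c v) &
      hf (d v) = (v \in caught c l) || hf (c v)] /\
  [/\ ac (d v) = ac (c v) && (v \notin caught c l),
      pt (d v) = pt (c v) & lg (d v) = lg (c v)].
Proof.
move=> Hc v.
have E : [&& pt (c v), l <= lg (c v)
    & 0 < heard (fun u => gtx (GEcho true r l) (off u) (gstep (GTx l) c w u)) v]
    = paired c l v.
  rewrite /paired inE andbA; case pv : (pt (c v)) => //=.
  case: (_ <= _) => //=; rewrite (heard_echo l true r w Hc pv).
  by rewrite leq_min.
have F := fd_GTx l w v Hc.
rewrite /d [gstep (GEcho _ _ _) _ _ v]/gstep [gupd _ _ _ _ _]/= E.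
rewrite [ac (c v) && (heard _ _ == 1)]F.
case Fv: (v \in caught c l).
  have av : ac (c v) by move: Fv; rewrite in_caught => /andP[].
  have -> : paired c l v = false.
    by apply/negP => /andP[]; rewrite inE (apart_ac_pt Hc av).
  by rewrite av.
by rewrite andbT; case: (paired c l v).
Qed.

(** Sending a caught child to the only transmitter around it covers all paired nodes. Each new fast
    parent of rank [r] is thus paid for by a child of rank [r]. *)
Lemma paired_count c l : #|[set u | paired c l u]| <= #|caught c l|.
Proof.
pose f x := odflt x [pick u in nbr x :&: trans c l].
apply: leq_trans (leq_imset_card f (caught c l)); apply: subset_leq_card.
apply/subsetP => u; rewrite inE => /pairedP[ul [x ux xl]].
apply/imsetP; exists x => //; rewrite /f.
have [u' xu' [E _]] := caught_paired xl.
have uE : u \in nbr x :&: trans c l by rewrite in_setI inE adjE ux.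
case: pickP => [z|/(_ u)]; last by rewrite uE.
by move: uE; rewrite E !inE => /eqP -> /eqP ->.
Qed.

(** A newly paired node has by [inv_mode] no neighbour of rank [r] that is active or matched except
    the child it has just caught, so it disturbs no older fast edge. A caught child hears one
    transmitter only, which becomes its unique fast parent. *)
Lemma echo_b_inv i r c l w w' (d := gstep (GEcho true r l) (gstep (GTx l) c w) w') :
  apart c i -> rank_inv true i r c -> rank_inv true i r d.
Proof.
move=> Hap H; have D := echo_b r l w w' Hap; rewrite -/d in D.
have Hm : forall u x y, off u == i -> fre (c u) -> adj u x -> adj u y ->
        off x == i.+1 -> off y == i.+1 -> rk (c x) == r -> rk (c y) == r ->
        ac (c x) || hf (c x) -> ac (c y) || hf (c y) -> x = y := inv_mode H.
have PP u : paired c l u -> [/\ off u == i, fre (c u), rk (c u) = 0 & ~~ fr (c u)].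
  case/pairedP; rewrite inE => /andP[pu _] [x ux]; rewrite in_caught => /andP[ax _].
  have ou : off u == i by case: Hap => _; apply.
  have fu : fre (c u) by apply: (inv_ac_free H ax) => //; rewrite adjE.
  by have [? ?] := red_free (inv_below H) ou fu; split.
have CC x : x \in caught c l -> [/\ ac (c x), off x == i.+1, rk (c x) == r & ~~ hf (c x)].
  by rewrite in_caught => /andP[ax _]; have [? ? ?] := inv_ac H ax; split.
have Poff x : off x != i -> paired c l x = false.
  by move=> ox; apply/negP => /PP[E _ _ _]; rewrite E in ox.
have Coff x : off x != i.+1 -> (x \in caught c l) = false.
  by move=> ox; apply/negP => /CC[_ E _ _]; rewrite E in ox.
have Crk x : rk (c x) != r -> (x \in caught c l) = false.
  by move=> ox; apply/negP => /CC[_ _ E _]; rewrite E in ox.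
have Dlink x : off x != i -> x \notin caught c l -> linked c x -> linked d x.
  move=> ox /negbTE cx; rewrite /linked; have [[-> _ _ ->] _] := D x.
  rewrite cx (Poff x ox) /=; case: ifP => [hx /eqP <-|_ /existsP[u /and3P[a b h]]].
    apply/eqP/eq_card => u; rewrite !inE; have [[-> _ -> _] _] := D u.
    case Pu : (paired c l u) => //=; have [/eqP ou fu _ /negbTE ->] := PP u Pu.
    rewrite /= andbF andbF; apply/negbTE/negP => /and3P[xu /eqP oux rx].
    case/pairedP: Pu => _ [y uy /CC[ay oy ry hy]].
    have xy : x = y.
      apply: (Hm u x y) => //; rewrite ?ay ?hx ?orbT //; first exact/eqP.
      - by rewrite adjE.
      - by rewrite -oux ou.
      - by rewrite eq_sym.
    by rewrite -xy hx in hy.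
  apply/existsP; exists u; rewrite a b /=; have [[-> _ _ _] _] := D u.
  by case: ifP => // /PP[_ _ E _]; rewrite E in h.
have Dcaught x : x \in caught c l -> linked d x.
  move=> xl; have [ax ox rx hx] := CC x xl; have ox' : off x != i by lia.
  rewrite /linked; have [[-> _ _ ->] _] := D x; rewrite xl (Poff x ox') /=.
  have [u xu [E Pu]] := caught_paired xl.
  apply/cards1P; exists u; apply/setP => v; rewrite in_set1 inE.
  have [[-> _ -> _] _] := D v; apply/idP/eqP => [/and4P[xv ov fv _]|->].
    have ovi : off v == i by move: ov ox; lia.
    have nfv : ~~ fr (c v).
      have fv' := inv_ac_free H ax xv ovi.
      by have [_] := red_free (inv_below H) ovi fv'.
    move: fv; rewrite (negbTE nfv) orbF => /pairedP[vl _].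
    by apply/set1P; rewrite -E in_setI inE xv.
  have [/eqP ou _ _ _] := PP u Pu.
  by rewrite xu Pu ou (eqP ox) /= (eqP rx) !eqxx.
split; [split=> [v ov|v ov|v ov|u ou|x ox||x ox]|..].
- have [[-> -> _ _] _] := D v; rewrite Poff /=; last lia.
  exact: (top_init (inv_below H)).
- have [[_ _ -> _] _] := D v; rewrite Poff /=; last lia.
  exact: (top_fr (inv_below H)).
- have [[_ _ _ ->] _] := D v; rewrite Coff /=; last lia.
  exact: (top_hf (inv_below H)).
- have [[-> -> -> _] _] := D u; case: (paired c l u) => //=.
  exact: (red_free (inv_below H)).
- by apply: Dlink; [lia | rewrite Coff; lia | apply: (low_linked (inv_below H))].
- rewrite (eq_bigr (fun x => 2 ^ rk (c x))) ?(low_weight (inv_below H)) // => x ox.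
  by have [[-> _ _ _] _] := D x; rewrite Poff //; lia.
- by have [[-> _ _ _] _] := D x; rewrite Poff ?(low_rank (inv_below H)) //; lia.
- move=> u ou; have [[-> -> _ _] _] := D u; rewrite negb_and negbK.
  by case: (paired c l u) => //=; apply: (inv_ranked H).
- move=> x ox; have ox' : off x != i by lia.
  have [[-> _ _ _] _] := D x; rewrite (Poff x ox') => h; apply: Dlink => //.
    by rewrite Crk //; lia.
  exact: (inv_high H).
- move=> x ox; have ox' : off x != i by lia.
  have [[-> _ _ ->] _] := D x; rewrite (Poff x ox') => h; rewrite Crk /=; last lia.
  exact: (inv_low H).
- move=> x; have [[-> _ _ ->] [-> _ _]] := D x => /andP[ax nx].
  have [ox rx hx] := inv_ac H ax; have ox' : off x != i by lia.
  by rewrite (Poff x ox') (negbTE nx).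
- move=> x u; have [_ [-> _ _]] := D x; have [[_ -> _ _] _] := D u.
  move=> /andP[ax nx] xu ou; rewrite (inv_ac_free H ax xu ou) andbT.
  apply/negP => /pairedP[_ [y uy yl]].
  have [ay oy ry hy] := CC y yl; have [ox rx hx] := inv_ac H ax.
  have xy : x = y.
    apply: (Hm u x y) => //; rewrite ?ax ?ay //; last by rewrite adjE.
    exact: (inv_ac_free H ax xu ou).
  by rewrite xy yl in nx.
- move=> x ox; have ox' : off x != i by lia.
  have [[-> _ _ _] [-> _ _]] := D x; rewrite (Poff x ox') => rx.
  case xl : (x \in caught c l) => /=; first by move=> _; apply: Dcaught.
  rewrite andbT => nax; apply: Dlink => //; rewrite ?xl //; exact: (inv_done H).
- have W1 : ranked_weight d i = ranked_weight c i + #|[set u | paired c l u]| * 2 ^ r.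
    rewrite /ranked_weight (bigID (paired c l)) /= addnC; congr (_ + _).
      apply: eq_big => u.
        have [[_ -> _ _] _] := D u; case Pu: (paired c l u); rewrite ?andbT // andbF.
        by have [_ -> _ _] := PP u Pu; rewrite andbF.
      by have [[-> _ _ _] _] := D u => /andP[_ /negbTE ->].
    rewrite -sum_nat_const; apply: eq_big => u.
      rewrite inE; have [[_ -> _ _] _] := D u; case Pu: (paired c l u); rewrite ?andbF //=.
      by have [-> _ _] := PP u Pu.
    by have [[-> _ _ _] _] := D u => /andP[_ ->].
  have W2 : inactive_weight d i r = inactive_weight c i r + #|caught c l| * 2 ^ r.
    have -> : #|caught c l| * 2 ^ r =
        \sum_(x | off x == i.+1) if x \in caught c l then 2 ^ r else 0.
      rewrite -sum_nat_const -big_mkcondr; apply: eq_bigl => x.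
      by case xl: (x \in caught c l); rewrite ?andbF //; have [_ ->] := CC x xl.
    rewrite -big_split; apply: eq_bigr => x ox.
    have ox' : off x != i by lia.
    have [[-> _ _ _] [-> _ _]] := D x; rewrite (Poff x ox').
    case xl: (x \in caught c l); last by rewrite /= andbT addn0.
    by have [-> _ /eqP -> _] := CC x xl; rewrite ltnn eqxx.
  by rewrite W1 W2 leq_add ?(inv_weight H) // leq_mul2r paired_count orbT.
- move=> u x y; have [[_ -> _ _] _] := D u => ou /andP[_ fu] ux uy ox oy.
  have [[-> _ _ ->] [-> _ _]] := D x; have [[-> _ _ ->] [-> _ _]] := D y.
  rewrite (Poff x) ?(Poff y); try lia.
  move=> rx ry hx hy; apply: (Hm u x y) => //.
    move: hx; case xl: (x \in caught c l); last by rewrite andbT.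
    by have [-> _ _ _] := CC x xl.
  move: hy; case yl: (y \in caught c l); last by rewrite andbT.
  by have [-> _ _ _] := CC y yl.
Qed.

Hypothesis redP : forall x i, off x = i.+1 -> exists2 u, adj x u & off u = i.

Lemma cycle_b_rest i r c w (c0 := gstep (GDeg i true) c w) :
  rank_inv true i r c ->
  sure gstep (cycle_body true r)
    (fun d => rank_inv true i r d /\ forall x, ac (d x) ->
       ac (c x) && ~~ [exists l : 'I_lam.+1, #|nbr x :&: trans c0 l| == 1]) c0.
Proof.
move=> H; have [H0 Hap] := deg_inv w H; rewrite -/c0 in H0 Hap.
pose Q j d := [/\ rank_inv true i r d, apart d i,
  forall v, pt (d v) = pt (c0 v) /\ lg (d v) = lg (c0 v) &
  forall x, ac (d x) ->
    ac (c x) && ~~ has (fun l => #|nbr x :&: trans c0 l| == 1) (iota 0 j)].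
apply: (@sure_mono _ _ _ gstep _ (Q lam.+1)) => [d [Hd _ _ Ha]|].
  split=> // x /Ha/andP[-> /hasPn N]; apply/existsPn => l; apply: N.
  by rewrite mem_iota /= add0n.
apply: sure_body; first by split=> // x /= ->.
move=> l d _ [Hd Hapd Hpt Ha] w1 w2; set d' := gstep _ _ w2.
have D := echo_b r l w1 w2 Hapd; rewrite -/d' in D.
have Hd' : rank_inv true i r d' by apply: echo_b_inv.
have Hpt' v : pt (d' v) = pt (c0 v) /\ lg (d' v) = lg (c0 v).
  by have [_ [_ -> ->]] := D v.
split=> //.
  split=> [x /(inv_ac Hd')[] //|u]; have [-> _] := Hpt' u.
  by case: Hap => _; apply.
have Et : trans d l = trans c0 l.
  by apply/setP => u; rewrite !inE; have [-> ->] := Hpt u.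
move=> x; have [_ [-> _ _]] := D x => /andP[ax nx].
have /andP[-> nh] := Ha x ax.
rewrite -[l.+1]addn1 iotaD has_cat negb_or nh /= orbF add0n.
by rewrite in_caught ax Et in nx.
Qed.

Lemma draws_gt0 : 0 < #|{: draws}|.
Proof. by rewrite card_ffun card_tuple card_bool expn_gt0 expn_gt0. Qed.

(** A child leaves as soon as some level isolates one of its free neighbours, which has probability
    at least 1/32; the weaker 1/64 gives both phases the same rate. *)
Lemma cycle_b_contract i r c : rank_inv true i r c ->
  (EX gstep (cycle_b i r) (fun d => #|actv d|%:R) c <= 63 / 64 * #|actv c|%:R)%R.
Proof.
move=> H; rewrite /cycle_b EX_cons.
(* Whether a node contends does not depend on the draw, so an arbitrary fixed draw serves to define
   the contenders around [x]. *)
pose S x := nbr x :&: [set u | pt (gstep (GDeg i true) c [ffun=> [tuple of nseq lam true]] u)].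
pose ev (w : draws) x := [exists l : 'I_lam.+1,
   #|S x :&: above l (fun v => lead (w v))| == 1].
apply: le_trans (_ : avg (fun w : draws =>
   \sum_(x | ac (c x)) (1 + -1 * (ev w x)%:R)) <= _)%R.
  apply: avg_le => w; apply: (EX_bound draws_gt0).
  apply: sure_mono (cycle_b_rest w H) => d [_ Ha].
  apply: le_trans (_ : (\sum_(x | ac (c x)) ~~ ev w x)%N%:R <= _)%R; last first.
    rewrite natr_sum; apply: ler_sum => x _.
    by case: (ev w x); rewrite /= ?mulr1 ?mulr0 ?addr0 ?addrN.
  rewrite ler_nat -sum1_card [leqRHS]big_mkcond [leqLHS]big_mkcond /=.
  apply: leq_sum => x _; rewrite inE; case: ifP => // /Ha/andP[-> N].
  suff -> : ev w x = false by [].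
  apply/negbTE; apply: contra N => /existsP[l E]; apply/existsP; exists l.
  rewrite -(eqP E); apply/eqP; congr #|pred_of_set _|; apply/setP => u.
  by rewrite !inE !(deg_pt _ _ H) andbA.
rewrite avg_sum.
apply: le_trans (_ : \sum_(x | ac (c x)) (63 / 64) <= _)%R; last first.
  rewrite sumr_const -[leLHS]mulr_natr le_eqVlt; apply/orP; left; apply/eqP.
  by congr (_ * _%:R)%R; apply: eq_card => x; rewrite !inE.
apply: ler_sum => x ax; rewrite avgD avg_scale (avg_cst _ draws_gt0).
have [/eqP ox _ _] := inv_ac H ax; have [u xu ou] := redP ox.
have S0 : S x != set0.
  apply/set0Pn; exists u; rewrite !inE xu (deg_pt _ _ H) ou eqxx /=.
  rewrite (inv_ac_free H ax xu) ?ou //=; apply/card_gt0P; exists x.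
  by rewrite !inE adjE xu.
have := isolation1 S0 (up_log_card (S x)); rewrite -/(ev _ _).
lra.
Qed.

(** * Composition over phases, ranks and levels *)

Lemma cycle_sure (m : bool) i r c : rank_inv m i r c ->
  sure gstep (if m then cycle_b i r else cycle_a i r) (rank_inv m i r) c.
Proof.
case: m => H w /=.
  by apply: sure_mono (cycle_b_rest w H) => d [].
by apply: sure_mono (cycle_a_rest w H) => d [].
Qed.

Lemma pot_a_le i c : pot_a i c <= 4 ^ lam.
Proof.
apply: (@leq_trans (\sum_(u : V) #|V|)).
  rewrite /pot_a big_mkcond; apply: leq_sum => u _; case: ifP => // _.
  exact: max_card.
by rewrite sum_nat_const (@expnMn 2 2) leq_mul.
Qed.

(** No contender is left, so no free parent sees two active children; since no child of rank [r] is
    matched yet, this is the matching condition of the second mode. *)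
Lemma pot_a0_inv i r c : rank_inv false i r c -> pot_a i c = 0 ->
  rank_inv true i r c.
Proof.
move=> H P0; have Hm := inv_mode H.
case: H => ? ? ? ? ? ? ? ? _; split=> //.
move=> u x y ou fu ux uy ox oy rx ry.
rewrite (negbTE (Hm x ox rx)) (negbTE (Hm y oy ry)) !orbF => ax ay.
apply/eqP; apply: contraT => xy.
have h : 1 < #|nbr u :&: actv c|.
  apply: leq_trans (_ : #|[set x; y]| <= _); first by rewrite cards2 xy.
  apply: subset_leq_card; apply/subsetP => z.
  by rewrite !inE => /orP[] /eqP ->; rewrite ?ux ?uy ?ax ?ay.
move/eqP: P0; rewrite /pot_a sum_nat_eq0 => /forallP/(_ u).
rewrite /contender ou fu h /= => /eqP E; by rewrite E in h.
Qed.

Lemma rank_start i r c : rank_done i r.+1 c ->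
  sure gstep [:: GInit i r; GPurge i r] (rank_inv false i r) c.
Proof.
move=> H w w' /=.
set c1 := gstep (GInit i r) c w; set d := gstep _ c1 w'.
have Dac v : ac (d v) = [&& off v == i.+1, rk (c v) == r &
    ~~ [exists u, [&& adj v u, off u == i, ~~ fre (c u) & r < rk (c u)]]].
  rewrite /d /gstep [ac _]/=; case ov: (off v == i.+1) => //=.
  case: (_ == r) => //=.
  rewrite heard_listen /=; last by rewrite (eqP ov); lia.
  rewrite minn2_eq0 cards_eq0; apply/eqP/idP => [E|/existsPn E].
    by apply/existsPn => u; move/setP/(_ u): E; rewrite !inE => ->.
  by apply/setP => u; rewrite !inE; apply/negbTE/E.
have HL x : linked d x = linked c x by [].
have B : below_ok d i by case: (done_below H).
split=> //.
- by move=> u ou fu; apply: ltnW; apply: (done_ranked H).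
- by move=> x; apply: (done_high H).
- by move=> x ox rx; apply: (done_low H) => //; apply: ltnW.
- by move=> x; rewrite Dac => /and3P[ox rx _]; rewrite ox rx (done_low H) // (eqP rx).
- move=> x u; rewrite Dac => /and3P[ox rx /existsPn E] xu ou.
  have := E u; rewrite xu ou /=; apply: contraR => fu; rewrite fu /=.
  exact: (done_ranked H).
- move=> x ox rx; rewrite Dac ox rx /= negbK => /existsP[u /and4P[xu ou fu ru]].
  rewrite HL /linked (negbTE (done_low H ox _)) ?(eqP rx) //.
  by apply/existsP; exists u; rewrite xu (eqP ou) eq_sym ox /=.
- apply: leq_trans (done_weight H) _; rewrite big_mkcondr; apply: leq_sum => x _.
  by rewrite [rk (d x)]/=; case: (r < _).
- by move=> x ox rx; apply: (done_low H) => //; rewrite (eqP rx).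
Qed.

Lemma rank_end i r c : rank_inv true i r c -> actv c = set0 -> rank_done i r c.
Proof.
move=> H A0; have nac x : ~~ ac (c x).
  by move/setP/(_ x): A0; rewrite !inE => ->.
split.
- exact: (inv_below H).
- exact: (inv_ranked H).
- move=> x ox; rewrite leq_eqVlt => /orP[/eqP rx|]; last exact: (inv_high H).
  by apply: (inv_done H) => //; rewrite rx.
- exact: (inv_low H).
- apply: leq_trans (inv_weight H) _; rewrite [leqRHS]big_mkcondr.
  apply: leq_sum => x _; rewrite (negbTE (nac x)) andbT.
  by case: ltngtP => //=.
Qed.

(** Markov bound for one phase of [P] cycles, whose potential is at first at most [#|V| ^ 2]. *)
Definition tree_err (P : nat) : rat := ((63 / 64) ^+ P * 4 ^+ lam)%R.

Lemma tree_err_ge0 P : (0 <= tree_err P)%R.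
Proof. by rewrite /tree_err; apply: mulr_ge0; apply: exprn_ge0; lra. Qed.

Lemma le_expr4 k : k <= 4 ^ lam -> (k%:R <= 4 ^+ lam :> rat)%R.
Proof. by move=> H; rewrite -natrX ler_nat. Qed.

Lemma phase_a P i r :
  hoare gstep (rank_inv false i r) (flatten (nseq P (cycle_a i r)))
    (fun d => rank_inv false i r d /\ pot_a i d = 0) (tree_err P).
Proof.
have r0 : (0 <= 63 / 64 :> rat)%R by lra.
have p0 d : (0 <= (pot_a i d)%:R :> rat)%R by exact: ler0n.
have HQ d : rank_inv false i r d -> ~ (pot_a i d = 0) -> (1 <= (pot_a i d)%:R :> rat)%R.
  by move=> _ /eqP nz; rewrite (ler_nat rat 1) lt0n.
have H := hoare_contract (a := (4 ^+ lam)%R) P r0 (@cycle_sure false i r)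
  (@cycle_a_contract i r) p0 HQ.
apply: (hoare_weak _ _ _ H) => [c Hc|//|]; last exact: lexx.
split; first exact: Hc.
by apply: le_expr4; apply: pot_a_le.
Qed.

Lemma phase_b P i r :
  hoare gstep (rank_inv true i r) (flatten (nseq P (cycle_b i r)))
    (fun d => rank_inv true i r d /\ actv d = set0) (tree_err P).
Proof.
have r0 : (0 <= 63 / 64 :> rat)%R by lra.
have p0 d : (0 <= #|actv d|%:R :> rat)%R by exact: ler0n.
have HQ d : rank_inv true i r d -> ~ (actv d = set0) -> (1 <= #|actv d|%:R :> rat)%R.
  by move=> _ /eqP nz; rewrite (ler_nat rat 1) card_gt0.
have H := hoare_contract (a := (4 ^+ lam)%R) P r0 (@cycle_sure true i r)
  (@cycle_b_contract i r) p0 HQ.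
apply: (hoare_weak _ _ _ H) => [c Hc|//|]; last exact: lexx.
split; first exact: Hc.
apply: le_expr4; apply: leq_trans (max_card _) (leq_trans cardV _).
by rewrite (@expnMn 2 2) leq_pmulr ?expn_gt0.
Qed.

Lemma rank_phase P i r :
  hoare gstep (rank_done i r.+1) (rankp P i r) (rank_done i r) (tree_err P *+ 2).
Proof.
have e0 := tree_err_ge0 P.
have e20 : (0 <= tree_err P *+ 2)%R by rewrite mulrn_wge0.
rewrite /rankp -[(_ *+ 2)%R]add0r.
have H1 := hoare_sure draws_gt0 (@rank_start i r).
apply: (hoare_cat draws_gt0 e20 H1).
have Ha := @phase_a P i r; rewrite mulr2n; apply: (hoare_cat draws_gt0 e0 Ha).
apply: (hoare_weak _ _ (lexx _) (@phase_b P i r)) => [c []|c []].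
  exact: pot_a0_inv.
exact: rank_end.
Qed.

Record tree_ok i c : Prop := {
  ok_init : forall v, off v < i -> [/\ rk (c v) = 0, fre (c v) & ~~ fr (c v)];
  ok_hf : forall v, off v <= i -> ~~ hf (c v);
  ok_linked : forall x, i < off x -> linked c x;
  ok_weight : \sum_(x | off x == i) 2 ^ rk (c x) <= #|[set x | i <= off x]|;
  ok_rank : forall x, i <= off x -> rk (c x) <= lam }.

(** No child has rank above [lam], and no node of the upper level is ranked yet. *)
Lemma tree_ok_start i c : tree_ok i.+1 c -> rank_done i lam.+1 c.
Proof.
case=> H0 Hhf Hl Hw Hr; split=> //.
- split=> //.
  + by move=> v ov; have [] := H0 v (ltnW ov).
  + by move=> v ov; have [] := H0 v (ltnW ov).
  + by move=> v ov; apply: Hhf; apply: leqW.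
  + by move=> u /eqP ou; have [|] := H0 u; rewrite ?ou.
- by move=> u /eqP ou; have [|_ ->] := H0 u; rewrite ?ou.
- by move=> x /eqP ox; rewrite ltnNge Hr ?ox.
- by move=> x /eqP ox _; apply: Hhf; rewrite ox.
- rewrite /ranked_weight big_pred0 // => u.
  by case: eqP => //= ou; have [|_ ->] := H0 u; rewrite ?ou.
Qed.

(** Ranked nodes are paid for by the level below, and an unranked node, of weight 1, pays for
    itself. The resulting weight bound gives 2^rank <= [#|V|], hence rank at most [lam]. *)
Lemma tree_ok_end i c : rank_done i 0 c -> tree_ok i c.
Proof.
case=> -[H0 Hfr Hhf Hred Hl Hw Hr] _ Hhigh _ Hrw.
have W : \sum_(x | off x == i) 2 ^ rk (c x) <= #|[set x | i <= off x]|.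
  rewrite (bigID (fun x => fre (c x))) /= addnC.
  have -> : #|[set x | i <= off x]| = #|[set x | i < off x]| + #|[set x | off x == i]|.
    rewrite -cardsUI [X in _ + X](_ : _ = 0) ?addn0.
      by apply: eq_card => x; rewrite !inE orbC eq_sym leq_eqVlt.
    by apply/eqP; rewrite cards_eq0; apply/eqP/setP => x; rewrite !inE; lia.
  apply: leq_add.
    apply: leq_trans Hrw (leq_trans _ Hw).
    by rewrite big_mkcondr leq_sum // => x _.
  rewrite -sum1_set [leqRHS]big_mkcond [leqLHS]big_mkcond.
  apply: leq_sum => x _; case: ifP => [/andP[ox fx]|_].
    by rewrite ox; have [-> _] := Hred x ox fx.
  by [].
split=> //.
- by move=> v ov; have [-> ->] := H0 v ov; have := Hfr v ov.
- move=> x ix; have [ox|ox] := eqVneq (off x) i.+1; last by apply: Hl; lia.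
  by apply: Hhigh => //; apply/eqP.
- move=> x; rewrite leq_eqVlt => /orP[/eqP ox|]; last exact: Hr.
  rewrite -(@leq_exp2l 2) //; apply: leq_trans cardV.
  apply: leq_trans (leq_trans W (max_card _)).
  by rewrite (bigD1 x) /= ?leq_addr // -ox.
Qed.

Lemma level_phase P i :
  hoare gstep (tree_ok i.+1) (levelp P i) (tree_ok i) (tree_err P *+ 2 *+ lam.+1).
Proof.
have e0 : (0 <= tree_err P *+ 2)%R by rewrite mulrn_wge0 ?tree_err_ge0.
rewrite /levelp; set ps := map _ _.
have sz : size ps = lam.+1 by rewrite size_map size_iota.
have := @hoare_flatten _ _ _ gstep draws_gt0 ps
  (fun j => rank_done i (lam.+1 - j)) _ e0.
rewrite sz subn0 subnn => H.
apply: hoare_weak (H _) => //; [exact: tree_ok_start | exact: tree_ok_end |].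
move=> j Hj; rewrite /ps (nth_map 0) ?size_iota // nth_iota // add0n.
have -> : lam.+1 - j = (lam - j).+1 by lia.
exact: rank_phase.
Qed.

Lemma tree_phase P w :
  hoare gstep (tree_ok w.-1) (treep P w) (tree_ok 0)
    (tree_err P *+ 2 *+ lam.+1 *+ w.-1).
Proof.
have e0 : (0 <= tree_err P *+ 2 *+ lam.+1)%R by rewrite !mulrn_wge0 ?tree_err_ge0.
rewrite /treep; set ps := map _ _.
have sz : size ps = w.-1 by rewrite size_map size_iota.
have := @hoare_flatten _ _ _ gstep draws_gt0 ps (fun j => tree_ok (w.-1 - j)) _ e0.
rewrite sz subn0 subnn; apply => j Hj.
rewrite /ps (nth_map 0) ?size_iota // nth_iota // add0n.
have -> : w.-1 - j = (w.-2 - j).+1 by lia.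
have -> : w.-1 - j.+1 = w.-2 - j by lia.
exact: level_phase.
Qed.

Definition gst0 : gst := Gst 0 true false false false false false 0.

Lemma tree_ok_init w : 0 < w -> (forall v, off v < w) -> tree_ok w.-1 (fun=> gst0).
Proof.
move=> w0 ow; split=> //.
- by move=> x; have := ow x; lia.
- rewrite -sum1_set [leqRHS]big_mkcond [leqLHS]big_mkcond; apply: leq_sum => x _.
  by case: eqP => // ->; rewrite leqnn.
Qed.

End Tree.

Lemma size_flatten_const (I : Type) (ps : seq (seq I)) n :
  (forall p, p \in [seq size q | q <- ps] -> p = n) ->
  size (flatten ps) = n * size ps.
Proof.
move=> H; rewrite size_flatten; have -> : shape ps = nseq (size ps) n.
  elim: ps H => //= p ps IH H; rewrite -IH => [|q qs]; last first.
    by apply: H; rewrite inE qs orbT.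
  by rewrite (H (size p)) ?inE ?eqxx.
by rewrite sumn_nseq.
Qed.

Lemma size_cycle_body lam m r : size (cycle_body lam m r) = 2 * lam.+1.
Proof.
rewrite /cycle_body (size_flatten_const (n := 2)); first by rewrite size_map size_iota.
by move=> p; rewrite -map_comp => /mapP[j _ ->].
Qed.

Lemma size_treep lam P w :
  size (treep lam P w) = (2 + P * (4 * lam.+1 + 3)) * lam.+1 * w.-1.
Proof.
rewrite /treep (size_flatten_const (n := (2 + P * (4 * lam.+1 + 3)) * lam.+1)).
  by rewrite size_map size_iota.
move=> q; rewrite -map_comp => /mapP[j _ ->].
change (size (levelp lam P (w.-2 - j)) = (2 + P * (4 * lam.+1 + 3)) * lam.+1).
rewrite /levelp (size_flatten_const (n := 2 + P * (4 * lam.+1 + 3))).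
  by rewrite size_map size_iota.
move=> q'; rewrite -map_comp => /mapP[k _ ->].
change (size (rankp lam P (w.-2 - j) (lam - k)) = 2 + P * (4 * lam.+1 + 3)).
rewrite !size_cat.
rewrite (size_flatten_const (n := 2 * lam.+1 + 2)); last first.
  move=> s; rewrite map_nseq mem_nseq => /andP[_ /eqP ->].
  rewrite -[size (cycle_a lam _ _)]/((size (cycle_body lam false (lam - k) ++
    [:: GPurge (w.-2 - j) (lam - k)])).+1).
  by rewrite size_cat size_cycle_body addn1; lia.
rewrite (size_flatten_const (n := 2 * lam.+1 + 1)); last first.
  move=> s; rewrite map_nseq mem_nseq => /andP[_ /eqP ->].
  rewrite -[size (cycle_b lam _ _)]/((size (cycle_body lam true (lam - k))).+1).
  by rewrite size_cycle_body; lia.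
by rewrite !size_nseq /= -mulnDl mulnC; congr (_ + _ * _); lia.
Qed.

(** * Random transmission patterns that serve all nodes *)

Section Patterns.
Variables (V : finType) (lam : nat).
Hypothesis cardV : #|V| <= 2 ^ lam.
Variable S : V -> {set V}.

Definition pconf := V -> seq nat.

Definition pstep (_ : unit) (c : pconf) (w : draws V lam) : pconf :=
  fun v => rcons (c v) (lead (w v)).

Definition frame_ok (A : {set V}) (c : pconf) (f : nat) : bool :=
  [exists l : 'I_lam.+1, #|A :&: above l (fun u => nth 0 (c u) f)| == 1].

Definition frames (c : pconf) (v : V) : nat :=
  count (frame_ok (S v) c) (iota 0 (size (c v))).

Definition same_size (c : pconf) : Prop := forall u v, size (c u) = size (c v).

Lemma frames_step c w v : same_size c ->
  frames (pstep tt c w) v = frames c v +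
    [exists l : 'I_lam.+1, #|S v :&: above l (fun u => lead (w u))| == 1].
Proof.
move=> Hs; rewrite /frames size_rcons -addn1 iotaD count_cat add0n; congr (_ + _).
  apply: eq_in_count => f; rewrite mem_iota add0n /= => Hf.
  apply: eq_existsb => l; congr (_ == _); apply: eq_card => u.
  by rewrite !inE /pstep nth_rcons (Hs u v) Hf.
rewrite /= addn0; congr (nat_of_bool _).
apply: eq_existsb => l; congr (_ == _); apply: eq_card => u.
by rewrite !inE /pstep nth_rcons (Hs u v) ltnn eqxx.
Qed.

Local Open Scope ring_scope.

(** An exponential potential in place of a Chernoff bound. A good frame halves the summand of [v],
    so a draw multiplies it on average by at most 1 - (1/2)(1/32) = 63/64, and a node short of [b]
    good frames contributes more than 1. *)
Definition pat_pot (b : nat) (c : pconf) : rat :=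
  \sum_(v | S v != set0) 2 ^+ b * 2^-1 ^+ frames c v.

Lemma pat_contract b c : same_size c ->
  EX pstep [:: tt] (pat_pot b) c <= 63 / 64 * pat_pot b c.
Proof.
move=> Hs; rewrite /= /pat_pot avg_sum mulr_sumr; apply: ler_sum => v Sv.
rewrite avg_scale [leRHS]mulrCA; apply: ler_wpM2l; first by rewrite exprn_ge0.
set ev := fun w : draws V lam =>
  [exists l : 'I_lam.+1, #|S v :&: above l (fun u => lead (w u))| == 1%N].
have -> : avg (fun w => 2^-1 ^+ frames (pstep tt c w) v : rat) =
    avg (fun w => 2^-1 ^+ frames c v * (1 + - 2^-1 * (ev w)%:R) : rat).
  rewrite /avg; congr (_ / _); apply: eq_bigr => w _.
  rewrite frames_step // exprD -/(ev w); congr (_ * _).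
  by case: (ev w) => /=; rewrite ?expr0 ?expr1; lra.
rewrite avg_scale avgD avg_scale (avg_cst _ (draws_gt0 V lam)) [leLHS]mulrC.
apply: ler_wpM2r; first by rewrite exprn_ge0.
have := isolation1 Sv (up_log_card cardV (S v)); rewrite -/ev.
lra.
Qed.

Lemma pattern_phase F b :
  hoare pstep (fun c => forall v, c v = [::]) (flatten (nseq F [:: tt]))
    (fun c => forall v, S v != set0 -> (b <= frames c v)%N)
    ((63 / 64) ^+ F * (2 ^+ b * 2 ^+ lam)).
Proof.
have sz c : same_size c -> sure pstep [:: tt] same_size c.
  by move=> H w u v; rewrite /pstep !size_rcons (H u v).
have p0 (c : pconf) : 0 <= pat_pot b c.
  by apply: sumr_ge0 => v _; rewrite mulr_ge0 ?exprn_ge0.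
have r0 : 0 <= 63 / 64 :> rat by lra.
have H := @hoare_contract _ _ _ pstep [:: tt] same_size
  (fun c => forall v, S v != set0 -> (b <= frames c v)%N) (pat_pot b) (63 / 64)
  (2 ^+ b * 2 ^+ lam) F r0 sz (pat_contract b) p0.
apply: hoare_weak (H _); [| by move=> c [] | by [] |].
  move=> c Hc; split; first by move=> u v; rewrite !Hc.
  apply: le_trans (_ : \sum_(v : V) 2 ^+ b <= _).
    rewrite /pat_pot big_mkcond; apply: ler_sum => v _; case: ifP => _.
      rewrite -[leRHS]mulr1; apply: ler_wpM2l; first exact: exprn_ge0.
      by apply: exprn_ile1; lra.
    exact: exprn_ge0.
  rewrite sumr_const -[leLHS]mulr_natr; apply: ler_wpM2l; first exact: exprn_ge0.
  by rewrite -natrX ler_nat.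
move=> c Hc nQ.
have [v [Sv lt]] : exists v, S v != set0 /\ (frames c v < b)%N.
  apply: NNPP => N; apply: nQ => v Sv; rewrite leqNgt; apply/negP => lt.
  exact: (N (ex_intro _ v (conj Sv lt))).
rewrite /pat_pot (bigD1 v Sv) /=.
apply: le_trans (_ : 2 ^+ b * 2^-1 ^+ frames c v <= _).
  have h0 : 0 < 2 ^+ frames c v :> rat by apply: exprn_gt0.
  rewrite exprVn (ler_pdivlMr _ _ h0) mul1r.
  by apply: ler_weXn2l; [lra | exact: ltnW].
rewrite lerDl; apply: sumr_ge0 => u _.
by apply: mulr_ge0; apply: exprn_ge0; lra.
Qed.

End Patterns.

(** * Reception in the radio model *)

Section Perceive.
Variables (V : finType) (adj : rel V) (B : nat).
Implicit Types (tx : V -> option (B.-tuple bool)) (v : V).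

Definition beep_count (fb : feedback B) : nat :=
  match fb with Silence => 0 | Received _ => 1 | Collision => 2 end.

Lemma size_pmap_tx tx v :
  size (pmap tx [seq u <- enum V | adj v u]) = #|[set u | adj v u & tx u]|.
Proof.
rewrite size_pmap count_filter cardE -size_filter /enum_mem -!filter_predI.
congr size; apply: eq_filter => u; rewrite !inE /= andbT.
by case: (adj v u) => /=; rewrite ?andbT ?andbF //; case: (tx u).
Qed.

Lemma perceive_count tx v :
  beep_count (perceive adj tx v) = heard adj (fun u => isSome (tx u)) v.
Proof.
rewrite /perceive /heard; case: (tx v) => //=.
by rewrite -size_pmap_tx; case: (pmap _ _) => [|p [|q l]] //=; lia.
Qed.

Lemma perceive_one tx v u p : tx v = None -> adj v u -> tx u = Some p ->
  (forall u', adj v u' -> tx u' -> u' = u) -> perceive adj tx v = Received p.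
Proof.
move=> tv vu up H.
have := size_pmap_tx tx v.
have -> : [set u | adj v u & tx u] = [set u].
  apply/setP => u'; rewrite !inE; apply/andP/eqP => [[a b]|->]; first exact: H.
  by rewrite vu up.
rewrite cards1 /perceive tv => sz.
have : p \in pmap tx [seq u <- enum V | adj v u].
  rewrite mem_pmap -up; apply: map_f; by rewrite mem_filter vu mem_enum.
by case: (pmap _ _) sz => [|q [|]] //= _; rewrite inE => /eqP ->.
Qed.

Lemma perceive_received tx v p : perceive adj tx v = Received p ->
  exists2 u, adj v u & tx u = Some p /\ forall u', adj v u' -> tx u' -> u' = u.
Proof.
have := size_pmap_tx tx v; rewrite /perceive; case: (tx v) => //.
case E: (pmap _ _) => [|q [|]] //= sz [<-].
have : q \in pmap tx [seq u <- enum V | adj v u] by rewrite E inE.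
rewrite mem_pmap => /mapP[u]; rewrite mem_filter => /andP[vu _] qu.
exists u => //; split=> // u' vu' tu'.
have /card_le1_eqP : #|[set u | adj v u & tx u]| <= 1 by rewrite -sz.
by apply; rewrite !inE ?vu' ?vu // -qu.
Qed.

End Perceive.

(** * Delays as distances in a weighted graph *)

Section WeightedDistance.
Variables (V : finType) (adj : rel V) (s : V) (jump : pred V).
Variables (src : V -> V) (wt : V -> nat).
Hypothesis conn : forall v, connect adj s v.

(** Lengths of walks with unit edges [adj] and, for [jump v], an edge of weight [wt v] from [src v].
    Below, [src v] is the head of the fast path of [v], not the source of the broadcast. *)
Inductive reached : nat -> V -> Prop :=
  | reached0 : reached 0 s
  | reached_adj n u v : reached n u -> adj u v -> reached n.+1 v
  | reached_jump n v : reached n (src v) -> jump v -> reached (n + wt v) v.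

Lemma weighted_distance : exists dl : V -> nat, [/\ dl s = 0,
  forall u v, adj u v -> dl v <= (dl u).+1,
  forall v, jump v -> dl v <= dl (src v) + wt v &
  forall v, v != s -> (exists2 u, adj u v & dl v = (dl u).+1) \/
     (jump v /\ dl v = dl (src v) + wt v)].
Proof.
pose R n v : bool := if excluded_middle_informative (reached n v) then true else false.
have RP n v : reflect (reached n v) (R n v).
  by rewrite /R; case: excluded_middle_informative => h; constructor.
have ex v : exists n, R n v.
  have /connectP[p pth ->] := conn v.
  have : exists n, R n s by exists 0; apply/RP; constructor.
  elim: p s pth => //= x p IH u /andP[ux pth] [n /RP Hn].
  by apply: IH => //; exists n.+1; apply/RP; apply: reached_adj ux.
pose dl v := ex_minn (ex v).
have dlR v : reached (dl v) v by rewrite /dl; case: ex_minnP => n /RP.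
have dlm n v : reached n v -> dl v <= n.
  by move=> h; rewrite /dl; case: ex_minnP => k _; apply; apply/RP.
exists dl; split.
- by apply/eqP; rewrite -leqn0; apply: dlm; constructor.
- by move=> u v uv; apply: dlm; apply: reached_adj uv.
- by move=> v jv; apply: dlm; apply: reached_jump.
- move=> v; have := dlR v; move En: (dl v) => n H; case: H En => [|n' u v' Hu uv|n' v' Hv jv].
  + by rewrite eqxx.
  + move=> En _; left; exists u => //; have := dlm _ _ Hu.
    by have := dlm _ _ (reached_adj (dlR u) uv); lia.
  + move=> En _; right; split=> //; have := dlm _ _ Hv.
    by have := dlm _ _ (reached_jump (dlR (src v')) jv); lia.
Qed.

End WeightedDistance.

(** * Behaviour of a node in the data phase; time [s] counts pairs of a fast and a slow round *)

Section Data.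
Variables (B b F lam : nat) (batch : Type) (b0 : batch).
Variables (enc pkt : batch -> nat -> B.-tuple bool).
Variables (dec : seq (nat * B.-tuple bool) -> batch).
Variables (mk : seq (B.-tuple bool) -> batch).
Local Notation pk := (B.-tuple bool).

Inductive mode := MSrc of (nat -> batch) | MSlow | MFast.

(* [dl] is the delay of the node, [bs] the batches it has decoded, [sl] the code
   symbols of the current stage, [fl] the time-stamped packets received from the
   fast parent, and [rl] the packet to be relayed in the next fast round. *)
Record dst := Dst {
  dl : option nat; md : mode; bs : seq batch;
  sl : seq (nat * pk); fl : seq (nat * pk); rl : option pk }.

(** In slow rounds: three delay classes times [lam.+1] Decay levels. In fast rounds: room for
    [lam.+1] ranks whose slots lie 3 apart. *)
Definition period : nat := 3 * lam.+1.
Definition stage : nat := F * period.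
Definition frame_of (s : nat) : nat := (s %/ period) %% F.

Definition head_tx (s slot : nat) (d : dst) : option pk :=
  if dl d is Some e then
    if (s == slot %[mod period]) && (frame_of s < b)
    then Some (pkt (nth b0 (bs d) (s %/ stage - e)) (frame_of s)) else None
  else None.

Definition fast_tx (s slot : nat) (h f : bool) (d : dst) : option pk :=
  if f then if h then rl d else head_tx s slot d else None.

Definition fast_upd (s slot : nat) (h : bool) (d : dst) (fb : feedback B) : dst :=
  if h then
    match fb with
    | Received p =>
        if s.+1 == slot %[mod period] then
          Dst (dl d) (md d) (bs d) (sl d) (rcons (fl d) (s, p)) (Some p)
        else Dst (dl d) (md d) (bs d) (sl d) (fl d) None
    | _ => Dst (dl d) (md d) (bs d) (sl d) (fl d) None
    end
  else d.

Definition slow_tx (s : nat) (pat : seq nat) (d : dst) : option pk :=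
  if dl d is Some e then
    if ((s %% period) %% 3 == e %% 3) &&
       ((s %% period) %/ 3 <= nth 0 pat (frame_of s))
    then Some (enc (nth b0 (bs d) (s %/ stage - e)) (frame_of s)) else None
  else None.

(** A node of delay [e] listens to delay [e - 1], written [e + 2] modulo 3. In stage t, a node
    without delay can only have informed neighbours of delay exactly t, since adjacent delays differ
    by at most 1. *)
Definition class_of (s : nat) (d : dst) : nat :=
  if dl d is Some e then (e + 2) %% 3 else (s %/ stage) %% 3.

Definition decoded (l : seq (nat * pk)) : option batch :=
  if b <= size (undup (map fst l)) then Some (dec l) else None.

Definition fast_batch (l : seq (nat * pk)) (j : nat) : batch :=
  mk (take b (drop (b * j) (map snd l))).

(** The packets of batch 0 are spread over at most one stage. If the first arrives in stage q, the
    batch is complete when stage q + 1 ends, which sets the delay to q + 2. This is the origin of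
    the 2 here and in [fast_delay]. *)
Definition end_stage (t : nat) (d : dst) : dst :=
  match dl d with
  | None =>
      match decoded (sl d) with
      | Some x => Dst (Some t.+1) MSlow [:: x] [::] (fl d) (rl d)
      | None =>
          if fl d is (s1, _) :: _ then
            if s1 %/ stage + 2 <= t.+1 then
              Dst (Some t.+1) MFast [:: fast_batch (fl d) 0] [::] (fl d) (rl d)
            else Dst (dl d) (md d) (bs d) [::] (fl d) (rl d)
          else Dst (dl d) (md d) (bs d) [::] (fl d) (rl d)
      end
  | Some _ =>
      let x := match md d with
        | MSrc f => f (size (bs d))
        | MSlow => odflt b0 (decoded (sl d))
        | MFast => fast_batch (fl d) (size (bs d))
        end in
      Dst (dl d) (md d) (rcons (bs d) x) [::] (fl d) (rl d)
  end.

Definition slow_upd (s : nat) (d : dst) (fb : feedback B) : dst :=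
  let l := if fb is Received p then
             if (s %% period) %% 3 == class_of s d
             then rcons (sl d) (frame_of s, p) else sl d
           else sl d in
  let d' := Dst (dl d) (md d) (bs d) l (fl d) (rl d) in
  if stage %| s.+1 then end_stage (s %/ stage) d' else d'.

End Data.

(** * Correctness of the data phase for a given tree, delays and patterns *)

Section Transmission.
Variables (B b F lam : nat) (batch : Type) (b0 : batch).
Variables (enc pkt : batch -> nat -> B.-tuple bool).
Variables (dec : seq (nat * B.-tuple bool) -> batch).
Variables (mk : seq (B.-tuple bool) -> batch).
Local Notation pk := (B.-tuple bool).
Local Notation dst := (dst B batch).
Local Notation period := (period lam).
Local Notation stage := (stage F lam).
Local Notation frame_of := (frame_of F lam).

Hypothesis b_gt0 : 0 < b.
Hypothesis b_leF : b <= F.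
Hypothesis decP : forall x l,
  (forall f p, (f, p) \in l -> f < F /\ p = enc x f) ->
  b <= size (undup (map fst l)) -> dec l = x.
Hypothesis mkP : forall x, mk (mkseq (pkt x) b) = x.

Variables (V : finType) (adj : rel V) (src : V) (SB : nat -> batch).
Variables (L rk : V -> nat) (hf fr : V -> bool) (pat : V -> seq nat).
Variables (par head : V -> V) (depth dlt : V -> nat).

Definition slot (v : V) : nat := L v + 3 * rk v.

Hypothesis adjC : symmetric adj.
Hypothesis L_adj : forall u v, adj u v -> L v <= (L u).+1.
Hypothesis rk_le : forall v, rk v <= lam.
Hypothesis parP : forall v u, hf v ->
  [&& adj v u, (L u).+1 == L v, fr u & rk u == rk v] = (u == par v).
Hypothesis head_par : forall v, hf v -> head v = head (par v).
Hypothesis depth_par : forall v, hf v -> depth v = (depth (par v)).+1.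
Hypothesis head_top : forall v, ~~ hf v -> head v = v /\ depth v = 0.
Hypothesis L_head : forall v, L (head v) + depth v = L v.
Hypothesis rk_head : forall v, rk (head v) = rk v.

(** The first packet leaves the head at its slot within the stage and would be relayed by [v] after
    [depth v] further steps; it is received one step before that, hence [.-1]. *)
Definition fast_delay (v : V) : nat :=
  (slot (head v) %% period + depth v).-1 %/ stage + 2.

Hypothesis dlt_src : dlt src = 0.
Hypothesis dlt_adj : forall u v, adj u v -> dlt v <= (dlt u).+1.
Hypothesis dlt_hf : forall v, hf v -> dlt v <= dlt (head v) + fast_delay v.
Hypothesis dlt_cause : forall v, v != src ->
  (exists2 u, adj u v & dlt v = (dlt u).+1) \/
  (hf v /\ dlt v = dlt (head v) + fast_delay v).

Definition feeders (v : V) : {set V} := [set u | adj v u & (dlt u).+1 == dlt v].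

Hypothesis pat_ok : forall v, feeders v != set0 -> b <= frames lam feeders pat v.
Hypothesis pat_size : forall v, size (pat v) = F.

Definition fast_round (s : nat) (c : V -> dst) : V -> dst := fun v =>
  fast_upd lam s (slot v) (hf v) (c v)
    (perceive adj (fun u => fast_tx b F lam b0 pkt s (slot u) (hf u) (fr u) (c u)) v).

Definition slow_round (s : nat) (c : V -> dst) : V -> dst := fun v =>
  slow_upd b F lam b0 dec mk s (c v)
    (perceive adj (fun u => slow_tx F lam b0 enc s (pat u) (c u)) v).

(* What the head of a fast path emits, and what a node at depth j relays j
   double rounds later. *)
Definition emit (s : nat) (h : V) : option pk :=
  if [&& dlt h <= s %/ stage, s == slot h %[mod period] & frame_of s < b]
  then Some (pkt (SB (s %/ stage - dlt h)) (frame_of s)) else None.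

Definition relayed (s : nat) (v : V) : option pk :=
  if depth v <= s then emit (s - depth v) (head v) else None.

Definition arrivals (s : nat) (v : V) : seq (nat * pk) :=
  pmap (fun i => omap (pair i) (relayed i.+1 v)) (iota 0 s).

Definition feed (s : nat) (v : V) : nat :=
  if dlt v <= s %/ stage then (dlt v).-1 else s %/ stage.

Record core_inv (s : nat) (c : V -> dst) : Prop := {
  di_dl : forall v, dl (c v) = if dlt v <= s %/ stage then Some (dlt v) else None;
  di_bs : forall v, dlt v <= s %/ stage ->
    bs (c v) = mkseq SB (s %/ stage - dlt v).+1;
  di_md : forall v, dlt v <= s %/ stage ->
    match md (c v) with
    | MSrc f => f =1 SB
    | MSlow => feeders v != set0
    | MFast => hf v /\ dlt v = dlt (head v) + fast_delay v
    end }.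

Record fast_inv (s : nat) (c : V -> dst) : Prop := {
  di_rl : forall v, hf v -> rl (c v) = relayed s v;
  di_fl : forall v, fl (c v) = if hf v then arrivals s v else [::] }.

Record slow_inv (s : nat) (c : V -> dst) : Prop := {
  si_sound : forall v f p, dlt v != 0 -> (f, p) \in sl (c v) ->
    [/\ f < F, p = enc (SB (s %/ stage - feed s v)) f &
        [exists u, adj v u && (dlt u == feed s v)]];
  si_complete : forall v i u, dlt v != 0 -> s %/ stage * stage <= i < s ->
    (i %% period) %% 3 = feed s v %% 3 ->
    [set u | adj v u & dlt u == feed s v] :&:
      above ((i %% period) %/ 3) (fun u => nth 0 (pat u) (frame_of i)) = [set u] ->
    frame_of i \in map fst (sl (c v)) }.

Lemma period_gt0 : 0 < period. Proof. by rewrite /period. Qed.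

Lemma F_gt0 : 0 < F. Proof. exact: leq_trans b_gt0 b_leF. Qed.

Lemma stage_gt0 : 0 < stage.
Proof. by rewrite /stage muln_gt0 F_gt0 period_gt0. Qed.

Lemma par_spec v : hf v ->
  [/\ adj v (par v), (L (par v)).+1 = L v, fr (par v) & rk (par v) = rk v].
Proof.
move=> hv; have := parP (par v) hv; rewrite eqxx => /and4P[? /eqP ? ? /eqP ?].
by split.
Qed.

Lemma slot_par v : hf v -> (slot (par v)).+1 = slot v.
Proof. by case/par_spec => _ H _ R; rewrite /slot R; lia. Qed.

Lemma slot_head v : slot (head v) + depth v = slot v.
Proof. by rewrite /slot rk_head -(L_head v); lia. Qed.

Lemma relayed_slot s v : relayed s v -> s == slot v %[mod period].
Proof.
rewrite /relayed; case: leqP => // ds; rewrite /emit; case: ifP => // /and3P[_ E _] _.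
by rewrite -(subnK ds) -slot_head eqn_modDr.
Qed.

Lemma relayed_hf s v : hf v -> relayed s.+1 v = relayed s (par v).
Proof.
move=> hv; rewrite /relayed (depth_par hv) (head_par hv) ltnS.
by case: leqP => // _; rewrite subSS.
Qed.

(** Modulo 3 the slots show which of three possible levels [u] has, namely the one above [v]. What
    remains is an equality between multiples of 3 below [period], so the ranks agree, and the
    matching property [parP] identifies [u]. *)
Lemma slots_apart u v : adj u v -> hf v -> fr u -> (slot u).+1 == slot v %[mod period] ->
  u = par v.
Proof.
move=> uv hv fu E; apply/eqP; rewrite -(parP u hv) fu adjC uv /=.
have h1 := L_adj uv; have h2 : L u <= (L v).+1 by apply: L_adj; rewrite adjC.
have ru := rk_le u; have rv := rk_le v.
have E3 : (slot u).+1 = slot v %[mod 3].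
  have d3 : 3 %| period by rewrite /period dvdn_mulr.
  by rewrite -(modn_dvdm (slot u).+1 d3) (eqP E) modn_dvdm.
have EL : (L u).+1 = L v by move: E3; rewrite /slot; lia.
rewrite EL eqxx /=; move: E; rewrite /slot -EL -!addSn eqn_modDl => E.
have small x : x <= lam -> 3 * x < period by rewrite /period; lia.
by move: E; rewrite !modn_small ?small // eqn_mul2l.
Qed.
Lemma fast_txE s c u : core_inv s c -> fast_inv s c ->
  fast_tx b F lam b0 pkt s (slot u) (hf u) (fr u) (c u) =
    if fr u then relayed s u else None.
Proof.
move=> H Hf; rewrite /fast_tx; case: (fr u) => //; case: ifP => hu.
  exact: (di_rl Hf hu).
have [hE dE] := head_top (negbT hu).
rewrite /head_tx (di_dl H) /relayed hE dE subn0 /= /emit.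
case: ifP => //= du; rewrite (di_bs H du).
by case: ifP => // _; rewrite nth_mkseq.
Qed.

Lemma arrivals_step s v : arrivals s.+1 v =
  if relayed s.+1 v is Some p then rcons (arrivals s v) (s, p) else arrivals s v.
Proof.
rewrite /arrivals -[in iota 0 s.+1]addn1 iotaD pmap_cat add0n /=.
by case: (relayed s.+1 v) => [p|]; rewrite /= ?cats0 ?cats1.
Qed.

Lemma fast_roundP s c (c1 := fast_round s c) v : core_inv s c -> fast_inv s c ->
  [/\ dl (c1 v) = dl (c v), md (c1 v) = md (c v), bs (c1 v) = bs (c v) &
      sl (c1 v) = sl (c v)] /\
  [/\ hf v -> rl (c1 v) = relayed s.+1 v &
      fl (c1 v) = if hf v then arrivals s.+1 v else [::]].
Proof.
move=> H Hf; rewrite /c1 /fast_round; set tx := fun u => fast_tx _ _ _ _ _ _ _ _ _ _.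
have txE u : tx u = if fr u then relayed s u else None by exact: fast_txE.
rewrite /fast_upd; case: ifPn => hv; last by have := di_fl Hf v; rewrite (negbTE hv).
have fE := di_fl Hf v; rewrite hv in fE.
rewrite arrivals_step (relayed_hf s hv).
have [sv|sv] := boolP (s.+1 == slot v %[mod period]); last first.
  have -> : relayed s (par v) = None.
    case E : (relayed s (par v)) => //; case/negP: sv.
    have : relayed s (par v) by rewrite E.
    move/relayed_slot => E'; rewrite -addn1 -(slot_par hv).
    by rewrite -[X in _ == X %[mod _]]addn1 eqn_modDr.
  by case: (perceive adj tx v) => [|p|].
(* A node transmits only in its own slot; as 3 divides [period], that is never the step in which it
   must listen to its parent. *)
have tv : tx v = None.
  rewrite txE; case: (fr v) => //; case E : (relayed s v) => //; exfalso.
  have : relayed s v by rewrite E.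
  move/relayed_slot => /eqP E'.
  have d3 : 3 %| period by rewrite /period dvdn_mulr.
  have := eqP sv; rewrite -addn1 -modnDml E' modnDml.
  move=> /(congr1 (modn^~ 3)); rewrite !modn_dvdm //; lia.
have [vp _ frp _] := par_spec hv.
have uniq u : adj v u -> tx u -> u = par v.
  rewrite txE; case: ifP => // fu vu /relayed_slot E; apply: slots_apart => //.
    by rewrite adjC.
  by move: sv; rewrite /= -addn1 => /eqP <-; rewrite -[(slot u).+1]addn1 eqn_modDr eq_sym.
case E : (relayed s (par v)) => [p|].
  by rewrite (perceive_one (u := par v) (p := p)) // ?txE ?frp // fE.
case E' : (perceive adj tx v) => [|p|] //=.
have [u vu [up _]] := perceive_received E'.
have uE : u = par v by apply: uniq; rewrite ?up.
by move: up; rewrite uE txE frp E.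
Qed.

Lemma feed_fixed s v : s.+1 %/ stage = s %/ stage -> feed s.+1 v = feed s v.
Proof. by rewrite /feed => ->. Qed.

Lemma slow_txE s c u : core_inv s c ->
  slow_tx F lam b0 enc s (pat u) (c u) =
    if [&& dlt u <= s %/ stage, (s %% period) %% 3 == dlt u %% 3 &
           (s %% period) %/ 3 <= nth 0 (pat u) (frame_of s)]
    then Some (enc (SB (s %/ stage - dlt u)) (frame_of s)) else None.
Proof.
move=> H; rewrite /slow_tx (di_dl H); case: ifP => //= du.
by rewrite (di_bs H du) nth_mkseq.
Qed.

Lemma class_ofE s c v : core_inv s c -> dlt v != 0 ->
  class_of F lam s (c v) = feed s v %% 3.
Proof.
move=> H v0; rewrite /class_of (di_dl H) /feed; case: ifP => _ //.
by move: v0; case: (dlt v) => // d _; lia.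
Qed.

(** Delays of neighbours differ by at most 1, so among informed neighbours the residue modulo 3
    determines the delay. *)
Lemma feeder_class s u v : adj v u -> dlt v != 0 -> dlt u <= s %/ stage ->
  dlt u %% 3 = feed s v %% 3 -> dlt u = feed s v.
Proof.
move=> vu v0 du; have h1 := dlt_adj vu; have h2 : dlt v <= (dlt u).+1.
  by apply: dlt_adj; rewrite adjC.
by rewrite /feed; case: ifP => h; lia.
Qed.

Lemma slow_listen s c v : core_inv s c -> dlt v != 0 ->
  (s %% period) %% 3 = feed s v %% 3 ->
  slow_tx F lam b0 enc s (pat v) (c v) = None.
Proof.
move=> H v0 E; rewrite slow_txE //; case: ifP => // /and3P[dv /eqP E' _].
move: E E'; rewrite /feed dv; lia.
Qed.

Definition sl_after (s : nat) (c : V -> dst) (v : V) : seq (nat * pk) :=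
  if perceive adj (fun u => slow_tx F lam b0 enc s (pat u) (c u)) v is Received p then
    if (s %% period) %% 3 == class_of F lam s (c v)
    then rcons (sl (c v)) (frame_of s, p) else sl (c v)
  else sl (c v).

Lemma frame_ltF s : frame_of s < F.
Proof. by rewrite ltn_mod F_gt0. Qed.

Lemma sl_after_sound s c v : core_inv s c -> slow_inv s c -> dlt v != 0 ->
  forall f p, (f, p) \in sl_after s c v ->
    [/\ f < F, p = enc (SB (s %/ stage - feed s v)) f &
        [exists u, adj v u && (dlt u == feed s v)]].
Proof.
move=> H Hs v0 f p; rewrite /sl_after.
case E : (perceive _ _ _) => [|q|]; try exact: (si_sound Hs v0).
case: eqP => Ec; last exact: (si_sound Hs v0).
rewrite mem_rcons inE => /orP[/eqP[-> ->]|]; last exact: (si_sound Hs v0).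
rewrite class_ofE // in Ec.
have [u vu [up _]] := perceive_received E.
move: up; rewrite slow_txE //; case: ifP => // /and3P[du /eqP cu _] [<-].
have uE : dlt u = feed s v by apply: feeder_class => //; rewrite -cu.
rewrite frame_ltF uE; split=> //; apply/existsP; exists u.
by rewrite vu uE eqxx.
Qed.

Lemma feed_le s v : feed s v <= s %/ stage.
Proof. by rewrite /feed; case: ifP => // h; lia. Qed.

Lemma sl_after_complete s c v : core_inv s c -> slow_inv s c -> dlt v != 0 ->
  forall i u, s %/ stage * stage <= i <= s ->
    (i %% period) %% 3 = feed s v %% 3 ->
    [set u | adj v u & dlt u == feed s v] :&:
      above ((i %% period) %/ 3) (fun u => nth 0 (pat u) (frame_of i)) = [set u] ->
    frame_of i \in map fst (sl_after s c v).
Proof.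
move=> H Hs v0 i u /andP[ti]; rewrite leq_eqVlt => /orP[/eqP ->|lt] Ei Eu; last first.
  have := si_complete Hs v0 _ Ei Eu; rewrite ti lt => /(_ isT) h.
  rewrite /sl_after; case: (perceive _ _ _) => // p; case: ifP => // _.
  by rewrite map_rcons mem_rcons inE h orbT.
have : u \in [set u] := set11 u.
rewrite -Eu !inE => /andP[/andP[vu /eqP du] ab].
have us : slow_tx F lam b0 enc s (pat u) (c u) =
    Some (enc (SB (s %/ stage - dlt u)) (frame_of s)).
  by rewrite slow_txE // du feed_le Ei eqxx ab.
rewrite /sl_after (perceive_one (slow_listen H v0 Ei) vu us).
  by rewrite class_ofE // Ei eqxx map_rcons mem_rcons inE eqxx.
move=> u' vu'; rewrite slow_txE //; case: ifP => // /and3P[du' /eqP cu' ab'] _.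
have uE : dlt u' = feed s v by apply: feeder_class => //; rewrite -cu'.
have : u' \in [set u] by rewrite -Eu !inE vu' uE eqxx ab'.
by rewrite inE => /eqP.
Qed.

Lemma nonempty_feeders s v : dlt v != 0 -> dlt v <= (s %/ stage).+1 ->
  [set u | adj v u & dlt u == feed s v] = feeders v.
Proof.
move=> v0 dv; apply/setP => u; rewrite !inE; case: (adj v u) => //=.
by rewrite /feed; case: ifP; lia.
Qed.

(** Every good frame of the feeders delivers the symbol with the index of that frame, and [pat_ok]
    provides [b] good frames in each stage. *)
Lemma decoded_end s c v : core_inv s c -> slow_inv s c -> dlt v != 0 ->
  stage %| s.+1 -> dlt v <= (s %/ stage).+1 ->
  feeders v != set0 ->
  decoded b dec (sl_after s c v) = Some (SB (s %/ stage - feed s v)).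
Proof.
move=> H Hs v0 ds dv fv; rewrite /decoded.
have sound := sl_after_sound H Hs v0.
have cnt : b <= size (undup (map fst (sl_after s c v))).
  apply: leq_trans (pat_ok fv) _; rewrite /frames pat_size -size_filter.
  apply: uniq_leq_size; first by rewrite filter_uniq ?iota_uniq.
  move=> f; rewrite mem_filter mem_iota add0n mem_undup /= => /andP[/existsP[l E] fF].
  set t := s %/ stage; have sE : s.+1 = t.+1 * stage.
    rewrite [LHS](divn_eq s.+1 stage) (eqP ds) addn0; congr (_ * _).
    by rewrite divnS ?stage_gt0 // ds add1n.
  (* The time [i] below is the slow round of this stage reserved for frame [f], Decay level [l] and
     the delay class of the feeders. *)
  pose k := 3 * l + feed s v %% 3.
  have kp : k < period by rewrite /k /period; have := ltn_ord l; lia.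
  pose i := t * stage + f * period + k.
  have p0 := period_gt0.
  have ip : i %% period = k.
    by rewrite /i /stage mulnA -mulnDl modnMDl modn_small.
  have iF : frame_of i = f.
    rewrite /i /frame_of /stage mulnA -mulnDl divnMDl // (divn_small kp) addn0.
    by rewrite modnMDl modn_small.
  have k3 : k %/ 3 = l by rewrite /k; lia.
  have /cards1P[u Eu] := E.
  have := @sl_after_complete s c v H Hs v0 i u; rewrite iF ip k3; apply.
  - rewrite -/t; apply/andP; split; first by rewrite /i -addnA leq_addr.
    rewrite -ltnS sE mulSn /i.
    have : f.+1 * period <= stage by rewrite /stage leq_mul2r fF orbT.
    by rewrite mulSn; lia.
  - by rewrite /k; lia.
  - by rewrite nonempty_feeders.
rewrite cnt; congr Some; apply: decP cnt => f p fp.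
by have [] := sound f p fp.
Qed.

Lemma decoded_none s c v : core_inv s c -> slow_inv s c -> dlt v != 0 ->
  ~~ [exists u, adj v u && (dlt u == feed s v)] ->
  decoded b dec (sl_after s c v) = None.
Proof.
move=> H Hs v0 N; rewrite /decoded.
have -> : sl_after s c v = [::].
  case E: (sl_after s c v) => [//|[f p] l].
  have [|_ _ X] := sl_after_sound H Hs v0 (f := f) (p := p).
    by rewrite E inE eqxx.
  by rewrite X in N.
by case: b b_gt0.
Qed.

Lemma pmap_none (T : eqType) (U : Type) (g : T -> option U) (l : seq T) :
  (forall x, x \in l -> g x = None) -> pmap g l = [::].
Proof.
elim: l => //= x l IH H; rewrite (H x) ?inE ?eqxx //= IH // => y yl.
by apply: H; rewrite inE yl orbT.
Qed.

Lemma pmap_iota_single (U : Type) (g : nat -> option U) a o n : o < n ->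
  (forall k, k < n -> k != o -> g (a + k) = None) ->
  pmap g (iota a n) = if g (a + o) is Some y then [:: y] else [::].
Proof.
move=> on H; have -> : n = o + (1 + (n - o.+1)) by lia.
rewrite !iotaD !pmap_cat pmap_none; last first.
  by move=> x; rewrite mem_iota => h; rewrite (_ : x = a + (x - a)); [apply: H | ]; lia.
rewrite [X in _ ++ (_ ++ X)]pmap_none ?cats0 /=; last first.
  by move=> x; rewrite mem_iota => h; rewrite (_ : x = a + (x - a)); [apply: H | ]; lia.
by case: (g _).
Qed.

(** * The stream of packets along a fast path *)

Lemma emit_early x h : x < dlt h * stage + slot h %% period -> emit x h = None.
Proof.
move=> lt; rewrite /emit; case: ifP => // /and3P[dx /eqP E _]; exfalso.
have ge : dlt h * stage <= x by rewrite -leq_divRL ?stage_gt0.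
have op : slot h %% period < period by rewrite ltn_mod period_gt0.
move: E; have -> : x = dlt h * F * period + (x - dlt h * stage).
  by rewrite -mulnA -/stage; lia.
rewrite modnMDl modn_small; last lia.
lia.
Qed.

Lemma emit_block h m f k : f < F -> k < period ->
  emit ((dlt h + m) * stage + f * period + k) h =
    if (k == slot h %% period) && (f < b) then Some (pkt (SB m) f) else None.
Proof.
move=> fF kp; rewrite /emit.
have lt : f * period + k < stage.
  have : f.+1 * period <= stage by rewrite /stage leq_mul2r fF orbT.
  by rewrite mulSn; lia.
rewrite -addnA divnMDl ?stage_gt0 // (divn_small lt) addn0 leq_addr addKn /=.
have E : (dlt h + m) * stage + (f * period + k) = ((dlt h + m) * F + f) * period + k.
  by rewrite [(_ * F + f) * _]mulnDl -addnA -mulnA.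
have -> : frame_of ((dlt h + m) * stage + (f * period + k)) = f.
  by rewrite E /frame_of divnMDl ?period_gt0 // (divn_small kp) addn0 modnMDl modn_small.
by rewrite E modnMDl (modn_small kp).
Qed.

Lemma emit_frames h m n : n <= F ->
  pmap (emit^~ h) (iota ((dlt h + m) * stage) (n * period)) =
    mkseq (pkt (SB m)) (minn n b).
Proof.
elim: n => [|f IH] fF; first by rewrite min0n.
rewrite mulSn [period + _]addnC iotaD pmap_cat IH ?(ltnW fF) //.
have op : slot h %% period < period by rewrite ltn_mod period_gt0.
rewrite (pmap_iota_single op) => [|k kp ko]; last by rewrite emit_block // (negbTE ko).
rewrite emit_block // eqxx /=; case: ltnP => fb.
  rewrite (_ : minn f.+1 b = f.+1) ?mkseqS ?cats1 //; lia.
by rewrite cats0; congr mkseq; lia.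
Qed.

Lemma emit_stages h m :
  pmap (emit^~ h) (iota 0 ((dlt h + m) * stage)) =
    flatten (mkseq (fun j => mkseq (pkt (SB j)) b) m).
Proof.
elim: m => [|m IH].
  rewrite pmap_none // => x; rewrite mem_iota addn0 => /andP[_ lt].
  by apply: emit_early; lia.
rewrite addnS mulSn [stage + _]addnC iotaD pmap_cat IH mkseqS -cats1 flatten_cat /= cats0.
by rewrite add0n emit_frames // (minn_idPr b_leF).
Qed.

Lemma map_snd_arrivals s v : hf v -> depth v <= s.+1 ->
  map snd (arrivals s v) = pmap (emit^~ (head v)) (iota 0 (s.+1 - depth v)).
Proof.
move=> hv ds; have d0 : 0 < depth v by rewrite (depth_par hv).
have -> : map snd (arrivals s v) = pmap (fun i => relayed i.+1 v) (iota 0 s).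
  rewrite /arrivals; elim: (iota 0 s) => //= i l <-.
  by case: (relayed i.+1 v).
have -> : s = (depth v).-1 + (s.+1 - depth v) by lia.
rewrite iotaD pmap_cat pmap_none; last first.
  by move=> i; rewrite mem_iota /relayed => h; rewrite leqNgt ifN //; lia.
rewrite add0n cat0s -[(depth v).-1]addn0 iotaDl.
have -> : (depth v).-1 + 0 + (s.+1 - depth v) = s by lia.
elim: (iota 0 _) => //= i l ->.
rewrite /relayed; have -> : ((depth v).-1 + i).+1 = i + depth v by lia.
by rewrite leq_addl addnK.
Qed.

Lemma fast_batch_ok s v j : hf v ->
  (dlt (head v) + j.+1) * stage + depth v <= s.+1 ->
  fast_batch b mk (arrivals s v) j = SB j.
Proof.
move=> hv H; rewrite /fast_batch map_snd_arrivals //; last by lia.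
have -> : s.+1 - depth v = (dlt (head v) + j.+1) * stage +
    (s.+1 - depth v - (dlt (head v) + j.+1) * stage) by lia.
rewrite iotaD pmap_cat emit_stages mkseqS -cats1 flatten_cat /= cats0 -!catA.
rewrite drop_size_cat; last first.
  elim: j {H} => [|j IH]; first by rewrite muln0.
  by rewrite mkseqS -cats1 flatten_cat size_cat IH /= cats0 size_mkseq mulnSr.
by rewrite take_size_cat ?size_mkseq // mkP.
Qed.

Definition first_arrival v : nat :=
  (dlt (head v) * stage + slot (head v) %% period + depth v).-1.

Lemma first_arrival_delay v : hf v ->
  first_arrival v %/ stage + 2 = dlt (head v) + fast_delay v.
Proof.
move=> hv; rewrite /first_arrival /fast_delay (depth_par hv) !addnS /= -addnA.
by rewrite divnMDl ?stage_gt0 // addnA.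
Qed.

Lemma arrivals_early s v : hf v -> s <= first_arrival v -> arrivals s v = [::].
Proof.
move=> hv ls; rewrite /arrivals pmap_none // => i; rewrite mem_iota => /andP[_ li].
rewrite /relayed; case: leqP => //= di; rewrite emit_early //.
by move: ls; rewrite /first_arrival; lia.
Qed.

Lemma arrivals_first s v : hf v -> first_arrival v < s ->
  exists p l, arrivals s v = (first_arrival v, p) :: l.
Proof.
move=> hv lt; have -> : s = first_arrival v + (1 + (s - (first_arrival v).+1)) by lia.
have := arrivals_early hv (leqnn (first_arrival v)).
rewrite /arrivals !iotaD !pmap_cat => -> /=; rewrite add0n.
have d0 : 0 < depth v by rewrite (depth_par hv).
have -> : relayed (first_arrival v).+1 v = Some (pkt (SB 0) 0).
  rewrite /relayed /first_arrival prednK; last lia.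
  rewrite leq_addl addnK.
  have := @emit_block (head v) 0 0 (slot (head v) %% period) F_gt0.
  by rewrite addn0 mul0n addn0 eqxx b_gt0 ltn_mod period_gt0 => ->.
by do 2 eexists.
Qed.

Lemma fast_delay_ge v j t : hf v -> dlt (head v) + fast_delay v + j <= t ->
  (dlt (head v) + j.+1) * stage + depth v <= t * stage.
Proof.
move=> hv H; set o := (slot (head v) %% period + depth v).-1.
have h1 : depth v <= o.+1 by rewrite /o; lia.
have h2 : o < (o %/ stage).+1 * stage by apply: ltn_ceil; exact: stage_gt0.
have h3 : dlt (head v) + (o %/ stage + 2) + j <= t by exact: H.
have h4 : (dlt (head v) + j.+1 + (o %/ stage).+1) * stage <= t * stage.
  by rewrite leq_mul2r; apply/orP; right; lia.
by move: h4; rewrite mulnDl; lia.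
Qed.

Lemma div_stage_step s :
  s.+1 %/ stage = if stage %| s.+1 then (s %/ stage).+1 else s %/ stage.
Proof. by rewrite divnS ?stage_gt0 //; case: (stage %| s.+1). Qed.

Lemma feeders_src v : feeders v != set0 -> dlt v != 0.
Proof.
by case/set0Pn => u; rewrite inE => /andP[_ /eqP <-].
Qed.

Lemma end_known s c c1 v : core_inv s c1 -> slow_inv s c1 -> fast_inv s.+1 c1 ->
  stage %| s.+1 -> dlt v <= s %/ stage ->
  c v = end_stage b F lam b0 dec mk (s %/ stage)
    (Dst (dl (c1 v)) (md (c1 v)) (bs (c1 v)) (sl_after s c1 v) (fl (c1 v)) (rl (c1 v))) ->
  [/\ dl (c v) = Some (dlt v), bs (c v) = mkseq SB ((s %/ stage).+1 - dlt v).+1,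
      md (c v) = md (c1 v), sl (c v) = [::] & fl (c v) = fl (c1 v) /\ rl (c v) = rl (c1 v)].
Proof.
move=> H Hs Hf ds dv ->; rewrite /end_stage /= (di_dl H) dv /= (di_bs H dv).
split=> //; rewrite size_mkseq subSn // [RHS]mkseqS; congr rcons.
have := di_md H dv; case: (md (c1 v)) => [f -> //|fv|[hv dE]].
  have v0 := feeders_src fv.
  rewrite (decoded_end H Hs v0 ds _ fv) /=; last exact: leqW.
  by congr SB; rewrite /feed dv; lia.
rewrite (di_fl Hf) hv; apply: fast_batch_ok => //.
have sE : s.+1 = (s %/ stage).+1 * stage.
  by rewrite [LHS](divn_eq s.+1 stage) (eqP ds) addn0 div_stage_step ds.
have := @fast_delay_ge v (s %/ stage - dlt v).+1 (s %/ stage).+1 hv.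
by rewrite -dE -sE => h; apply: leq_trans (h _) _; lia.
Qed.

(** A node fixes its delay neither early nor late. At delay t + 1 it decodes if it has feeders;
    otherwise [dlt_cause] makes the fast path responsible, and the time-stamp test succeeds now. For
    larger delays [dlt_adj] excludes senders of delay t, and [dlt_hf] makes the test fail. *)
Lemma end_unknown s c c1 v : core_inv s c1 -> slow_inv s c1 -> fast_inv s.+1 c1 ->
  stage %| s.+1 -> s %/ stage < dlt v ->
  c v = end_stage b F lam b0 dec mk (s %/ stage)
    (Dst (dl (c1 v)) (md (c1 v)) (bs (c1 v)) (sl_after s c1 v) (fl (c1 v)) (rl (c1 v))) ->
  [/\ sl (c v) = [::], fl (c v) = fl (c1 v), rl (c v) = rl (c1 v) &
   if dlt v == (s %/ stage).+1 then
     [/\ dl (c v) = Some (dlt v), bs (c v) = [:: SB 0] &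
       match md (c v) with
       | MSrc f => f =1 SB
       | MSlow => feeders v != set0
       | MFast => hf v /\ dlt v = dlt (head v) + fast_delay v
       end]
   else dl (c v) = None].
Proof.
set t := s %/ stage; move=> H Hs Hf ds dv ->.
have v0 : dlt v != 0 by lia.
have vs : v != src by apply: contraNneq v0 => ->; rewrite dlt_src.
have feedE : feed s v = t by rewrite /feed -/t leqNgt dv.
have sE : s.+1 = t.+1 * stage.
  by rewrite [LHS](divn_eq s.+1 stage) (eqP ds) addn0 div_stage_step ds.
rewrite /end_stage /= (di_dl H) -/t leqNgt dv /=.
have [E|NE] := eqVneq (dlt v) t.+1.
  have [f0|fv] := eqVneq (feeders v) set0; last first.
    rewrite (decoded_end H Hs v0 ds _ fv) ?E // feedE subnn /=; by split.
  have N : ~~ [exists u, adj v u && (dlt u == feed s v)].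
    apply/existsPn => u; rewrite feedE; move/setP/(_ u): f0; rewrite !inE E eqSS => ->.
    by [].
  rewrite (decoded_none H Hs v0 N).
  have [[u uv du]|[hv dE]] := dlt_cause vs.
    by move/setP/(_ u): f0; rewrite !inE adjC uv du eqxx.
  have dl1 := first_arrival_delay hv.
  have le1 : first_arrival v < s.+1.
    rewrite sE; apply: leq_trans (_ : (first_arrival v %/ stage).+1 * stage <= _).
      by apply: ltn_ceil; exact: stage_gt0.
    by rewrite leq_mul2r; apply/orP; right; lia.
  have [p [l aE]] := arrivals_first hv le1.
  have fb : fast_batch b mk (fl (c1 v)) 0 = SB 0.
    rewrite (di_fl Hf) hv; apply: fast_batch_ok => //.
    have := @fast_delay_ge v 0 t.+1 hv; rewrite addn0 -dE E -sE => h.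
    by apply: leq_trans (h _) _; lia.
  rewrite fb; move: (di_fl Hf v); rewrite hv aE => ->.
  rewrite dl1 -dE E leqnn /=; by split=> //; split.
have N : ~~ [exists u, adj v u && (dlt u == feed s v)].
  apply/existsPn => u; rewrite feedE negb_and; case vu: (adj v u) => //=.
  by apply/eqP => du; have := @dlt_adj u v; rewrite adjC => /(_ vu); lia.
rewrite (decoded_none H Hs v0 N) (di_fl Hf).
case: ifP => hv; last by split.
have dh := dlt_hf hv; have dl1 := first_arrival_delay hv.
case aE : (arrivals s.+1 v) => [|[s1 p] l]; first by split.
have s1E : s1 = first_arrival v.
  have [le1|lt1] := leqP s.+1 (first_arrival v).
    by move: aE; rewrite arrivals_early.
  by have [p' [l' E']] := arrivals_first hv lt1; move: aE; rewrite E' => -[].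
by rewrite s1E; case: leqP => h /=; [lia | split].
Qed.

Lemma data_step s c : core_inv s c -> fast_inv s c -> slow_inv s c ->
  let c' := slow_round s (fast_round s c) in
  [/\ core_inv s.+1 c', fast_inv s.+1 c' & slow_inv s.+1 c'].
Proof.
move=> H Hf Hs /=; set c1 := fast_round s c; set c' := slow_round s c1.
have R v := fast_roundP v H Hf.
have H1 : core_inv s c1.
  split=> v; have [[e1 e2 e3 _] _] := R v; rewrite ?e1 ?e2 ?e3;
    [exact: (di_dl H) | exact: (di_bs H) | exact: (di_md H)].
have Hs1 : slow_inv s c1.
  split=> [v f p|v i u]; have [[_ _ _ ->] _] := R v;
    [exact: (si_sound Hs) | exact: (si_complete Hs)].
have Hf1 : fast_inv s.+1 c1.
  by split=> v; have [_ [? ?]] := R v.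
have c'E v : c' v = (if stage %| s.+1 then end_stage b F lam b0 dec mk (s %/ stage) else id)
    (Dst (dl (c1 v)) (md (c1 v)) (bs (c1 v)) (sl_after s c1 v) (fl (c1 v)) (rl (c1 v))).
  by rewrite /c' /slow_round /slow_upd /sl_after; case: ifP.
have [ds|nds] := boolP (stage %| s.+1); last first.
  have tE : s.+1 %/ stage = s %/ stage by rewrite div_stage_step (negbTE nds).
  have E v : c' v = Dst (dl (c1 v)) (md (c1 v)) (bs (c1 v)) (sl_after s c1 v)
      (fl (c1 v)) (rl (c1 v)).
    by rewrite c'E (negbTE nds).
  split.
  - by split=> v; rewrite E tE; [exact: (di_dl H1) | exact: (di_bs H1) | exact: (di_md H1)].
  - by split=> v; rewrite E; [exact: (di_rl Hf1) | exact: (di_fl Hf1)].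
  - split=> [v f p v0|v i u v0]; rewrite E tE (feed_fixed v tE).
      exact: (sl_after_sound H1 Hs1 v0).
    by rewrite ltnS; apply: (sl_after_complete H1 Hs1 v0).
have tE : s.+1 %/ stage = (s %/ stage).+1 by rewrite div_stage_step ds.
have EK v : dlt v <= s %/ stage -> _ := fun dv => end_known (c := c') H1 Hs1 Hf1 ds dv
  (etrans (c'E v) (congr1 (fun x : bool => (if x then _ else id) _) ds)).
have EU v : s %/ stage < dlt v -> _ := fun dv => end_unknown (c := c') H1 Hs1 Hf1 ds dv
  (etrans (c'E v) (congr1 (fun x : bool => (if x then _ else id) _) ds)).
split.
- split=> v; rewrite tE.
  + have [dv|dv] := leqP (dlt v) (s %/ stage).
      by have [-> _ _ _ _] := EK v dv; rewrite (leqW dv).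
    have [_ _ _] := EU v dv; case: eqP => [E [-> _ _]|NE ->]; first by rewrite E leqnn.
    by rewrite ifN // -ltnNge; lia.
  + have [dv _|dv] := leqP (dlt v) (s %/ stage); first by have [_ -> _ _ _] := EK v dv.
    have [_ _ _] := EU v dv; case: eqP => [E [_ -> _] _|NE _ h]; last by lia.
    by rewrite E subnn.
  + have [dv _|dv] := leqP (dlt v) (s %/ stage).
      by have [_ _ -> _ _] := EK v dv; apply: (di_md H1).
    have [_ _ _] := EU v dv; case: eqP => [E [_ _ h] _ //|NE _ h]; by lia.
- split=> v; have [dv|dv] := leqP (dlt v) (s %/ stage).
  + by have [_ _ _ _ [_ ->]] := EK v dv; apply: (di_rl Hf1).
  + by have [_ _ -> _] := EU v dv; apply: (di_rl Hf1).
  + by have [_ _ _ _ [-> _]] := EK v dv; apply: (di_fl Hf1).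
  + by have [_ -> _ _] := EU v dv; apply: (di_fl Hf1).
have nil v : sl (c' v) = [::].
  have [dv|dv] := leqP (dlt v) (s %/ stage); first by have [_ _ _ ->] := EK v dv.
  by have [-> _] := EU v dv.
have sE : s.+1 = s.+1 %/ stage * stage by rewrite divnK.
split=> [v f p _|v i u _]; first by rewrite nil.
by rewrite -sE; lia.
Qed.

End Transmission.
Record schedule (V : finType) (adj : rel V) (src : V) (L : V -> nat) (w lam : nat)
    (c : V -> gst) (F : nat) (par head : V -> V) (depth dlt : V -> nat) : Prop := {
  sch_par : forall v u, hf (c v) ->
    [&& adj v u, (L u).+1 == L v, fr (c u) & rk (c u) == rk (c v)] = (u == par v);
  sch_head : forall v, hf (c v) -> head v = head (par v);
  sch_depth : forall v, hf (c v) -> depth v = (depth (par v)).+1;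
  sch_top : forall v, ~~ hf (c v) -> head v = v /\ depth v = 0;
  sch_level : forall v, L (head v) + depth v = L v;
  sch_rank : forall v, rk (c (head v)) = rk (c v);
  sch_src : dlt src = 0;
  sch_adj : forall u v, adj u v -> dlt v <= (dlt u).+1;
  sch_hf : forall v, hf (c v) ->
    dlt v <= dlt (head v) + fast_delay F lam L (fun u => rk (c u)) head depth v;
  sch_cause : forall v, v != src ->
    (exists2 u, adj u v & dlt v = (dlt u).+1) \/
    (hf (c v) /\
     dlt v = dlt (head v) + fast_delay F lam L (fun u => rk (c u)) head depth v);
  sch_bound : forall v, dlt v * stage F lam <=
    L v + 4 * stage F lam * (L v %/ w * lam.+1 + lam) + 3 * stage F lam }.

(** * From the trees to fast paths and a bound on the delays *)

Section Structure.
Variables (V : finType) (adj : rel V) (src : V) (L : V -> nat) (w lam : nat).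
Variable c : V -> gst.
Hypothesis adjC : symmetric adj.
Hypothesis conn : forall x y, connect adj x y.
Hypothesis L_src : L src = 0.
Hypothesis L_adj : forall u v, adj u v -> L v <= (L u).+1.
Hypothesis L_up : forall v, v != src -> exists2 u, adj v u & (L u).+1 = L v.
Hypothesis w3 : 2 < w.
Let off v := L v %% w.
Hypothesis tree : tree_ok adj lam off 0 c.
Let rk v := rk (c v).
Let hf v := hf (c v).
Let fr v := fr (c v).

(** Adjacent levels differ by at most 1, and a width of at least 3 keeps the two sides apart modulo
    [w]. *)
Lemma off_up u v : adj v u -> 0 < off v -> ((off u).+1 == off v) = ((L u).+1 == L v).
Proof.
move=> vu o0; have h1 : L u <= (L v).+1 by exact: L_adj.
have h2 : L v <= (L u).+1 by apply: L_adj; rewrite adjC.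
have E : L v = L v %/ w * w + off v by exact: divn_eq.
have w0 : 0 < w by lia.
have ow : off v < w by rewrite ltn_mod.
apply/idP/idP => /eqP H; apply/eqP.
  have [e|[e|e]] : L u = L v \/ L u = (L v).+1 \/ (L u).+1 = L v by lia.
  - by move: H; rewrite /off e; lia.
  - move: H; rewrite {1}/off e E -addnS modnMDl.
    have [lt|ge] := ltnP (off v).+1 w; first by rewrite modn_small //; lia.
    have -> : (off v).+1 = w by lia.
    by rewrite modnn; lia.
  - exact: e.
have -> : off u = (off v).-1; last lia.
rewrite {1}/off; have -> : L u = L v %/ w * w + (off v).-1 by lia.
by rewrite modnMDl modn_small //; lia.
Qed.

Let par v := odflt v [pick u | [&& adj v u, (L u).+1 == L v, fr u & rk u == rk v]].

Lemma hf_off v : hf v -> 0 < off v.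
Proof.
rewrite lt0n /hf => h; apply: contraL h => /eqP E.
by apply: (ok_hf tree); rewrite E.
Qed.

Lemma par_unique v u : hf v ->
  [&& adj v u, (L u).+1 == L v, fr u & rk u == rk v] = (u == par v).
Proof.
move=> hv; have o0 := hf_off hv.
have := ok_linked tree o0; rewrite /linked -/(hf v) hv => /cards1P[x E].
have {}E u' : [&& adj v u', (L u').+1 == L v, fr u' & rk u' == rk v] = (u' == x).
  have := in_set1 u' x; rewrite -E inE => <-.
  by case vu: (adj v u') => //=; rewrite -(off_up vu o0).
suff -> : par v = x by [].
by rewrite /par; case: pickP => [y|/(_ x)]; rewrite E ?eqxx // => /eqP.
Qed.

(** Each step goes up one level, so the fuel [L v] reaches the top of the fast path. *)
Fixpoint climb n v := if n is n'.+1 then if hf v then climb n' (par v) else v else v.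
Let head v := climb (L v) v.
Let depth v := L v - L (head v).

Lemma par_level v : hf v -> (L (par v)).+1 = L v /\ rk (par v) = rk v.
Proof.
by move=> hv; have := par_unique (par v) hv; rewrite eqxx => /and4P[_ /eqP ? _ /eqP ?].
Qed.

Lemma climb_spec n v : [/\ L (climb n v) <= L v, rk (climb n v) = rk v &
  L (climb n v) %/ w = L v %/ w].
Proof.
elim: n v => [|n IH] v /=; first by split.
case: ifP => hv; last by split.
have [Lp rp] := par_level hv; have [h1 h2 h3] := IH (par v).
split; [lia | by rewrite h2 | rewrite h3].
have w0 : 0 < w by lia.
have := hf_off hv; rewrite /off -Lp => o0.
have E : (L (par v)).+1 = (L (par v)).+1 %/ w * w + (L (par v)).+1 %% w by exact: divn_eq.
have ow : (L (par v)).+1 %% w < w by rewrite ltn_mod.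
set q := (L (par v)).+1 %/ w in E *.
have e : L (par v) = q * w + ((L (par v)).+1 %% w).-1 by lia.
rewrite {1}e.
by rewrite divnMDl // divn_small ?addn0 //; lia.
Qed.

Lemma climb_top n v : L v <= n -> ~~ hf (climb n v).
Proof.
elim: n v => [|n IH] v Lv /=.
  by apply/negP => hv; have [E _] := par_level hv; rewrite -E in Lv.
case: ifPn => // hv; apply: IH; have [E _] := par_level hv.
by rewrite -E in Lv.
Qed.

Lemma head_parE v : hf v -> head v = head (par v).
Proof. by move=> hv; have [E _] := par_level hv; rewrite /head -E /= hv. Qed.

Lemma L_headE v : L (head v) + depth v = L v.
Proof. by have [h _ _] := climb_spec (L v) v; rewrite subnKC. Qed.

Lemma depth_parE v : hf v -> depth v = (depth (par v)).+1.
Proof.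
move=> hv; have [E _] := par_level hv.
have h1 := L_headE (par v); have h2 := L_headE v; rewrite (head_parE hv) in h2.
by move: (depth v) (depth (par v)) (L (head (par v))) h1 h2 E => a b d; lia.
Qed.

Lemma head_topE v : ~~ hf v -> head v = v /\ depth v = 0.
Proof.
move=> nv; have E : head v = v by rewrite /head; case: (L v) => //= n; rewrite (negbTE nv).
by rewrite /depth E subnn.
Qed.

Lemma slow_parent v : v != src -> ~~ hf v -> exists2 u, adj u v &
  (L u).+1 = L v /\ ((L v %/ w = L u %/ w /\ rk v < rk u) \/ L v %/ w = (L u %/ w).+1).
Proof.
move=> vs nv; have w0 : 0 < w by lia.
have [o0|o0] := posnP (off v).
  have [u vu E] := L_up vs; exists u; first by rewrite adjC.
  split=> //; right; rewrite -E divnS //.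
  by rewrite /dvdn E -/(off v) o0 eqxx.
have := ok_linked tree o0; rewrite /linked -/(hf v) (negbTE nv).
case/existsP => u /and3P[vu ou ru]; exists u; first by rewrite adjC.
rewrite (off_up vu o0) in ou; split; [exact/eqP | left; split=> //].
rewrite -(eqP ou) divnS // /dvdn (eqP ou) -/(off v).
by move: o0; case: (off v).
Qed.

Section Delay.
Variables (F : nat) (dlt : V -> nat).
Let delay v := fast_delay F lam L rk head depth v.
Hypothesis F0 : 0 < F.
Hypothesis dlt_src : dlt src = 0.
Hypothesis dlt_adj : forall u v, adj u v -> dlt v <= (dlt u).+1.
Hypothesis dlt_hf : forall v, hf v -> dlt v <= dlt (head v) + delay v.

(** A slow edge costs one stage, plus at most three for the fast path above it: two from
    [fast_delay], one from the offset of the slot. The length of that path is charged to [L v]. The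
    bracket grows along every slow edge: either the rank drops inside a ring, or a new ring adds
    [lam.+1], more than the rank term can lose. *)
Let budget v :=
  L v + 4 * stage F lam * (L v %/ w * lam.+1 + (lam - rk v)).

Lemma delay_bound v :
  dlt v * stage F lam <= budget v + (if hf v then 3 * stage F lam else 0).
Proof.
set T := stage F lam; have [n] := ubnP (L v); elim: n v => // n IH v Ln.
have rk_le u : rk u <= lam by exact: (ok_rank tree).
have T0 : 0 < T by rewrite /T /stage muln_gt0 F0.
case: ifPn => hv.
  have [h1 h2 h3] := climb_spec (L v) v; rewrite -/(head v) in h1 h2 h3.
  have hh : ~~ hf (head v) by apply: climb_top.
  have dh : 0 < depth v by rewrite (depth_parE hv).
  have Lh := L_headE v.
  have IHh : dlt (head v) * T <= budget (head v).
    have := IH (head v); rewrite (negbTE hh) addn0; apply.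
    by move: (depth v) dh Lh => k; lia.
  have bE : budget v = budget (head v) + depth v.
    by rewrite /budget h2 h3 -Lh; lia.
  have := dlt_hf hv; rewrite /delay /fast_delay -/T.
  set o := _.-1 => hd.
  have oP : o < period lam + depth v.
    have : slot L rk (head v) %% period lam < period lam by rewrite ltn_mod.
    by rewrite /o; lia.
  have pT : period lam <= T by rewrite /T /stage leq_pmull.
  have h4 : o %/ T * T <= o := leq_divM o T.
  have h5 : dlt v * T <= (dlt (head v) + (o %/ T + 2)) * T by rewrite leq_mul2r hd orbT.
  rewrite !mulnDl in h5; rewrite bE; lia.
rewrite addn0; have [->|vs] := eqVneq v src; first by rewrite dlt_src.
have [u uv [Lu H]] := slow_parent vs hv.
have IHu : dlt u * T <= budget u + 3 * T.
  have Lun : L u < n by lia.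
  by apply: leq_trans (IH u Lun) _; rewrite leq_add2l; case: ifP.
have h5 : dlt v * T <= (dlt u).+1 * T by rewrite leq_mul2r dlt_adj ?orbT.
rewrite mulSn in h5.
have ru := rk_le u; have rv := rk_le v.
have h6 : (L u %/ w * lam.+1 + (lam - rk u)).+1 <= L v %/ w * lam.+1 + (lam - rk v).
  by case: H => [[-> lt]|->]; rewrite ?mulSn; lia.
have h7 : 4 * T * (L u %/ w * lam.+1 + (lam - rk u)).+1 <=
    4 * T * (L v %/ w * lam.+1 + (lam - rk v)) by rewrite leq_mul2l h6 orbT.
rewrite mulnS in h7; rewrite /budget -/T in IHu *; lia.
Qed.

End Delay.

Lemma delays F : 0 < F -> exists par' head' depth' dlt,
  schedule adj src L w lam c F par' head' depth' dlt.
Proof.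
move=> F0.
have [dlt [d0 dadj djump dcause]] := @weighted_distance V adj src hf head
  (fast_delay F lam L rk head depth) (conn src).
exists par, head, depth, dlt; split=> //.
- exact: par_unique.
- exact: head_parE.
- exact: depth_parE.
- exact: head_topE.
- exact: L_headE.
- by move=> v; have [] := climb_spec (L v) v.
- move=> v; apply: leq_trans (delay_bound F0 d0 dadj djump v) _.
  apply: leq_add; last by case: ifP.
  by rewrite leq_add2l leq_mul2l leq_add2l leq_subr orbT.
Qed.

End Structure.

(** * Erasure codes for batches of packets *)

Section Code.
Variables (B b F : nat).
Local Notation pk := (B.-tuple bool).
Local Notation batch := (b.-tuple pk).

Definition pk0 : pk := [tuple of nseq B false].
Definition batch0 : batch := [tuple of nseq b pk0].
Definition pkt (x : batch) (i : nat) : pk := nth pk0 x i.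
Definition mk (l : seq pk) : batch := [tuple nth pk0 l i | i < b].

Lemma mkP x : mk (mkseq (pkt x) b) = x.
Proof.
apply: eq_from_tnth => i; rewrite tnth_mktuple nth_mkseq // /pkt.
by rewrite (tnth_nth pk0).
Qed.

Definition is_code (enc : batch -> nat -> pk) : Prop := forall x y (l : seq nat),
  uniq l -> b <= size l ->
  (forall f, f \in l -> f < F /\ enc x f = enc y f) -> x = y.

(** Packets are the elements of the field of order 2^B and a batch is the coefficient list of a
    polynomial of degree below [b]. Symbols are values at distinct points, so [b] of them determine
    it. *)
Lemma reed_solomon : 0 < B -> F <= 2 ^ B -> exists enc, is_code enc.
Proof.
move=> B0 FB; have [K _ cK] := pPrimePowerField (isT : prime 2) B0.
have e : #|{: pk}| = #|K| by rewrite cK card_tuple card_bool.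
pose phi (p : pk) : K := enum_val (cast_ord e (enum_rank p)).
pose psi (a : K) : pk := enum_val (cast_ord (esym e) (enum_rank a)).
have psiK : cancel psi phi.
  by move=> a; rewrite /phi /psi enum_valK cast_ordKV enum_rankK.
have phiK : cancel phi psi.
  by move=> a; rewrite /phi /psi enum_valK cast_ordK enum_rankK.
pose P (x : batch) : {poly K} := (\poly_(i < b) phi (pkt x i))%R.
pose pnt f : K := nth 0%R (enum K) f.
exists (fun x f => psi (P x).[pnt f]%R) => x y l ul bl H.
have [E|NE] := eqVneq (P x - P y)%R 0%R.
  apply: eq_from_tnth => i; rewrite !(tnth_nth pk0).
  have := congr1 (fun p : {poly K} => p`_i)%R E.
  rewrite coefB coef0 !coef_poly ltn_ord => /eqP; rewrite subr_eq0 => /eqP.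
  by move/(congr1 psi); rewrite !phiK.
have := @max_poly_roots _ (P x - P y)%R (map pnt l) NE.
have -> : all (root (P x - P y)%R) (map pnt l).
  apply/allP => _ /mapP[f fl ->]; have [_ Ef] := H f fl.
  rewrite /root hornerD hornerN subr_eq0; apply/eqP.
  by rewrite -[LHS]psiK Ef psiK.
have -> : uniq (map pnt l).
  rewrite map_inj_in_uniq // => f f' /H[lt _] /H[lt' _] /eqP.
  rewrite nth_uniq ?enum_uniq -?cardE ?cK ?(leq_trans lt FB) ?(leq_trans lt' FB) //.
  by move/eqP.
rewrite size_map => /(_ isT isT) lt; exfalso; move: lt; rewrite ltnNge.
case/negP; apply: leq_trans bl; apply: leq_trans (size_polyD _ _) _.
by rewrite size_polyN geq_max !size_poly.
Qed.

Lemma repetition : b = 1 -> is_code (fun x _ => pkt x 0).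
Proof.
move=> b1 x y [|f l] _ bl H; first by exfalso; move: bl => /=; lia.
have [_ E] := H f (mem_head _ _).
apply: eq_from_tnth => i; rewrite !(tnth_nth pk0).
by have -> : (i : nat) = 0 by have := ltn_ord i; lia.
Qed.

(** The choice depends only on [B], [b] and [F], so all nodes use the same code. *)
Definition enc : batch -> nat -> pk := epsilon (inhabits (fun x _ => pkt x 0)) is_code.

Definition dec (l : seq (nat * pk)) : batch :=
  odflt batch0 [pick x : batch | all (fun fp => fp.2 == enc x fp.1) l].

Lemma decP : (b = 1 \/ 0 < B /\ F <= 2 ^ B) -> forall x l,
  (forall f p, (f, p) \in l -> f < F /\ p = enc x f) ->
  b <= size (undup (map fst l)) -> dec l = x.
Proof.
move=> HB; have codeP : is_code enc.
  apply: epsilon_spec; case: HB => [b1|[B0 FB]]; last exact: reed_solomon.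
  by exists (fun x _ => pkt x 0); apply: repetition.
move=> x l Hl bl; rewrite /dec; case: pickP => [y /allP Hy|/(_ x)]; last first.
  case/allP => -[f p] /Hl[_ ->] /=; exact: eqxx.
apply: (codeP _ _ _ (undup_uniq _) bl) => f; rewrite mem_undup => /mapP[[f' p] fp ->] /=.
have [lt E] := Hl _ _ fp; split=> //.
by have /eqP /= <- := Hy _ fp.
Qed.

End Code.

(** * Messages as a self-delimiting bit stream *)

Section Serialization.

(** Each bit is preceded by [true]; the pair [false], [true] ends a message and [false], [false] the
    list. Nodes that do not know the number of messages can thus tell when they have them all. *)
Definition ser1 (m : bitseq) : seq bool :=
  flatten [seq [:: true; x] | x <- m] ++ [:: false; true].

Definition ser (ms : seq bitseq) : seq bool :=
  flatten [seq ser1 m | m <- ms] ++ [:: false; false].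

Fixpoint parse (cur : bitseq) (acc : seq bitseq) (l : seq bool) : option (seq bitseq) :=
  match l with
  | true :: x :: l' => parse (rcons cur x) acc l'
  | false :: true :: l' => parse [::] (rcons acc cur) l'
  | false :: false :: _ => Some acc
  | _ => None
  end.

(** This makes outputs final: further batches only extend the bit string. *)
Lemma parse_mono cur acc l l' ms :
  parse cur acc l = Some ms -> parse cur acc (l ++ l') = Some ms.
Proof.
have [n] := ubnP (size l); elim: n l cur acc => // n IH.
case=> [|x [|y l]] //= cur acc; first by case: x.
by move=> sl; case: x; [| case: y => //]; apply: IH; lia.
Qed.

Lemma parse_ser1 m cur acc l :
  parse cur acc (ser1 m ++ l) = parse [::] (rcons acc (cur ++ m)) l.
Proof.
elim: m cur => [|x m IH] cur /=; first by rewrite cats0.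
by rewrite IH cat_rcons.
Qed.

Lemma parse_ser ms l : parse [::] [::] (ser ms ++ l) = Some ms.
Proof.
suff H acc : parse [::] acc (ser ms ++ l) = Some (acc ++ ms) by exact: H.
elim: ms acc => [|m ms IH] acc; first by rewrite /= cats0.
have -> : ser (m :: ms) ++ l = ser1 m ++ (ser ms ++ l) by rewrite /ser /= !catA.
by rewrite parse_ser1 cat0s IH cat_rcons.
Qed.

Lemma size_ser ms c : (forall m, m \in ms -> size m <= c) ->
  size (ser ms) <= size ms * (2 * c + 2) + 2.
Proof.
move=> H; rewrite /ser size_cat /= leq_add2r.
elim: ms H => //= m ms IH H; rewrite size_cat mulSn leq_add //; last first.
  by apply: IH => x xm; apply: H; rewrite inE xm orbT.
have := H m (mem_head _ _); rewrite /ser1 size_cat /= leq_add2r => h.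
apply: leq_trans (_ : 2 * size m <= _); last by rewrite leq_mul2l h.
by elim: m {H h} => //= x m IHm; rewrite mulnS; lia.
Qed.

Variables (B b : nat).

(** The default [false] pads the stream, so there is a batch for every stage. *)
Definition source_batch (ms : seq bitseq) (j : nat) : b.-tuple (B.-tuple bool) :=
  [tuple [tuple nth false (ser ms) ((j * b + i) * B + q) | q < B] | i < b].

Definition batch_bits (bs : seq (b.-tuple (B.-tuple bool))) : seq bool :=
  flatten [seq flatten [seq val p | p <- val x] | x <- bs].

Lemma val_mktuple_mkseq (T : Type) n (f : nat -> T) :
  val [tuple f i | i < n] = mkseq f n.
Proof. by rewrite /= /mkseq -val_enum_ord -map_comp. Qed.

Lemma flatten_mkseq (T : Type) (f : nat -> T) n k :
  flatten (mkseq (fun i => mkseq (fun q => f (i * k + q)) k) n) = mkseq f (n * k).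
Proof.
elim: n => // n IH; rewrite mkseqS -cats1 flatten_cat IH /= cats0.
rewrite mulSn addnC /mkseq iotaD map_cat; congr (_ ++ _).
by rewrite add0n -{2}[n * k]addn0 iotaDl -map_comp.
Qed.

Lemma source_bits ms n :
  batch_bits (mkseq (source_batch ms) n) = mkseq (nth false (ser ms)) (n * b * B).
Proof.
rewrite -mulnA -flatten_mkseq /batch_bits /mkseq -!map_comp; congr flatten.
apply: eq_map => j; rewrite /comp.
transitivity (mkseq (fun q => nth false (ser ms) (j * (b * B) + q)) (b * B)); last by [].
rewrite -flatten_mkseq.
have -> : val (source_batch ms j) = mkseq (fun i =>
    [tuple nth false (ser ms) ((j * b + i) * B + q) | q < B]) b.
  exact: (val_mktuple_mkseq b (fun i =>
    [tuple nth false (ser ms) ((j * b + i) * B + q) | q < B])).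
rewrite /mkseq -map_comp; congr flatten; apply: eq_map => i.
rewrite /comp (val_mktuple_mkseq B (fun q => nth false (ser ms) ((j * b + i) * B + q))).
by apply: eq_map => q; congr nth; rewrite mulnDl mulnA addnA.
Qed.

Lemma parse_source ms n : size (ser ms) <= n * b * B ->
  parse [::] [::] (batch_bits (mkseq (source_batch ms) n)) = Some ms.
Proof.
move=> H; rewrite source_bits -(subnKC H) /mkseq iotaD map_cat.
have -> : [seq nth false (ser ms) i | i <- iota 0 (size (ser ms))] = ser ms.
  exact: mkseq_nth.
exact: parse_ser.
Qed.

Lemma batch_bits_rcons bs x :
  batch_bits (rcons bs x) = batch_bits bs ++ flatten [seq val p | p <- val x].
Proof. by rewrite /batch_bits map_rcons -cats1 flatten_cat /= cats0. Qed.

End Serialization.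

(** * Graph distance *)

Section Distance.
Variables (V : finType) (adj : rel V).
Hypothesis adjC : symmetric adj.
Hypothesis conn : forall x y, connect adj x y.

Lemma walkP d x y :
  reflect (exists p, [/\ size p = d, path adj x p & last x p = y]) (walk adj d x y).
Proof.
apply: (iffP existsP) => [[p /andP[h /eqP e]]|[p [/eqP sz h e]]].
  by exists p; rewrite size_tuple.
by exists (Tuple sz); rewrite /= h e eqxx.
Qed.

Lemma walk_dist x y : walk adj (dist adj x y) x y /\ dist adj x y < #|V|.
Proof.
have /connectP[p pth ->] := conn x y.
case/shortenP: pth => q qp uq _.
have sq : size q < #|V| by rewrite -[_.+1]/(size (x :: q)) -(card_uniqP uq) max_card.
have h : has (fun d => walk adj d x (last x q)) (iota 0 #|V|).
  apply/hasP; exists (size q); first by rewrite mem_iota.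
  by apply/walkP; exists q.
have := h; rewrite has_find size_iota => lt.
by split=> //; have := nth_find 0 h; rewrite nth_iota.
Qed.

Lemma dist_min d x y : walk adj d x y -> dist adj x y <= d.
Proof.
move=> wd; rewrite leqNgt; apply/negP => lt.
have [_ ltV] := walk_dist x y.
have := before_find 0 lt; rewrite nth_iota ?add0n ?wd //.
exact: ltn_trans lt ltV.
Qed.

Lemma dist_self x : dist adj x x = 0.
Proof. by apply/eqP; rewrite -leqn0; apply: dist_min; apply/walkP; exists [::]. Qed.

Lemma dist_step s u v : adj u v -> dist adj s v <= (dist adj s u).+1.
Proof.
move=> uv; apply: dist_min; have [/walkP[p [sz pp lp]] _] := walk_dist s u.
apply/walkP; exists (rcons p v).
by rewrite size_rcons sz rcons_path pp lp uv last_rcons.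
Qed.

Lemma dist_pred s v : v != s -> exists2 u, adj v u & (dist adj s u).+1 = dist adj s v.
Proof.
move=> vs; have [/walkP[p [sz pp lp]] _] := walk_dist s v.
case/lastP: p sz pp lp => [_ _ /= E|p x]; first by rewrite E eqxx in vs.
rewrite size_rcons rcons_path last_rcons => sz /andP[pp lx] E; rewrite E in lx.
exists (last s p); first by rewrite adjC.
apply/eqP; rewrite eqn_leq dist_step // andbT -sz ltnS.
by apply: dist_min; apply/walkP; exists p.
Qed.

Lemma dist_diameter x y : dist adj x y <= diameter adj.
Proof.
by rewrite /diameter (bigD1 x) //= leq_max (bigD1 y) //= leq_max leqnn.
Qed.

End Distance.

(** * Transfer of triples from the abstract processes to full node states *)

Section Simulation.
Local Open Scope ring_scope.
Variables (W : finType) (S S' I I' : Type).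
Variables (step : I' -> S -> W -> S) (step' : I -> S' -> W -> S').
Variables (h : I -> I') (f : S -> S') (Inv : S -> Prop).
Hypothesis sim : forall i c w, Inv c ->
  f (step (h i) c w) = step' i (f c) w /\ Inv (step (h i) c w).

Lemma sim_sure p c : Inv c -> sure step (map h p) Inv c.
Proof. by elim: p c => //= i p IH c Ic w; apply: IH; have [] := sim i w Ic. Qed.

Lemma sim_EX p phi c : Inv c ->
  EX step (map h p) (fun d => phi (f d)) c = EX step' p phi (f c).
Proof.
elim: p c => //= i p IH c Ic; rewrite /avg; congr (_ / _); apply: eq_bigr => w _.
by have [<- Ic'] := sim i w Ic; apply: IH.
Qed.

Lemma sim_hoare (P Q : S' -> Prop) p e : hoare step' P p Q e ->
  hoare step (fun c => Inv c /\ P (f c)) (map h p) (fun c => Inv c /\ Q (f c)) e.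
Proof.
move=> H c [Ic Pc]; apply: le_trans (H (f c) Pc); rewrite -(sim_EX _ _ Ic).
apply: EX_sure_le; apply: sure_mono (sim_sure p Ic) => d Id.
by apply: ind_mono => nQ Qd; apply: nQ.
Qed.

End Simulation.

Section Success.
Local Open Scope ring_scope.

Lemma uniform_prob_avg (Omega : finType) (E : pred Omega) :
  uniform_prob E = avg (fun w => (E w)%:R).
Proof.
rewrite /uniform_prob /avg; congr (_ / _).
by rewrite -natr_sum -sum1_card big_mkcond.
Qed.

End Success.

(** * The protocol and its execution *)

Section Protocol.
Variables (B Dhat lam w P F b : nat).
Local Notation pk := (B.-tuple bool).
Local Notation batch := (b.-tuple pk).

(* [Wave t] propagates the beep that assigns level [t.+1], [Tree] builds the
   trees, [Draw] appends to the fixed transmission pattern that is reused for all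
   batches, and data rounds alternate between [Fast] and [Slow]. *)
Inductive instr :=
  | Wave of nat
  | Tree of ginstr
  | Draw
  | Fast of nat
  | Slow of nat.

Record node := Node { lvl : option nat; gs : gst; pat : seq nat; ds : dst B batch }.

Definition level (l : node) : nat := odflt 0 (lvl l).

Definition act (i : instr) (l : node) : option pk :=
  match i with
  | Wave t => if lvl l == Some t then Some (pk0 B) else None
  | Tree g => if gtx g (level l %% w) (gs l) then Some (pk0 B) else None
  | Draw => None
  | Fast s => fast_tx b F lam (batch0 B b) (@pkt B b) s
                (level l + 3 * rk (gs l)) (hf (gs l)) (fr (gs l)) (ds l)
  | Slow s => slow_tx F lam (batch0 B b) (@enc B b F) s (pat l) (ds l)
  end.

Definition upd (i : instr) (l : node) (d : nat) (fb : feedback B) : node :=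
  match i with
  | Wave t =>
      Node (if (lvl l == None) && (0 < beep_count fb) then Some t.+1 else lvl l)
           (gs l) (pat l) (ds l)
  | Tree g => Node (lvl l) (gupd g (level l %% w) (gs l) d (beep_count fb)) (pat l) (ds l)
  | Draw => Node (lvl l) (gs l) (rcons (pat l) d) (ds l)
  | Fast s => Node (lvl l) (gs l) (pat l)
                (fast_upd lam s (level l + 3 * rk (gs l)) (hf (gs l)) (ds l) fb)
  | Slow s => Node (lvl l) (gs l) (pat l)
                (slow_upd b F lam (batch0 B b) (@dec B b F) (@mk B b) s (ds l) fb)
  end.

Definition setup : seq instr :=
  map Wave (iota 0 Dhat) ++ (map Tree (treep lam P w) ++ nseq F Draw).

Definition data_instr (r : nat) : instr := if odd r then Slow r./2 else Fast r./2.

(** Only the setup has a fixed length; data rounds go on forever, as only the source knows the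
    number of messages. *)
Definition instr_at (t : nat) : instr :=
  if t < size setup then nth Draw setup t else data_instr (t - size setup).

Definition data0 (o : option (seq bitseq)) : dst B batch :=
  if o is Some ms then
    Dst (Some 0) (MSrc (source_batch B b ms)) [:: source_batch B b ms 0] [::] [::] None
  else Dst None (MSlow _) [::] [::] [::] None.

Definition node0 (o : option (seq bitseq)) : node :=
  Node (if o is Some _ then Some 0 else None) gst0 [::] (data0 o).

Definition decode (l : node) : option (seq bitseq) :=
  if dl (ds l) is Some _ then parse [::] [::] (batch_bits (bs (ds l))) else None.

Lemma decode_final i l d fb ms : decode l = Some ms -> decode (upd i l d fb) = Some ms.
Proof.
case: i => [t|g||s|s] //=; rewrite /decode /=.
  by rewrite /fast_upd; case: (hf _) => //; case: fb => //= p; case: ifP.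
rewrite /slow_upd; set l' := (X in Dst _ _ _ X); case: ifP => // _.
rewrite /end_stage /=; case: (dl (ds l)) => // e /= H.
by rewrite batch_bits_rcons; apply: parse_mono.
Qed.

Definition broadcast : protocol B := {|
  state := nat * node;
  ncoins := lam;
  init o := (0, node0 o);
  action st _ := act (instr_at st.1) st.2;
  update st wv fb := (st.1.+1, upd (instr_at st.1) st.2 (lead wv) fb);
  output st := decode st.2;
  output_final st wv fb ms := @decode_final (instr_at st.1) st.2 (lead wv) fb ms |}.

Section Execution.
Variables (V : finType) (adj : rel V) (src : V).

Definition conf := V -> node.

Definition step (i : instr) (c : conf) (wv : draws V lam) : conf := fun v =>
  upd i (c v) (lead (wv v)) (perceive adj (fun u => act i (c u)) v).

Lemma run_EX (phi : (V -> state broadcast) -> rat) T t c :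
  avg (fun ws : T.-tuple (coins V broadcast) =>
     phi (foldl (@round V adj B broadcast) (fun v => (t, c v)) ws)) =
  EX step [seq instr_at j | j <- iota t T] (fun d => phi (fun v => (t + T, d v))) c.
Proof.
elim: T t c => [|T IH] t c; first by rewrite avg_tuple0 /= addn0.
rewrite avg_tupleS [iota _ _]/= map_cons EX_cons /avg; congr (_ / _)%R.
apply: eq_bigr => wv _; rewrite addnS -addSn -IH.
by [].
Qed.

Lemma decode_stable i c wv v ms :
  decode (c v) = Some ms -> decode (step i c wv v) = Some ms.
Proof. exact: decode_final. Qed.

Lemma decode_sure p c ms : (forall v, decode (c v) = Some ms) ->
  sure step p (fun d => forall v, decode (d v) = Some ms) c.
Proof.
elim: p c => //= i p IH c H wv; apply: IH => v.
by apply: decode_stable; apply: H.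
Qed.

Hypothesis adjC : symmetric adj.
Hypothesis conn : forall x y, connect adj x y.
Hypothesis diam : diameter adj <= Dhat.
Hypothesis cardV : #|V| <= 2 ^ lam.
Hypothesis w3 : 2 < w.

Let L := dist adj src.
Let off v := L v %% w.

Record wave_inv (ms : seq bitseq) (t : nat) (c : conf) : Prop := {
  wi_lvl : forall v, lvl (c v) = if L v <= t then Some (L v) else None;
  wi_gs : forall v, gs (c v) = gst0;
  wi_pat : forall v, pat (c v) = [::];
  wi_ds : forall v, ds (c v) = data0 (if v == src then Some ms else None) }.

Lemma L_eq0 v : (L v == 0) = (v == src).
Proof.
apply/idP/eqP => [|->]; last by rewrite /L dist_self.
by rewrite /L; apply: contraTeq => vs; have [u _ <-] := dist_pred adjC conn vs.
Qed.

(** A collision counts as a beep, so simultaneous beeps of one level do not hinder each other. *)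
Lemma wave_step ms t c wv : wave_inv ms t c -> wave_inv ms t.+1 (step (Wave t) c wv).
Proof.
move=> [H1 H2 H3 H4]; split=> v; [|exact: H2|exact: H3|exact: H4].
rewrite /step [lvl _]/= perceive_count H1; have [Lv|Lv] := leqP (L v) t.
  by rewrite (leqW Lv).
have txE u : isSome (if lvl (c u) == Some t then Some (pk0 B) else None) = (L u == t).
  rewrite H1; case: ltngtP => // [lt|-> //]; last by rewrite eqxx.
  by case: eqP => // -[E]; rewrite E ltnn in lt.
rewrite eqxx /= heard_listen; last by rewrite /= txE; lia.
rewrite (_ : [set u | _] = [set u | adj v u & L u == t]); last first.
  by apply/setP => u; rewrite !inE /= txE.
have -> : (0 < minn 2 #|[set u | adj v u & L u == t]|) = (L v <= t.+1).
  rewrite leq_min /=; apply/card_gt0P/idP => [[u]|Lv1].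
    rewrite inE => /andP[vu /eqP <-]; apply: dist_step => //.
    by rewrite adjC.
  have vs : v != src by rewrite -L_eq0; lia.
  have [u vu E] := dist_pred adjC conn vs; exists u; rewrite inE vu /=.
  by move: Lv Lv1; rewrite /L -E; lia.
by case: ifP => // Lv1; congr Some; lia.
Qed.

Lemma wave_phase ms n t c : wave_inv ms t c ->
  sure step (map Wave (iota t n)) (wave_inv ms (t + n)) c.
Proof.
elim: n t c => [|n IH] t c H; first by rewrite addn0.
move=> wv; rewrite addnS -addSn; apply: IH; exact: wave_step.
Qed.

Definition awaiting (ms : seq bitseq) (c : conf) : Prop := forall v,
  lvl (c v) = Some (L v) /\ ds (c v) = data0 (if v == src then Some ms else None).

Definition no_pattern (c : conf) : Prop := forall v, pat (c v) = [::].

Lemma tree_sim ms i c wv : awaiting ms c /\ no_pattern c ->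
  (fun v => gs (step (Tree i) c wv v)) = gstep adj off i (fun v => gs (c v)) wv /\
  (awaiting ms (step (Tree i) c wv) /\ no_pattern (step (Tree i) c wv)).
Proof.
move=> [H Hp]; split=> [|]; last by split=> v; [exact: H | exact: Hp].
have lE v : level (c v) = L v by have [E _] := H v; rewrite /level E.
apply: functional_extensionality => v; rewrite /step /gstep /= lE perceive_count.
congr gupd; rewrite /heard; have tE u :
    isSome (if gtx i (level (c u) %% w) (gs (c u)) then Some (pk0 B) else None) =
    gtx i (off u) (gs (c u)) by rewrite lE; case: ifP.
rewrite tE; case: ifP => // _; congr minn; apply: eq_card => u.
by rewrite !inE tE.
Qed.

Lemma L_adj u v : adj u v -> L v <= (L u).+1.
Proof. exact: dist_step. Qed.

Lemma L_up v : v != src -> exists2 u, adj v u & (L u).+1 = L v.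
Proof. exact: dist_pred. Qed.

Lemma L_src : L src = 0.
Proof. exact: dist_self. Qed.

Lemma off_pred x i : off x = i.+1 -> exists2 u, adj x u & off u = i.
Proof.
move=> ox; have xs : x != src.
  by apply: contraTneq isT => E; move: ox; rewrite E /off /L dist_self // mod0n.
have [u xu /eqP E] := L_up xs; exists u => //.
have o0 : 0 < L x %% w by rewrite -/(off x) ox.
by move: E; rewrite -(off_up adjC L_src L_adj w3 xu o0) -/(off x) ox => /eqP[].
Qed.

Definition tree_error : rat := (tree_err lam P *+ 2 *+ lam.+1 *+ w.-1)%R.
Definition pattern_error : rat := ((63 / 64) ^+ F * (2 ^+ b * 2 ^+ lam))%R.

Lemma tree_conf ms : hoare step (wave_inv ms Dhat) (map Tree (treep lam P w))
  (fun c => (awaiting ms c /\ no_pattern c) /\ tree_ok adj lam off 0 (fun v => gs (c v)))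
  tree_error.
Proof.
have H := sim_hoare (@tree_sim ms) (tree_phase adjC cardV off_pred P (w := w)).
apply: (hoare_weak _ _ (lexx _) H) => // c [H1 H2 H3 H4].
split; [split=> v; [split; last exact: H4 | exact: H3]|].
  by rewrite H1 ifT //; apply: leq_trans diam; apply: dist_diameter.
have -> : (fun v => gs (c v)) = (fun=> gst0).
  by apply: functional_extensionality => v; rewrite H2.
have w0 : 0 < w by exact: leq_trans w3.
by apply: tree_ok_init => // v; rewrite /off ltn_mod.
Qed.

Definition ready (ms : seq bitseq) (c : conf) : Prop :=
  [/\ awaiting ms c, forall v, size (pat (c v)) = F,
      tree_ok adj lam off 0 (fun v => gs (c v)) &
      exists par head depth dlt,
        schedule adj src L w lam (fun v => gs (c v)) F par head depth dlt /\
        forall v, feeders adj dlt v != set0 ->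
          b <= frames lam (feeders adj dlt) (fun u => pat (c u)) v].

Lemma draw_sim c0 (i : unit) c wv :
    (forall v, [/\ lvl (c v) = lvl (c0 v), gs (c v) = gs (c0 v) & ds (c v) = ds (c0 v)]) ->
  (fun v => pat (step Draw c wv v)) = pstep i (fun v => pat (c v)) wv /\
  (forall v, [/\ lvl (step Draw c wv v) = lvl (c0 v), gs (step Draw c wv v) = gs (c0 v) &
     ds (step Draw c wv v) = ds (c0 v)]).
Proof. by []. Qed.

Lemma draw_size n k c : (forall v, size (pat (c v)) = k) ->
  sure step (nseq n Draw) (fun d => forall v, size (pat (d v)) = k + n) c.
Proof.
elim: n k c => [|n IH] k c H /=; first by move=> v; rewrite addn0.
by move=> wv; rewrite addnS -addSn; apply: IH => v; rewrite /= size_rcons H.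
Qed.

Hypothesis F0 : 0 < F.

(** The delays, and with them the feeder sets, are fixed by the tree before any pattern is drawn, as
    [pattern_phase] requires. *)
Lemma draw_conf ms : hoare step
  (fun c => (awaiting ms c /\ no_pattern c) /\ tree_ok adj lam off 0 (fun v => gs (c v)))
  (nseq F Draw) (ready ms) pattern_error.
Proof.
move=> c [[Ha Hp] Ht].
have [par [head [depth [dlt Hs]]]] :=
  delays adjC conn L_src L_adj L_up w3 Ht F0.
pose Inv (d : conf) := forall v,
  [/\ lvl (d v) = lvl (c v), gs (d v) = gs (c v) & ds (d v) = ds (c v)].
have Hh := sim_hoare (@draw_sim c) (pattern_phase cardV (feeders adj dlt) F b).
have Ic : Inv c by [].
have E : map (fun _ : unit => Draw) (flatten (nseq F [:: tt])) = nseq F Draw.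
  by elim: (F) => //= k ->.
rewrite E in Hh; apply: le_trans (Hh c (conj Ic Hp)).
have Hz : forall v, size (pat (c v)) = 0 by move=> v; rewrite Hp.
apply: EX_sure_le; apply: sure_mono (draw_size F Hz) => d sz.
apply: ind_mono => nr [Id Hf]; apply: nr.
have gE : (fun v => gs (d v)) = (fun v => gs (c v)).
  by apply: functional_extensionality => v; have [_ ->] := Id v.
split=> //; rewrite ?gE //.
  by move=> v; have [-> _ ->] := Id v; apply: Ha.
by exists par, head, depth, dlt.
Qed.

Lemma setup_phase ms : hoare step (wave_inv ms 0) setup (ready ms)
  (tree_error + pattern_error)%R.
Proof.
have W0 := draws_gt0 V lam.
have te0 : (0 <= tree_error)%R by rewrite /tree_error !mulrn_wge0 ?tree_err_ge0.
have pe0 : (0 <= pattern_error)%R.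
  by rewrite /pattern_error; apply: mulr_ge0; [|apply: mulr_ge0]; apply: exprn_ge0; lra.
rewrite /setup -[(_ + _)%R]add0r.
have H1 : hoare step (wave_inv ms 0) (map Wave (iota 0 Dhat)) (wave_inv ms Dhat) 0.
  by apply: (hoare_sure W0) => c Hc; apply: (@wave_phase ms Dhat 0).
apply: (hoare_cat W0 _ H1); first by rewrite addr_ge0.
exact: (hoare_cat W0 pe0 (@tree_conf ms) (@draw_conf ms)).
Qed.

Hypothesis b_gt0 : 0 < b.
Hypothesis b_leF : b <= F.
Hypothesis code_ok : b = 1 \/ 0 < B /\ F <= 2 ^ B.

Section DataPhase.
Variables (ms : seq bitseq) (c0 : conf).
Variables (par head : V -> V) (depth dlt : V -> nat).
Hypothesis c0_lvl : forall v, lvl (c0 v) = Some (L v).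
Hypothesis c0_tree : tree_ok adj lam off 0 (fun v => gs (c0 v)).
Hypothesis c0_sched : schedule adj src L w lam (fun v => gs (c0 v)) F par head depth dlt.
Hypothesis c0_pat : forall v, feeders adj dlt v != set0 ->
  b <= frames lam (feeders adj dlt) (fun u => pat (c0 u)) v.
Hypothesis c0_size : forall v, size (pat (c0 v)) = F.

Let rk0 v := rk (gs (c0 v)).
Let hf0 v := hf (gs (c0 v)).
Let SB := source_batch B b ms.

Definition data_ok (s : nat) (c : conf) : Prop :=
  (forall v, [/\ lvl (c v) = lvl (c0 v), gs (c v) = gs (c0 v) & pat (c v) = pat (c0 v)]) /\
  [/\ core_inv F lam adj SB L rk0 hf0 head depth dlt s (fun v => ds (c v)),
      fast_inv b F lam (@pkt B b) SB L rk0 hf0 head depth dlt s (fun v => ds (c v)) &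
      slow_inv F lam (@enc B b F) adj SB (fun v => pat (c0 v)) dlt s (fun v => ds (c v))].

Lemma data_double s c w1 w2 : data_ok s c ->
  data_ok s.+1 (step (Slow s) (step (Fast s) c w1) w2).
Proof.
move=> [Hc [H1 H2 H3]]; split; first exact: Hc.
have rk_le v : rk0 v <= lam by exact: (ok_rank c0_tree).
have H := @data_step B b F lam _ (batch0 B b) (@enc B b F) (@pkt B b) (@dec B b F)
  (@mk B b) b_gt0 b_leF (decP code_ok) (@mkP B b) V adj src SB L rk0 hf0
  (fun v => fr (gs (c0 v))) (fun v => pat (c0 v)) par head depth dlt adjC L_adj rk_le
  (fun v u => sch_par c0_sched u) (sch_head c0_sched) (sch_depth c0_sched)
  (sch_top c0_sched) (sch_level c0_sched) (sch_rank c0_sched) (sch_src c0_sched)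
  (sch_adj c0_sched) (sch_hf c0_sched) (sch_cause c0_sched) c0_pat c0_size
  s _ H1 H2 H3.
have lE v : level (c v) = L v by have [E _ _] := Hc v; rewrite /level E c0_lvl.
set c1 := step (Fast s) c w1.
have E1 : (fun v => ds (c1 v)) =
    fast_round b F lam (batch0 B b) (@pkt B b) adj L rk0 hf0
      (fun v => fr (gs (c0 v))) s (fun v => ds (c v)).
  apply: functional_extensionality => v; rewrite /c1 /step /fast_round /=.
  have [_ gE _] := Hc v; rewrite lE gE; congr (fast_upd _ _ _ _ _ (perceive _ _ _)).
  apply: functional_extensionality => u; have [_ gEu _] := Hc u.
  by rewrite lE gEu.
have E2 : (fun v => ds (step (Slow s) c1 w2 v)) =
    slow_round b F lam (batch0 B b) (@enc B b F) (@dec B b F) (@mk B b) adj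
      (fun v => pat (c0 v)) s (fun v => ds (c1 v)).
  apply: functional_extensionality => v; rewrite /step /slow_round [LHS]/=.
  congr (slow_upd _ _ _ _ _ _ _ _ (perceive _ _ _)).
  by apply: functional_extensionality => u; have [_ _ pE] := Hc u; rewrite /= pE.
by rewrite E2 E1.
Qed.

Lemma data_rounds m s c : data_ok s c ->
  sure step [seq data_instr r | r <- iota s.*2 m.*2] (data_ok (s + m)) c.
Proof.
elim: m s c => [|m IH] s c H; first by rewrite addn0.
rewrite doubleS addnS -addSn => w1 w2; rewrite -doubleS; apply: IH.
rewrite /data_instr /= odd_double /= doubleK uphalf_double.
exact: data_double.
Qed.

Lemma data_start : (forall v, ds (c0 v) = data0 (if v == src then Some ms else None)) ->
  data_ok 0 c0.
Proof.
move=> H; split=> //; have d0 v : (dlt v <= 0) = (v == src).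
  apply/idP/eqP => [|->]; last by rewrite (sch_src c0_sched).
  apply: contraTeq => vs; have [[u _ ->] //|[_ ->]] := sch_cause c0_sched vs.
  by rewrite /fast_delay addnA -ltnNge addn2.
split; [split=> v|split=> v|split=> [v f p|v i u]]; rewrite ?div0n ?H ?d0.
- by case: eqP => [->|] //=; rewrite (sch_src c0_sched).
- by move/eqP => ->; rewrite eqxx (sch_src c0_sched).
- by move/eqP => ->; rewrite eqxx.
- move=> hv; rewrite /relayed (sch_depth c0_sched hv) /=.
  by case: (v == src).
- by rewrite /arrivals /=; case: (v == src); case: ifP.
- by case: (v == src).
- by rewrite ltn0 andbF.
Qed.

Lemma data_decode s c v : data_ok s c -> dlt v <= s %/ stage F lam ->
  size (ser ms) <= (s %/ stage F lam - dlt v).+1 * b * B ->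
  decode (c v) = Some ms.
Proof.
move=> [_ [H _ _]] dv sz; rewrite /decode (di_dl H) dv (di_bs H dv).
exact: parse_source.
Qed.

End DataPhase.

Lemma ready_delivery ms c K T : ready ms c -> size (ser ms) <= K * b * B ->
  2 * (Dhat + 4 * stage F lam * (Dhat %/ w * lam.+1 + lam) + 3 * stage F lam +
       K * stage F lam) <= T ->
  sure step [seq data_instr r | r <- iota 0 T]
    (fun d => forall v, decode (d v) = Some ms) c.
Proof.
move=> [Ha Hsz Ht [par [head [depth [dlt [Hs Hp]]]]]] HK HT.
set S := stage F lam in HT *; set X := Dhat + _ + _ in HT.
have S0 : 0 < S by rewrite /S /stage muln_gt0 F0.
(* The first [X %/ S] stages cover the largest delay, and [K] more let every node complete [K]
   batches. *)
pose m := (X %/ S + K) * S.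
have mT : m.*2 <= T.
  apply: leq_trans HT; rewrite -mul2n leq_mul2l /= /m mulnDl leq_add2r.
  exact: leq_divM.
rewrite -(subnKC mT) iotaD map_cat; apply/sure_cat.
have H0 := data_start Hs (fun v => proj2 (Ha v)).
have := data_rounds (fun v => proj1 (Ha v)) Ht Hs Hp Hsz m H0.
apply: sure_mono => d Hd; apply: decode_sure => v.
have dX : dlt v <= X %/ S.
  rewrite leq_divRL //; apply: leq_trans (sch_bound Hs v) _.
  have LD : L v <= Dhat by apply: leq_trans diam; apply: dist_diameter.
  rewrite /X -/S; apply: leq_add => //; apply: leq_add => //.
  rewrite leq_mul2l leq_add2r leq_mul2r; apply/orP; right; apply/orP; right.
  exact: leq_div2r.
have mS : (0 + m) %/ stage F lam = X %/ S + K by rewrite add0n /m mulnK.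
apply: (data_decode Hd); rewrite mS; first by apply: leq_trans dX (leq_addr _ _).
apply: leq_trans HK _; rewrite -!mulnA leq_mul2r; apply/orP; right; lia.
Qed.

Lemma instr_at_split T : [seq instr_at j | j <- iota 0 (size setup + T)] =
  setup ++ [seq data_instr r | r <- iota 0 T].
Proof.
rewrite iotaD map_cat; congr (_ ++ _).
  rewrite -[RHS](mkseq_nth Draw) /mkseq; apply/eq_in_map => j.
  by rewrite mem_iota /instr_at add0n /= => ->.
rewrite add0n -{1}[size setup]addn0 iotaDl -map_comp; apply: eq_map => r.
by rewrite /instr_at /= ltnNge leq_addr /= addKn.
Qed.

Theorem broadcast_success ms K T : size (ser ms) <= K * b * B ->
  size setup + 2 * (Dhat + 4 * stage F lam * (Dhat %/ w * lam.+1 + lam) +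
     3 * stage F lam + K * stage F lam) <= T ->
  (1 - (tree_error + pattern_error) <= success_prob adj src broadcast ms T)%R.
Proof.
move=> HK HT; have W0 := draws_gt0 V lam.
set T' := 2 * _ in HT.
have -> : T = size setup + (T - size setup) by lia.
set R := T - size setup; have RT : T' <= R by rewrite /R; lia.
pose phi (d : V -> state broadcast) : rat :=
  ([forall v, output (d v) == Some ms])%:R%R.
have -> : success_prob adj src broadcast ms (size setup + R) =
    EX step (setup ++ [seq data_instr r | r <- iota 0 R])
      (fun d => phi (fun v => (0 + (size setup + R), d v)))
      (fun v => node0 (if v == src then Some ms else None)).
  rewrite -instr_at_split -run_EX /success_prob uniform_prob_avg.
  by [].
rewrite EX_cat; set c0 := fun v => node0 _.
have Hw : wave_inv ms 0 c0.
  split=> v //; rewrite leqn0 L_eq0 /c0 /=; case: eqP => // ->.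
  by rewrite L_src.
have Hs := setup_phase Hw.
apply: (@le_trans _ _ (EX step setup (fun d => 1 + -1 * ind (~ ready ms d)) c0)%R).
  rewrite EXD EX_scale (EX_cst _ W0); lra.
apply: EX_le => d; have [r|nr] := excluded_middle_informative (ready ms d).
  rewrite ind_false; last by move=> /(_ r).
  rewrite mulr0 addr0 -[leLHS](EX_cst step W0 [seq data_instr r | r <- iota 0 R] 1%R d).
  apply: EX_sure_le; apply: sure_mono (ready_delivery r HK RT) => d' Hd'.
  rewrite /phi; suff -> : [forall v,
      output ((0 + (size setup + R), d' v) : state broadcast) == Some ms] by [].
  by apply/forallP => v; apply/eqP; apply: Hd'.
rewrite ind_true // mulr1 subrr.
rewrite -[leLHS](EX_cst step W0 [seq data_instr r | r <- iota 0 R] 0%R d).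
by apply: EX_le => d'; apply: ler0n.
Qed.

End Execution.

End Protocol.

(** * Choice of parameters, round count and error bound *)

Section Bounds.

Definition width (lam : nat) : nat := lam.+1 ^ 3 + 2.

(** As (63/64)^64 <= 1/2, this many repetitions leave a factor 2^-((c + 20) lam). The part 20 lam
    absorbs the initial potentials and the union bound, and the rest is at most n^-c. *)
Definition repeats (c lam : nat) : nat := 64 * (c + 20) * lam.

Definition batch_size (c lam B : nat) : nat :=
  if repeats c lam <= 2 ^ B then lam else 1.

Lemma width_gt2 lam : 2 < width lam.
Proof. by rewrite /width -addn1 addnC leq_add2r expn_gt0. Qed.

Lemma up_log_poly a e n N : 1 < n -> N <= a * n ^ e ->
  up_log 2 N <= (up_log 2 a + e) * up_log 2 n.
Proof.
move=> n1 HN; have l0 : 0 < up_log 2 n by rewrite up_log_gt0.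
apply: leq_trans (_ : up_log 2 a + e * up_log 2 n <= _); last first.
  by rewrite mulnDl leq_add2r leq_pmulr.
apply: up_log_min => //; apply: leq_trans HN _.
rewrite expnD; apply: leq_mul; first exact: up_logP.
rewrite mulnC expnM; have [->|e0] := posnP e; first by rewrite !expn0.
by rewrite leq_exp2r // up_logP.
Qed.

(** With h = B/2 rounded down, 2^B is at least (h + 1)^2, which is quadratic in [B]. *)
Lemma exp_lt_linear q B : 2 ^ B < q * B -> B < 4 * q.
Proof.
move=> H; set h := B./2; have hB : B = odd B + h.*2 by rewrite odd_double_half.
have e1 : h < 2 ^ h := ltn_expl h (isT : 1 < 2).
have e2 : 2 ^ h * 2 ^ h <= 2 ^ B by rewrite -expnD leq_exp2l //; lia.
have e3 : h.+1 * h.+1 <= 2 ^ h * 2 ^ h by apply: leq_mul.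
have e4 : q * B <= q * (2 * h.+1) by rewrite leq_mul2l; apply/orP; right; lia.
have e5 : h.+1 * h.+1 < (2 * q) * h.+1 by nia.
rewrite ltn_mul2r /= in e5; lia.
Qed.

(* The bound does not depend on the number of nodes: batches of size 1 are only
   used in networks of bounded size. *)
Lemma batch_size_small c lam B k m l : lam <= k * l -> l <= m * B ->
  ~~ (repeats c lam <= 2 ^ B) ->
  lam <= k * (m * (4 * (64 * (c + 20) * (k * m)))).
Proof.
move=> Hl HB; rewrite -ltnNge => H.
have : 2 ^ B < 64 * (c + 20) * (k * m) * B.
  apply: leq_trans H _; rewrite /repeats -[leqRHS]mulnA leq_mul2l; apply/orP; right.
  by apply: leq_trans Hl _; rewrite -mulnA leq_mul2l HB orbT.
move/exp_lt_linear => HB'; apply: leq_trans Hl _; rewrite leq_mul2l; apply/orP; right.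
by apply: leq_trans HB _; rewrite leq_mul2l ltnW ?orbT.
Qed.

Definition num_packets (k g : nat) : nat := k * (2 * g + 2) + 2.

Definition num_batches (c lam B k g : nat) : nat :=
  (num_packets k g %/ batch_size c lam B).+1.

Lemma batch_size_gt0 c lam B : 0 < lam -> 0 < batch_size c lam B.
Proof. by rewrite /batch_size; case: ifP. Qed.

Lemma ser_fits c lam B k g ms : 0 < lam -> 0 < B -> size ms = k ->
  (forall x, x \in ms -> size x <= g * B) ->
  size (ser ms) <= num_batches c lam B k g * batch_size c lam B * B.
Proof.
move=> l0 B0 sk Hg; apply: leq_trans (size_ser Hg) _; rewrite sk.
apply: leq_trans (_ : num_packets k g * B <= _).
  rewrite /num_packets mulnDl -mulnA mulnDl; apply: leq_add; last lia.
  by rewrite leq_mul2l; apply/orP; right; lia.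
rewrite leq_mul2r ltnW ?orbT //; apply: ltn_ceil; exact: batch_size_gt0.
Qed.

(** A stage has order lam^2 rounds and carries [lam] packets, hence order [lam] rounds per packet.
    With batches of one packet the additional factor [lam] is at most the constant [M]. *)
Lemma stage_batches c lam B k g M : 0 < lam ->
  (~~ (repeats c lam <= 2 ^ B) -> lam <= M) ->
  num_batches c lam B k g * stage (repeats c lam) lam <=
    stage (repeats c lam) lam +
    192 * (c + 20) * M.+1 * (lam.+1 * num_packets k g).
Proof.
move=> l0 HM; rewrite /num_batches mulSn leq_add2l.
set np := num_packets k g; rewrite /stage /period /repeats /batch_size.
case: ifPn => [_|/HM lM].
  have h : np %/ lam * lam <= np := leq_divM np lam.
  rewrite (_ : _ * _ = 192 * (c + 20) * (lam.+1 * (np %/ lam * lam))); last by ring.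
  rewrite -[leqRHS]mulnA leq_mul2l; apply/orP; right.
  by apply: leq_trans (_ : lam.+1 * np <= _); [rewrite leq_mul2l h orbT | rewrite leq_pmull].
rewrite divn1 (_ : np * _ = 192 * (c + 20) * (lam * (lam.+1 * np))); last by ring.
rewrite -[leqRHS]mulnA leq_mul2l; apply/orP; right.
by rewrite leq_mul2r (leqW lM) orbT.
Qed.

Lemma setup_size c lam Dhat (q := repeats c lam) :
  size (setup Dhat lam (width lam) q q) =
  Dhat + ((2 + q * (4 * lam.+1 + 3)) * lam.+1 * (width lam).-1 + q).
Proof. by rewrite !size_cat !size_map size_iota size_nseq size_treep. Qed.

Lemma total_rounds c lam Dhat R (q := repeats c lam) (S := stage q lam) : 0 < lam ->
  size (setup Dhat lam (width lam) q q) +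
  2 * (Dhat + 4 * S * (Dhat %/ width lam * lam.+1 + lam) + 3 * S + (S + R)) <=
  (3 + 1536 * (c + 20)) * Dhat + 5000 * (c + 20) * lam.+1 ^ 6 + 2 * R.
Proof.
move=> l0; rewrite setup_size; set x := lam.+1; set d := c + 20.
have qE : q = 64 * d * lam by [].
have SE : S = 192 * d * (lam * x) by rewrite /S /stage /period qE -/x; ring.
have lx : lam <= x by rewrite /x.
have x0 : 0 < x by [].
have d0 : 20 <= d by rewrite /d; lia.
have pw i j : i <= j -> x ^ i <= x ^ j by move=> ij; rewrite leq_pexp2l.
have Sx : S <= 192 * d * x ^ 2.
  by rewrite SE leq_mul2l (expnS x 1) expn1 leq_mul2r lx !orbT.
have wx : (width lam).-1 <= 2 * x ^ 3.
  rewrite /width -/x addn2 /=; have : 0 < x ^ 3 by rewrite expn_gt0.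
  by lia.
(* The estimate that dictates the width: a ring costs [S * x], of order [x ^ 3]. *)
have A1 : 4 * S * (Dhat %/ width lam * x) <= 768 * d * Dhat.
  have h : Dhat %/ width lam * width lam <= Dhat := leq_divM _ _.
  have h' : x ^ 3 <= width lam by rewrite /width leq_addr.
  apply: leq_trans (_ : 768 * d * (Dhat %/ width lam * x ^ 3) <= _).
    rewrite (_ : 4 * S * _ = 4 * (Dhat %/ width lam * x) * S); last by ring.
    apply: leq_trans (_ : 4 * (Dhat %/ width lam * x) * (192 * d * x ^ 2) <= _).
      by rewrite leq_mul2l Sx orbT.
    by apply: eq_leq; ring.
  rewrite leq_mul2l; apply/orP; right; apply: leq_trans h.
  by rewrite leq_mul2l h' orbT.
have A2 : 4 * S * lam <= 768 * d * x ^ 6.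
  apply: leq_trans (_ : 4 * (192 * d * x ^ 2) * x <= _).
    by apply: leq_mul => //; rewrite leq_mul2l Sx.
  rewrite (_ : 4 * _ * x = 768 * d * x ^ 3); last by ring.
  by rewrite leq_mul2l pw // orbT.
have A3 : 4 * S <= 768 * d * x ^ 6.
  apply: leq_trans (_ : 4 * (192 * d * x ^ 2) <= _); first by rewrite leq_mul2l Sx.
  by rewrite mulnA (mulnA 4) leq_mul2l pw // orbT.
(* The tree construction, whose length is truly of order [x ^ 6]. *)
have A4 : (2 + q * (4 * x + 3)) * x * (width lam).-1 <= 900 * d * x ^ 6.
  apply: leq_trans (_ : (450 * d * x ^ 2) * x * (2 * x ^ 3) <= _); last first.
    by apply: eq_leq; ring.
  apply: leq_mul wx; rewrite leq_mul2r; apply/orP; right.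
  rewrite qE; apply: leq_trans (_ : 2 * x ^ 2 + 448 * d * x ^ 2 <= _).
    apply: leq_add; first by rewrite leq_pmulr // expn_gt0.
    apply: leq_trans (_ : 64 * d * x * (7 * x) <= _).
      by apply: leq_mul; [rewrite leq_mul2l lx orbT | lia].
    by apply: eq_leq; ring.
  rewrite -mulnDl leq_mul2r; apply/orP; right; lia.
have A5 : q <= 64 * d * x ^ 6.
  rewrite qE leq_mul2l; apply/orP; right; apply: leq_trans lx _.
  by rewrite -{1}[x]expn1 pw.
have assemble D p y a1 a2 s z k r : a1 <= 768 * p -> a2 <= 768 * y ->
    4 * s <= 768 * y -> z <= 900 * y -> k <= 64 * y ->
    D + (z + k) + 2 * (D + (a1 + a2) + 3 * s + (s + r)) <=
    3 * D + 1536 * p + 5000 * y + 2 * r by lia.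
rewrite [4 * S * (_ + _)]mulnDr [(3 + _) * _]mulnDl -(mulnA 1536) -(mulnA 5000).
by apply: assemble; rewrite ?[_ * (d * _)]mulnA.
Qed.

Lemma union_count lam : 0 < lam ->
  4 ^ lam * (2 * (lam.+1 * (width lam).-1) + 1) <= 2 ^ (20 * lam).
Proof.
move=> l0; set y := 2 ^ lam.
have y2 : 2 <= y by rewrite /y -{1}[2]expn1 leq_exp2l.
have ly : lam.+1 <= y := ltn_expl lam (isT : 1 < 2).
have wy : (width lam).-1 <= 2 * y ^ 3.
  rewrite /width addn2 /=; have h : lam.+1 ^ 3 <= y ^ 3 by rewrite leq_exp2r.
  have : 0 < y ^ 3 by rewrite expn_gt0; lia.
  by lia.
have -> : 4 ^ lam = y * y by rewrite (@expnMn 2 2).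
have h1 : lam.+1 * (width lam).-1 <= y * (2 * y ^ 3) by apply: leq_mul.
have h2 : 8 * y ^ 4 <= y ^ 3 * y ^ 4.
  by rewrite leq_mul2r (@leq_exp2r 2 y 3) ?y2 ?orbT.
have h3 : 0 < y ^ 4 by rewrite expn_gt0; lia.
have -> : 2 ^ (20 * lam) = y * y * (y ^ 11 * y ^ 7) by rewrite mulnC expnM -/y; ring.
rewrite leq_mul2l; apply/orP; right.
apply: leq_trans (_ : y ^ 7 <= _); last by rewrite leq_pmull // expn_gt0; lia.
rewrite (_ : y * (2 * y ^ 3) = 2 * y ^ 4) in h1; last by ring.
by rewrite (expnD y 3 4); lia.
Qed.

Local Open Scope ring_scope.

Lemma half_power j : (63 / 64) ^+ (64 * j) <= 2^-1 ^+ j :> rat.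
Proof.
rewrite exprM; apply: lerXn2r; rewrite ?nnegrE; [apply: exprn_ge0; lra | lra |].
have h1 : (63 / 64) ^+ 8 <= 9 / 10 :> rat by rewrite !exprS expr0; lra.
rewrite -[64%N]/(8 * 8)%N exprM.
apply: le_trans (_ : (9 / 10) ^+ 8 <= _); last by rewrite !exprS expr0; lra.
by apply: lerXn2r; rewrite ?nnegrE; [apply: exprn_ge0; lra | lra | exact: h1].
Qed.

Lemma error_bound c lam b n (q := repeats c lam) : (0 < lam)%N -> (b <= lam)%N ->
  (0 < n <= 2 ^ lam)%N ->
  tree_error lam (width lam) q + pattern_error lam q b <= 1 / n%:R ^+ c.
Proof.
move=> l0 bl /andP[n0 nl]; set h : rat := (63 / 64) ^+ q.
have h0 : 0 <= h by rewrite /h; apply: exprn_ge0; lra.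
have hq : h <= 2^-1 ^+ ((c + 20) * lam).
  by have := half_power ((c + 20) * lam); rewrite mulnA.
have tE : tree_error lam (width lam) q =
    h * (4 ^ lam * (2 * (lam.+1 * (width lam).-1)))%N%:R.
  rewrite /tree_error /tree_err -/h -!mulrnA -[LHS]mulr_natr -mulrA; congr (_ * _).
  by rewrite -natrX -natrM.
have pE : pattern_error lam q b <= h * (4 ^ lam)%N%:R.
  rewrite /pattern_error -/h; apply: ler_wpM2l; first exact: h0.
  rewrite -!natrX -natrM ler_nat (@expnMn 2 2) leq_mul2r leq_exp2l // bl.
  exact: orbT.
apply: le_trans (_ : h * (2 ^ (20 * lam))%N%:R <= _).
  apply: le_trans (_ : h * (4 ^ lam * (2 * (lam.+1 * (width lam).-1) + 1))%N%:R <= _).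
    by rewrite tE mulnDr muln1 natrD mulrDr lerD2l.
  by apply: ler_wpM2l; [exact: h0 | rewrite ler_nat; exact: union_count].
apply: le_trans (_ : 2^-1 ^+ ((c + 20) * lam) * (2 ^ (20 * lam))%N%:R <= _).
  by apply: ler_wpM2r; [exact: ler0n | exact: hq].
have z0 j : 0 < 2 ^+ j :> rat by apply: exprn_gt0.
have -> : 2^-1 ^+ ((c + 20) * lam) * (2 ^ (20 * lam))%N%:R = (2 ^+ (c * lam))^-1 :> rat.
  rewrite natrX mulnDl exprD !exprVn -mulrA mulVf ?mulr1 //.
  by rewrite gt_eqF.
rewrite div1r lef_pV2 ?posrE; [|exact: z0|by apply: exprn_gt0; rewrite ltr0n].
by rewrite -!natrX ler_nat mulnC expnM; case: (c) => [|c']; rewrite ?expn0 // leq_exp2r.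
Qed.

Local Close Scope ring_scope.

Lemma total_rounds_le c a e bd m g D Dhat lam k l
    (kap := up_log 2 a + e) (M := kap * (m * (4 * (64 * (c + 20) * (kap * m)))))
    (E := 192 * (c + 20) * M.+1 * (2 * kap)) :
  0 < lam -> lam <= kap * l -> Dhat <= bd * D -> 0 < l ->
  (3 + 1536 * (c + 20)) * Dhat + 5000 * (c + 20) * lam.+1 ^ 6 +
    2 * (192 * (c + 20) * M.+1 * (lam.+1 * num_packets k g)) <=
  ((3 + 1536 * (c + 20)) * bd + 5000 * (c + 20) * (2 * kap) ^ 6 +
     2 * E * (2 * g + 2) + 4 * E) * (D + k * l + l ^ 6).
Proof.
move=> l0 Hl HD l1.
have lx : lam.+1 <= 2 * kap * l by rewrite -mulnA; lia.
have A1 : (3 + 1536 * (c + 20)) * Dhat <= (3 + 1536 * (c + 20)) * bd * D.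
  by rewrite -[leqRHS]mulnA leq_mul2l HD orbT.
have A2 : 5000 * (c + 20) * lam.+1 ^ 6 <= 5000 * (c + 20) * (2 * kap) ^ 6 * l ^ 6.
  by rewrite -[leqRHS]mulnA leq_mul2l -expnMn leq_exp2r // lx orbT.
have A3 : 192 * (c + 20) * M.+1 * (lam.+1 * num_packets k g) <=
    E * ((2 * g + 2) * (k * l) + 2 * l ^ 6).
  rewrite /E -[leqRHS]mulnA leq_mul2l; apply/orP; right.
  apply: leq_trans (_ : 2 * kap * l * num_packets k g <= _).
    by rewrite leq_mul2r lx orbT.
  rewrite -mulnA leq_mul2l; apply/orP; right; rewrite /num_packets.
  have h : l <= l ^ 6 by rewrite -{1}[l]expn1 leq_pexp2l.
  rewrite mulnDr; apply: leq_add; last by rewrite mulnC leq_mul2l h.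
  by apply: eq_leq; ring.
set C1 := (3 + _) * bd in A1 *; set C3 := 5000 * _ * (2 * kap) ^ 6 in A2 *.
move: (k * l) (l ^ 6) A1 A2 A3 => y z A1 A2 A3.
apply: leq_trans (_ : C1 * D + C3 * z + 2 * (E * ((2 * g + 2) * y + 2 * z)) <= _).
  by apply: leq_add; [apply: leq_add | rewrite leq_mul2l A3].
have -> : (C1 + C3 + 2 * E * (2 * g + 2) + 4 * E) * (D + y + z) =
  (C1 * D + C3 * z + 2 * (E * ((2 * g + 2) * y + 2 * z))) +
  (C1 * (y + z) + C3 * (D + y) + 2 * E * (2 * g + 2) * (D + z) + 4 * E * (D + y)) by ring.
exact: leq_addr.
Qed.

End Bounds.

(* The first block of variables are the constants of the model: the exponent c
   of "with high probability", the polynomial bound a * n ^ e on N, the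
   approximation factor b of the diameter bound, the constant m hidden in
   B = Omega(log n), and the constant g bounding message sizes by g * B. *)
Theorem theorem3 :
  forall c a e b m g : nat, 1 <= c ->
  exists (A : algorithm) (C : nat),
  forall (V : finType) (adj : rel V) (s : V) (N Dhat B k : nat)
         (ms : k.-tuple bitseq),
    connected_graph adj ->
    #|V| <= N <= a * #|V| ^ e ->
    diameter adj <= Dhat <= b * diameter adj ->
    up_log 2 #|V| <= m * B ->
    (forall x : bitseq, x \in ms -> size x <= g * B) ->
    (1 - 1 / #|V|%:R ^+ c <=
       success_prob adj s (A N Dhat B) ms
         (broadcast_rounds C (diameter adj) k #|V|))%R.
Proof.
move=> c a e b m g c1.
pose kap := up_log 2 a + e.
pose M := kap * (m * (4 * (64 * (c + 20) * (kap * m)))).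
pose E := 192 * (c + 20) * M.+1 * (2 * kap).
exists (fun N Dhat B => let lam := up_log 2 N in
  broadcast B Dhat lam (width lam) (repeats c lam) (repeats c lam) (batch_size c lam B)).
exists ((3 + 1536 * (c + 20)) * b + 5000 * (c + 20) * (2 * kap) ^ 6 +
     2 * E * (2 * g + 2) + 4 * E).
move=> V adj s N Dhat B k ms [adjC _ conn] /andP[nN Na] /andP[dD Db] lB gB.
set T := broadcast_rounds _ _ _ _; set lam := up_log 2 N; set n := #|V|.
have n0 : 0 < n by apply/card_gt0P; exists s.
(* For a single node the required probability is 0; beyond that, logarithms are positive. *)
have [n1|n1] := leqP n 1.
  have -> : n = 1 by lia.
  rewrite expr1n divr1 subrr /success_prob /uniform_prob.
  by rewrite mulr_ge0 ?invr_ge0 ?ler0n.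
have l1 : 0 < up_log 2 n by rewrite up_log_gt0.
have B0 : 0 < B by rewrite lt0n; apply/eqP => E0; move: lB; rewrite E0 muln0 leqNgt l1.
have lamN : N <= 2 ^ lam by apply: up_logP.
have lam0 : 0 < lam by rewrite up_log_gt0; apply: leq_trans nN.
have laml : lam <= kap * up_log 2 n by apply: up_log_poly.
have bq : batch_size c lam B <= lam by rewrite /batch_size; case: ifP.
have lq : lam <= repeats c lam by rewrite /repeats leq_pmull // muln_gt0 addnS.
have code : batch_size c lam B = 1 \/ 0 < B /\ repeats c lam <= 2 ^ B.
  by rewrite /batch_size; case: ifP; [right | left].
have HM : ~~ (repeats c lam <= 2 ^ B) -> lam <= M by exact: batch_size_small laml lB.
have fits := ser_fits c lam0 B0 (size_tuple ms) gB.
apply: (@le_trans _ _ (1 - (tree_error lam (width lam) (repeats c lam) +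
    pattern_error lam (repeats c lam) (batch_size c lam B)))%R).
  by rewrite lerD2l lerN2; apply: error_bound => //; rewrite n0 (leq_trans nN).
apply: (broadcast_success (P := repeats c lam) s adjC conn dD
  (leq_trans nN lamN) (width_gt2 lam) _ _ (leq_trans bq lq) code fits).
- exact: leq_trans lam0 lq.
- exact: batch_size_gt0.
rewrite /T /broadcast_rounds; apply: leq_trans _
  (@total_rounds_le c a e b m g _ Dhat lam k (up_log 2 n) lam0 laml Db l1).
apply: leq_trans _ (total_rounds c Dhat _ lam0).
rewrite leq_add2l leq_mul2l leq_add2l; apply/orP; right.
exact: (stage_batches k g lam0 HM).
Qed.
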